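(* Let $A$ be a strongly admissible monoid in a cofibrantly generated symmetric monoidal model category $\mathcal{C}$, let $\mathrm{Mod}(A)$ be the category of $A$-modules with forgetful functor $U\colon\mathrm{Mod}(A)\to\mathcal{C}$, and let $\mathcal{K}$ be a set of isomorphism classes of objects of $\mathrm{Ho}(\mathcal{C})$. Suppose that $A\otimes^{\mathbf{L}}\mathcal{K}$ is underlying $\mathcal{K}$-colocal and that $\mathrm{Mod}(A)$ has a good $A\otimes^{\mathbf{L}}\mathcal{K}$-colocalization. If $M'\to M$ is an $A\otimes^{\mathbf{L}}\mathcal{K}$-colocalization of $M\in\mathrm{Mod}(A)$, then $UM'\to UM$ is a $\mathcal{K}$-colocalization in $\mathcal{C}$.
   Context: In a cofibrantly generated model category the (co)domains of the generating (trivial) cofibrations are assumed small relative to the cellular maps they generate. $\mathcal{C}$ is (cocomplete, closed) symmetric monoidal with tensor $\otimes$ and unit $I$. Strongly admissible monoids. For a monoid $A$ in $\mathcal{C}$ let $\mathcal{O}_A$ be the (one-colored) operad with $\mathcal{O}_A(1)=A$ and $\mathcal{O}_A(n)=0$ (initial object) for $n\neq1$; its algebras are the $A$-modules. An operad is admissible if the model structure of $\mathcal{C}$ transfers along the free-forgetful adjunction to a cofibrantly generated model structure on its algebras; for $\mathcal{O}_A$ this means that $\mathrm{Mod}(A)$ has a cofibrantly generated model structure whose weak equivalences and fibrations are detected in $\mathcal{C}$. $A$ is strongly admissible if there are a monoid $A'$ and a monoid map $\varphi\colon A'\to A$ that is a weak equivalence in $\mathcal{C}$ such that $\mathcal{O}_A$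 and $\mathcal{O}_{A'}$ are admissible, the induced adjunction $\varphi_!\colon\mathrm{Mod}(A')\rightleftarrows\mathrm{Mod}(A)\colon\varphi^*$ is a Quillen equivalence, and either (i) $\mathcal{O}_{A'}$ has an underlying cofibrant collection, i.e. $A'$ is cofibrant in $\mathcal{C}$; or (ii) $\mathcal{O}_{A'}$ has an underlying cofibrant pointed collection, i.e. the unit map $I\to A'$ is a cofibration in $\mathcal{C}$, and $\mathcal{C}$ has an additional cofibrantly generated symmetric monoidal model structure with the same weak equivalences and cofibrant unit. Colocalization. For a model category $\mathcal{D}$, $\mathrm{map}(X,Y)$ denotes the derived mapping space (homotopy function complex; if $\mathcal{D}$ is simplicial it is $\mathrm{Map}(QX,RY)$ with $Q$, $R$ cofibrant and fibrant replacement). Let $\mathcal{K}$ be a set of isomorphism classes of objects of $\mathrm{Ho}(\mathcal{D})$. A map $X\to Y$ is a $\mathcal{K}$-colocal equivalence if $\mathrm{map}(K,X)\to\mathrm{map}(K,Y)$ is an isomorphism in $\mathrm{Ho}(s\mathrm{Sets})$ for all $K\in\mathcal{K}$. An object $W$ is $\mathcal{K}$-colocal if $\mathrm{map}(W,X)\to\mathrm{map}(W,Y)$ is an isomorphism in $\mathrm{Ho}(s\mathrm{Sets})$ for every $\mathcal{K}$-colocal equivalence $X\to Y$. A $\mathcal{K}$-colocalization of $X$ is a $\mathcal{K}$-colocal equivalence $X'\to X$ with $X'$ $\mathcal{K}$-colocal. $\mathcal{D}$ has a good $\mathcal{K}$-colocalization if the fibrations of $\mathcal{D}$ and the $\mathcal{K}$-colocal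 equivalences define a model structure on $\mathcal{D}$ and the $\mathcal{K}$-colocal objects are generated under homotopy colimits by the objects of $\mathcal{K}$. $A\otimes^{\mathbf{L}}\mathcal{K}$ is the set of isomorphism classes of objects of $\mathrm{Ho}(\mathrm{Mod}(A))$ obtained from $\mathcal{K}$ by applying the left derived functor of the free module functor $X\mapsto A\otimes X$. An $A$-module is underlying $\mathcal{K}$-colocal if $U$ of it is $\mathcal{K}$-colocal in $\mathcal{C}$; $A\otimes^{\mathbf{L}}\mathcal{K}$ is underlying $\mathcal{K}$-colocal if all its elements are. *)

(* Defs.v *)
(* Category theory is set up from scratch; the only library notions used are
   the finite ordinals of MathComp and some relations and axioms of Stdlib. *)
From mathcomp Require Import all_boot.
From Stdlib Require Import Relations FunctionalExtensionality
  PropExtensionality ProofIrrelevance.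

Set Implicit Arguments.
Unset Strict Implicit.
Unset Printing Implicit Defensive.
Set Primitive Projections.

(** * Categories *)

(* The universe of sets.  Categories are locally small with respect to it, and
   "a set of" objects or maps means a family indexed by a type in [small]. *)
Definition small := Type.

Record category := Category {
  ob : Type;
  hom : ob -> ob -> small;
  idm : forall x, hom x x;
  comp : forall x y z, hom y z -> hom x y -> hom x z;
  comp1m : forall x y (f : hom x y), comp (idm y) f = f;
  compm1 : forall x y (f : hom x y), comp f (idm x) = f;
  compA : forall x y z t (h : hom z t) (g : hom y z) (f : hom x y),
    comp h (comp g f) = comp (comp h g) f
}.
Arguments hom {_} _ _.
Arguments idm {_} _.
Arguments comp {_ _ _ _} _ _.

Notation "g '∘' f" := (comp g f) (at level 40, left associativity).

Record functor (C D : category) := Functor {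
  fob :> ob C -> ob D;
  fmap : forall x y, hom x y -> hom (fob x) (fob y);
  fmap1 : forall x, fmap (idm x) = idm (fob x);
  fmapM : forall x y z (g : @hom C y z) (f : hom x y),
    fmap (g ∘ f) = fmap g ∘ fmap f
}.
Arguments fmap {C D} _ {x y} _.

Record nat_trans (C D : category) (F G : functor C D) := NatTrans {
  ntc :> forall x, hom (F x) (G x);
  nt_nat : forall x y (f : hom x y), ntc y ∘ fmap F f = fmap G f ∘ ntc x
}.

Record adjunction (C D : category) (L : functor C D) (R : functor D C) :=
  Adjunction {
  adj : forall x y, hom (L x) y -> hom x (R y);
  adj_inv : forall x y, hom x (R y) -> hom (L x) y;
  adjK : forall x y (f : hom (L x) y), adj_inv (adj f) = f;
  adj_invK : forall x y (f : hom x (R y)), adj (adj_inv f) = f;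
  adj_natl : forall x x' y (u : hom x' x) (f : hom (L x) y),
    adj (f ∘ fmap L u) = adj f ∘ u;
  adj_natr : forall x y y' (v : hom y y') (f : hom (L x) y),
    adj (v ∘ f) = fmap R v ∘ adj f
}.
Arguments adj {C D L R} _ {x y} _.

Definition is_iso (C : category) (x y : ob C) (f : hom x y) : Prop :=
  exists g : hom y x, g ∘ f = idm x /\ f ∘ g = idm y.

(* a class of maps *)
Definition mclass (C : category) := forall x y : ob C, hom x y -> Prop.

(** ** Limits and colimits *)

Definition is_small (J : category) : Prop :=
  exists (T : small) (e : T -> ob J), forall j, exists t, e t = j.

Definition is_cocone (J C : category) (F : functor J C) (x : ob C)
    (l : forall j, hom (F j) x) : Prop :=
  forall i j (u : hom i j), l j ∘ fmap F u = l i.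

Definition is_colimit (J C : category) (F : functor J C) (x : ob C)
    (l : forall j, hom (F j) x) : Prop :=
  is_cocone l /\
  forall y (m : forall j, hom (F j) y), is_cocone m ->
    exists! h : hom x y, forall j, h ∘ l j = m j.

Definition is_cone (J C : category) (F : functor J C) (x : ob C)
    (l : forall j, hom x (F j)) : Prop :=
  forall i j (u : hom i j), fmap F u ∘ l i = l j.

Definition is_limit (J C : category) (F : functor J C) (x : ob C)
    (l : forall j, hom x (F j)) : Prop :=
  is_cone l /\
  forall y (m : forall j, hom y (F j)), is_cone m ->
    exists! h : hom y x, forall j, l j ∘ h = m j.

Definition cocomplete (C : category) : Prop :=
  forall (J : category) (F : functor J C), is_small J ->
    exists (x : ob C) (l : forall j, hom (F j) x), is_colimit l.

Definition complete (C : category) : Prop :=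
  forall (J : category) (F : functor J C), is_small J ->
    exists (x : ob C) (l : forall j, hom x (F j)), is_limit l.

Definition is_initial (C : category) (o : ob C) : Prop :=
  forall x, exists! f : hom o x, True.

Definition is_terminal (C : category) (o : ob C) : Prop :=
  forall x, exists! f : hom x o, True.

(* p and q exhibit d as the pushout of  b <-f- a -g-> c *)
Definition is_pushout (C : category) (a b c d : ob C) (f : hom a b)
    (g : hom a c) (p : hom b d) (q : hom c d) : Prop :=
  p ∘ f = q ∘ g /\
  forall y (p' : hom b y) (q' : hom c y), p' ∘ f = q' ∘ g ->
    exists! h : hom d y, h ∘ p = p' /\ h ∘ q = q'.

(** * Zigzags, localization and the homotopy category *)

Section Zigzags.
Variables (C : category) (W : mclass C).

Inductive zigzag : ob C -> ob C -> Type :=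
| zz_nil x : zigzag x x
| zz_fwd x y z (f : hom x y) (p : zigzag y z) : zigzag x z
| zz_bwd x y z (w : hom y x) (hw : W w) (p : zigzag y z) : zigzag x z.

Fixpoint zz_cat x y z (p : zigzag x y) : zigzag y z -> zigzag x z :=
  match p in zigzag x y return zigzag y z -> zigzag x z with
  | zz_nil _ => fun q => q
  | zz_fwd _ _ _ f p => fun q => zz_fwd f (zz_cat p q)
  | zz_bwd _ _ _ w hw p => fun q => zz_bwd hw (zz_cat p q)
  end.

(* Adjacent maps in the same direction are composed, identities are omitted. *)
Inductive zz_reduce : forall x y, zigzag x y -> zigzag x y -> Prop :=
| zzr_fwd1 x y (p : zigzag x y) : zz_reduce (zz_fwd (idm x) p) p
| zzr_fwdM x y z t (f : hom x y) (g : hom y z) (p : zigzag z t) :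
    zz_reduce (zz_fwd f (zz_fwd g p)) (zz_fwd (g ∘ f) p)
| zzr_bwd1 x y (h1 : W (idm x)) (p : zigzag x y) : zz_reduce (zz_bwd h1 p) p
| zzr_bwdM x y z t (f : hom y x) (g : hom z y) (hf : W f) (hg : W g)
    (hfg : W (f ∘ g)) (p : zigzag z t) :
    zz_reduce (zz_bwd hf (zz_bwd hg p)) (zz_bwd hfg p).

(* Formal inverses are made into inverses. *)
Inductive zz_invert : forall x y, zigzag x y -> zigzag x y -> Prop :=
| zzi_reduce x y (p q : zigzag x y) : zz_reduce p q -> zz_invert p q
| zzi_fwd_bwd x y z (w : hom x y) (hw : W w) (p : zigzag x z) :
    zz_invert (zz_fwd w (zz_bwd hw p)) p
| zzi_bwd_fwd x y z (w : hom y x) (hw : W w) (p : zigzag x z) :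
    zz_invert (zz_bwd hw (zz_fwd w p)) p.

Section Context.
Variable B : forall x y, zigzag x y -> zigzag x y -> Prop.

Inductive zz_step : forall x y, zigzag x y -> zigzag x y -> Prop :=
| zzs_base x y (p q : zigzag x y) : B p q -> zz_step p q
| zzs_fwd x y z (f : hom x y) (p q : zigzag y z) :
    zz_step p q -> zz_step (zz_fwd f p) (zz_fwd f q)
| zzs_bwd x y z (w : hom y x) (hw : W w) (p q : zigzag y z) :
    zz_step p q -> zz_step (zz_bwd hw p) (zz_bwd hw q).

Lemma zz_step_cat x y z (p q : zigzag x y) (r : zigzag y z) :
  (forall a b (u v : zigzag a b) c (s : zigzag b c),
     B u v -> B (zz_cat u s) (zz_cat v s)) ->
  zz_step p q -> zz_step (zz_cat p r) (zz_cat q r).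
Proof.
move=> HB s; move: z r.
induction s as [x y p q b|x y t f p q _ IH|x y t w hw p q _ IH] => z r /=.
- exact/zzs_base/HB.
- exact/zzs_fwd/IH.
- exact/zzs_bwd/IH.
Qed.

End Context.

Lemma zz_reduce_cat x y (p q : zigzag x y) z (r : zigzag y z) :
  zz_reduce p q -> zz_reduce (zz_cat p r) (zz_cat q r).
Proof. by move=> h; move: z r; case: h => *; constructor. Qed.

(* Maps of Ho(C) = C[W^-1] are zigzags modulo [ho_eq]. *)
Definition ho_eq x y : relation (zigzag x y) :=
  clos_refl_sym_trans _ (@zz_step zz_invert x y).

Definition ho_iso (x y : ob C) : Prop :=
  exists (p : zigzag x y) (q : zigzag y x),
    ho_eq (zz_cat p q) (zz_nil x) /\ ho_eq (zz_cat q p) (zz_nil y).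

End Zigzags.
Arguments zz_nil {C W} x.

Fixpoint zz_map (C D : category) (F : functor C D) (V : mclass C) (W : mclass D)
    (h : forall x y (f : hom x y), V x y f -> W _ _ (fmap F f))
    x y (p : zigzag V x y) : zigzag W (F x) (F y) :=
  match p in zigzag _ x y return zigzag W (F x) (F y) with
  | zz_nil x => zz_nil (F x)
  | zz_fwd _ _ _ f p => zz_fwd (fmap F f) (zz_map h p)
  | zz_bwd _ _ _ w hw p => zz_bwd (h _ _ w hw) (zz_map h p)
  end.

Lemma zz_map_cat (C D : category) (F : functor C D) (V : mclass C)
    (W : mclass D) (h : forall x y (f : hom x y), V x y f -> W _ _ (fmap F f))
    x y z (p : zigzag V x y) (q : zigzag V y z) :
  zz_map h (zz_cat p q) = zz_cat (zz_map h p) (zz_map h q).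
Proof. by move: z q; elim: p => //= ? ? ? ? => [|?] p IH z q; rewrite IH. Qed.

Lemma zz_step_map (C D : category) (F : functor C D) (V : mclass C)
    (W : mclass D) (h : forall x y (f : hom x y), V x y f -> W _ _ (fmap F f))
    x y (p q : zigzag V x y) :
  zz_step (@zz_reduce _ V) p q ->
  zz_step (@zz_reduce _ W) (zz_map h p) (zz_map h q).
Proof.
elim=> {x y p q} [x y p q b|x y t f p q _ IH|x y t w hw p q _ IH] /=;
  [|exact: zzs_fwd|exact: zzs_bwd].
apply: zzs_base; case: b => {x y p q} /=.
- by move=> x y p; rewrite fmap1; constructor.
- by move=> x y z t f g p; rewrite fmapM; constructor.
- by move=> x y h1 p; move: (h _ _ _ h1); rewrite fmap1; constructor.
- move=> x y z t f g hf hg hfg p; move: (h _ _ _ hfg); rewrite fmapM => k.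
  by constructor.
Qed.

(** * Quotients *)

(* Elements of the quotient are equivalence classes, as predicates. *)
Definition quot (T : Type) (R : relation T) : Type :=
  {P : T -> Prop | exists t, P = clos_refl_sym_trans _ R t}.

Section Quotients.
Variables (S T : Type) (RS : relation S) (RT : relation T).

Definition qclass (t : T) : quot RT :=
  exist _ (clos_refl_sym_trans _ RT t) (ex_intro _ t erefl).

Lemma qclassP (s t : T) : clos_refl_sym_trans _ RT s t -> qclass s = qclass t.
Proof.
move=> st; apply: subset_eq_compat; apply: functional_extensionality => u.
apply: propositional_extensionality; split=> h; apply: rst_trans h => //.
exact: rst_sym.
Qed.

Lemma qclass_surj (q : quot RT) : exists t, q = qclass t.
Proof. by case: q => P [t Pt]; exists t; apply: subset_eq_compat. Qed.

Variables (f : S -> T) (hf : forall s t, RS s t -> RT (f s) (f t)).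

Lemma clos_map s t :
  clos_refl_sym_trans _ RS s t -> clos_refl_sym_trans _ RT (f s) (f t).
Proof.
elim=> {s t} [s t /hf|s|s t _|s t u _ h1 _ h2].
- exact: rst_step.
- exact: rst_refl.
- exact: rst_sym.
- exact: rst_trans h1 h2.
Qed.

Lemma quot_map_subproof (q : quot RS) :
  exists t, (fun u => exists2 s, proj1_sig q s & clos_refl_sym_trans _ RT (f s) u)
            = clos_refl_sym_trans _ RT t.
Proof.
case: q => P [s Ps] /=; rewrite {P}Ps; exists (f s); apply: functional_extensionality => u.
apply: propositional_extensionality; split=> [[s' h1 h2]|h].
  exact: rst_trans (clos_map h1) h2.
by exists s => //; apply: rst_refl.
Qed.

Definition quot_map (q : quot RS) : quot RT := exist _ _ (quot_map_subproof q).

End Quotients.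

Lemma quot_mapE S T (RS : relation S) (RT : relation T) (f : S -> T)
    (hf : forall s t, RS s t -> RT (f s) (f t)) s :
  quot_map hf (qclass RS s) = qclass RT (f s).
Proof.
apply: subset_eq_compat; apply: functional_extensionality => u.
apply: propositional_extensionality; split=> [[s' /= h1 h2]|h].
  exact: rst_trans (clos_map hf h1) h2.
by exists s => //; apply: rst_refl.
Qed.

(** * Simplicial sets *)

Record mono (m n : nat) := Mono {
  mfun :> 'I_m.+1 -> 'I_n.+1;
  mono_le : forall i j : 'I_m.+1, i <= j -> mfun i <= mfun j
}.

Definition mono_id n : mono n n := @Mono n n id (fun _ _ h => h).

Definition mono_comp m n p (g : mono n p) (f : mono m n) : mono m p :=
  @Mono m p (fun i => g (f i)) (fun i j h => mono_le g (mono_le f h)).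

Definition mono_const m n (i : 'I_n.+1) : mono m n :=
  @Mono m n (fun=> i) (fun _ _ _ => leqnn i).

Lemma mono_eq m n (f g : mono m n) : (forall i, f i = g i) -> f = g.
Proof.
case: f g => f hf [g hg] /= /functional_extensionality fg.
by case: g / fg hg => hg; congr Mono; apply: proof_irrelevance.
Qed.

Record sset := SSet {
  sx :> nat -> Type;
  sact : forall m n, mono m n -> sx n -> sx m;
  sact1 : forall n (x : sx n), sact (mono_id n) x = x;
  sactM : forall m n p (g : mono n p) (f : mono m n) (x : sx p),
    sact (mono_comp g f) x = sact f (sact g x)
}.
Arguments sact {_ m n} _ _.

Record smap (X Y : sset) := SMap {
  sfun :> forall n, X n -> Y n;
  sfun_act : forall m n (f : mono m n) (x : X n),
    sfun (sact f x) = sact f (sfun x)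
}.
Arguments sfun {X Y} _ {n} _.

Definition smap_comp X Y Z (g : smap Y Z) (f : smap X Y) : smap X Z.
Proof.
refine (@SMap X Z (fun n x => g n (f n x)) _) => m n t x.
by rewrite !sfun_act.
Defined.

Definition sprod (X Y : sset) : sset.
Proof.
refine (@SSet (fun n => (X n * Y n)%type)
          (fun m n f xy => (sact f xy.1, sact f xy.2)) _ _).
- by move=> n [x y] /=; rewrite !sact1.
- by move=> m n p g f [x y] /=; rewrite !sactM.
Defined.

Definition simplex (n : nat) : sset.
Proof. exact: (@SSet (fun m => mono m n) (fun k m f g => mono_comp g f)). Defined.

(* the simplices of the horn: those lying in the i-th face for some i != k *)
Definition in_horn n (k : 'I_n.+1) m (f : mono m n) : Prop :=
  exists2 i, i != k & forall j, f j != i.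

Lemma in_horn_act n (k : 'I_n.+1) m p (f : mono m p) (x : mono p n) :
  in_horn k x -> in_horn k (mono_comp x f).
Proof. by case=> i ik xi; exists i => // j; apply: xi. Qed.

Definition horn (n : nat) (k : 'I_n.+1) : sset.
Proof.
refine (@SSet (fun m => {x : mono m n | in_horn k x})
  (fun m p f x => exist _ _ (in_horn_act f (proj2_sig x))) _ _).
- by move=> m x; case: x => x hx; apply: subset_eq_compat.
- by move=> m p q g f x; case: x => x hx; apply: subset_eq_compat.
Defined.

Definition horn_incl (n : nat) (k : 'I_n.+1) : smap (horn k) (simplex n).
Proof. by refine (@SMap (horn k) (simplex n) (fun m x => proj1_sig x) _). Defined.

Definition is_kan (X : sset) : Prop :=
  forall n (k : 'I_n.+2) (h : smap (horn k) X),
    exists s : smap (simplex n.+1) X, smap_comp s (horn_incl k) = h.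

Definition elem_homotopic (X Y : sset) (f g : smap X Y) : Prop :=
  exists H : smap (sprod X (simplex 1)) Y,
    forall n (x : X n), H n (x, mono_const n ord0) = f n x /\
                        H n (x, mono_const n ord_max) = g n x.

Definition homotopic (X Y : sset) : relation (smap X Y) :=
  clos_refl_sym_trans _ (@elem_homotopic X Y).

(* Weak homotopy equivalences (the maps that become isomorphisms in
   Ho(sSets)): f : X -> Y such that f^* : pi_0 (Z^Y) -> pi_0 (Z^X) is bijective
   for every Kan complex Z. *)
Definition sset_weq (X Y : sset) (f : smap X Y) : Prop :=
  forall Z : sset, is_kan Z ->
    (forall g : smap X Z, exists h : smap Y Z, homotopic (smap_comp h f) g) /\
    (forall h h' : smap Y Z,
       homotopic (smap_comp h f) (smap_comp h' f) -> homotopic h h').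

(** * Derived mapping spaces *)

Section Hammocks.
Variable C : category.

(* A wide class of weak equivalences. *)
Record wclass := WClass {
  wmap : forall x y : ob C, hom x y -> Prop;
  wmap1 : forall x : ob C, wmap (idm x)
}.

Variable W : wclass.

(* functors from the poset [k] = {0 <= ... <= k} to C all of whose values are
   weak equivalences *)
Record chain (k : nat) := Chain {
  ch :> 'I_k.+1 -> ob C;
  chm : forall i j : 'I_k.+1, i <= j -> hom (ch i) (ch j);
  chm1 : forall (i : 'I_k.+1) (h : i <= i), chm h = idm (ch i);
  chmM : forall (i j l : 'I_k.+1) (hij : i <= j) (hjl : j <= l) (hil : i <= l),
    chm hil = chm hjl ∘ chm hij;
  chmW : forall (i j : 'I_k.+1) (h : i <= j), wmap W (chm h)
}.

Record chain_map (k : nat) (F G : chain k) := ChainMap {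
  cm :> forall i, hom (F i) (G i);
  cm_nat : forall (i j : 'I_k.+1) (h : i <= j), cm j ∘ chm F h = chm G h ∘ cm i
}.

Lemma chain_map_eq k (F G : chain k) (s t : chain_map F G) :
  (forall i, s i = t i) -> s = t.
Proof.
case: s t => s hs [t ht] /= st.
have {}st : s = t by apply: functional_extensionality_dep.
by case: t / st ht => ht; congr ChainMap; apply: proof_irrelevance.
Qed.

Definition chain_cat (k : nat) : category.
Proof.
unshelve refine (@Category (chain k) (@chain_map k)
  (fun F => @ChainMap k F F (fun i => idm (F i)) _)
  (fun F G H t s => @ChainMap k F H (fun i => t i ∘ s i) _) _ _ _).
- by move=> i j h; rewrite comp1m compm1.
- by move=> i j h; rewrite -compA cm_nat !compA cm_nat.
- by move=> F G f; apply: chain_map_eq => i /=; rewrite comp1m.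
- by move=> F G f; apply: chain_map_eq => i /=; rewrite compm1.
- by move=> F G H K h g f; apply: chain_map_eq => i /=; rewrite compA.
Defined.

Definition chain_weq (k : nat) : mclass (chain_cat k) :=
  fun F G t => forall i, wmap W (cm t i).

Definition chain_res_ob m n (f : mono m n) (F : chain n) : chain m :=
  @Chain m (fun i => F (f i)) (fun i j h => chm F (mono_le f h))
    (fun i h => chm1 F (mono_le f h))
    (fun i j l h1 h2 h3 => chmM F (mono_le f h1) (mono_le f h2) (mono_le f h3))
    (fun i j h => chmW F (mono_le f h)).

Definition chain_res m n (f : mono m n) : functor (chain_cat n) (chain_cat m).
Proof.
refine (@Functor (chain_cat n) (chain_cat m) (chain_res_ob f)
  (fun F G t => @ChainMap m (chain_res_ob f F) (chain_res_ob f G)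
     (fun i => cm t (f i)) (fun i j h => cm_nat t (mono_le f h))) _ _).
- by move=> F; apply: chain_map_eq.
- by move=> F G H t s; apply: chain_map_eq.
Defined.

Definition chain_const_ob (k : nat) (x : ob C) : chain k :=
  @Chain k (fun=> x) (fun _ _ _ => idm x) (fun _ _ => erefl)
    (fun _ _ _ _ _ _ => esym (comp1m (idm x))) (fun _ _ _ => wmap1 W x).

Definition chain_const (k : nat) : functor C (chain_cat k).
Proof.
refine (@Functor C (chain_cat k) (chain_const_ob k)
  (fun x y f => @ChainMap k (chain_const_ob k x) (chain_const_ob k y) (fun=> f)
     (fun _ _ _ => etrans (compm1 f) (esym (comp1m f)))) _ _).
- by move=> x; apply: chain_map_eq.
- by move=> x y z g f; apply: chain_map_eq.
Defined.

(* The simplicial set of maps from x to y in the hammock localization of Dwyer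
   and Kan.  A k-simplex is a hammock of width k from x to y, whose columns are
   maps of chains of weak equivalences; two hammocks are identified if they have
   the same reduced form. *)
Definition hammock k (x y : ob C) :=
  zigzag (@chain_weq k) (chain_const k x) (chain_const k y).

Definition hammock_step k (x y : ob C) : relation (hammock k x y) :=
  @zz_step _ _ (@zz_reduce _ (@chain_weq k)) _ _.

Definition chain_res_weq m n (f : mono m n) (F G : ob (chain_cat n))
    (t : hom F G) (ht : chain_weq t) : chain_weq (fmap (chain_res f) t) :=
  fun i => ht (f i).

Definition hammock_res m n (f : mono m n) x y (p : hammock n x y) :
    hammock m x y :=
  zz_map (@chain_res_weq m n f) p.

Lemma hammock_res_step m n (f : mono m n) x y (p q : hammock n x y) :
  hammock_step p q -> hammock_step (hammock_res f p) (hammock_res f q).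
Proof. exact: (@zz_step_map _ _ _ _ _ (@chain_res_weq m n f) _ _ p q). Qed.

Lemma zz_map_res1 n (F G : chain n) (p : zigzag (@chain_weq n) F G) :
  zz_map (@chain_res_weq n n (mono_id n)) p = p.
Proof. by elim: p => //= ? ? ? ? => [|?] p IH; rewrite IH. Qed.

Lemma zz_map_resM m n k (g : mono n k) (f : mono m n) (F G : chain k)
    (p : zigzag (@chain_weq k) F G) :
  zz_map (@chain_res_weq m k (mono_comp g f)) p =
  zz_map (@chain_res_weq m n f) (zz_map (@chain_res_weq n k g) p).
Proof. by elim: p => //= ? ? ? ? => [|?] p IH; rewrite IH. Qed.

Definition map_space (x y : ob C) : sset.
Proof.
refine (@SSet (fun k => quot (@hammock_step k x y))
  (fun m n f => quot_map (@hammock_res_step m n f x y)) _ _).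
- move=> n q; case: (qclass_surj q) => p ->; rewrite quot_mapE.
  congr qclass; exact: (@zz_map_res1 n _ _ p).
- move=> m n k g f q; case: (qclass_surj q) => p ->; rewrite !quot_mapE.
  congr qclass; exact: (@zz_map_resM m n k g f _ _ p).
Defined.

Definition hammock_post k x y z (f : hom y z) (p : hammock k x y) :
    hammock k x z :=
  zz_cat p (zz_fwd (fmap (chain_const k) f) (zz_nil _)).

Lemma hammock_post_step k x y z (f : hom y z) (p q : hammock k x y) :
  hammock_step p q -> hammock_step (hammock_post f p) (hammock_post f q).
Proof. by apply: zz_step_cat => a b u v c s; apply: zz_reduce_cat. Qed.

(* map(x, f) : map(x, y) -> map(x, z) *)
Definition map_post x y z (f : hom y z) : smap (map_space x y) (map_space x z).
Proof.
refine (@SMap (map_space x y) (map_space x z)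
          (fun k => quot_map (@hammock_post_step k x y z f)) _).
move=> m n t q; case: (qclass_surj q) => p ->; rewrite /= !quot_mapE.
congr qclass; by rewrite /hammock_res /hammock_post zz_map_cat.
Defined.

End Hammocks.

(** * Model categories *)

(* Three classes of maps, not yet subject to the axioms. *)
Record premodel (C : category) := Premodel {
  weq : wclass C;
  cof : mclass C;
  fib : mclass C
}.
Arguments weq {C} _.
Arguments cof {C} _ {x y} _ : rename.
Arguments fib {C} _ {x y} _ : rename.

Notation is_weq M f := (wmap (weq M) f).

Section ModelStructures.
Variable C : category.
Implicit Types (M : premodel C) (P Q : mclass C).

Definition lifts (a b x y : ob C) (i : hom a b) (p : hom x y) : Prop :=
  forall (u : hom a x) (v : hom b y), p ∘ u = v ∘ i ->
    exists h : hom b x, h ∘ i = u /\ p ∘ h = v.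

(* maps with the left (right) lifting property with respect to P *)
Definition llp P : mclass C :=
  fun a b i => forall x y (p : hom x y), P _ _ p -> lifts i p.
Definition rlp P : mclass C :=
  fun x y p => forall a b (i : hom a b), P _ _ i -> lifts i p.

Definition tcof M : mclass C := fun x y f => cof M f /\ is_weq M f.
Definition tfib M : mclass C := fun x y f => fib M f /\ is_weq M f.

Definition two_of_three P : Prop :=
  forall x y z (g : hom y z) (f : hom x y),
    [/\ P _ _ f -> P _ _ g -> P _ _ (g ∘ f),
        P _ _ f -> P _ _ (g ∘ f) -> P _ _ g &
        P _ _ g -> P _ _ (g ∘ f) -> P _ _ f].

Definition is_retract (a b x y : ob C) (f : hom a b) (g : hom x y) : Prop :=
  exists (i : hom a x) (r : hom x a) (j : hom b y) (s : hom y b),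
    [/\ r ∘ i = idm a, s ∘ j = idm b, g ∘ i = j ∘ f & f ∘ r = s ∘ g].

Definition retract_closed P : Prop :=
  forall a b x y (f : hom a b) (g : hom x y),
    is_retract f g -> P _ _ g -> P _ _ f.

(* every map f factors functorially as [ff_r f ∘ ff_l f] *)
Record functorial_factorization P Q := FunctorialFactorization {
  ff_ob : forall x y : ob C, hom x y -> ob C;
  ff_l : forall x y (f : hom x y), hom x (ff_ob f);
  ff_r : forall x y (f : hom x y), hom (ff_ob f) y;
  ff_fac : forall x y (f : hom x y), ff_r f ∘ ff_l f = f;
  ff_lP : forall x y (f : hom x y), P _ _ (ff_l f);
  ff_rQ : forall x y (f : hom x y), Q _ _ (ff_r f);
  ff_map : forall x y x' y' (f : hom x y) (f' : hom x' y') (u : hom x x')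
    (v : hom y y'), f' ∘ u = v ∘ f -> hom (ff_ob f) (ff_ob f');
  ff_map_l : forall x y x' y' (f : hom x y) (f' : hom x' y') (u : hom x x')
    (v : hom y y') (e : f' ∘ u = v ∘ f), ff_map e ∘ ff_l f = ff_l f' ∘ u;
  ff_map_r : forall x y x' y' (f : hom x y) (f' : hom x' y') (u : hom x x')
    (v : hom y y') (e : f' ∘ u = v ∘ f), ff_r f' ∘ ff_map e = v ∘ ff_r f;
  ff_map1 : forall x y (f : hom x y) (e : f ∘ idm x = idm y ∘ f),
    ff_map e = idm (ff_ob f);
  ff_mapM : forall x y x' y' x'' y'' (f : hom x y) (f' : hom x' y')
    (f'' : hom x'' y'') (u : hom x x') (v : hom y y') (u' : hom x' x'')
    (v' : hom y' y'') (e : f' ∘ u = v ∘ f) (e' : f'' ∘ u' = v' ∘ f')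
    (e'' : f'' ∘ (u' ∘ u) = (v' ∘ v) ∘ f), ff_map e'' = ff_map e' ∘ ff_map e
}.

Record is_model_structure M : Prop := {
  ms_2of3 : two_of_three (wmap (weq M));
  ms_weq_retract : retract_closed (wmap (weq M));
  ms_cof_retract : retract_closed (@cof _ M);
  ms_fib_retract : retract_closed (@fib _ M);
  ms_lift_tcof : forall a b x y (i : hom a b) (p : hom x y),
    tcof M i -> fib M p -> lifts i p;
  ms_lift_tfib : forall a b x y (i : hom a b) (p : hom x y),
    cof M i -> tfib M p -> lifts i p;
  ms_fac_tfib : inhabited (functorial_factorization (@cof _ M) (tfib M));
  ms_fac_tcof : inhabited (functorial_factorization (tcof M) (@fib _ M))
}.

Definition is_model_category M : Prop :=
  [/\ complete C, cocomplete C & is_model_structure M].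

Definition cofibrant M (x : ob C) : Prop :=
  forall (o : ob C) (f : hom o x), is_initial o -> cof M f.
Definition fibrant M (x : ob C) : Prop :=
  forall (o : ob C) (f : hom x o), is_terminal o -> fib M f.

End ModelStructures.

(** ** Cofibrant generation *)

(* a small well-ordered set, i.e. an ordinal *)
Record wellorder := Wellorder {
  wo : small;
  wle : wo -> wo -> Prop;
  wle_refl : forall a, wle a a;
  wle_trans : forall a b c, wle a b -> wle b c -> wle a c;
  wle_antisym : forall a b, wle a b -> wle b a -> a = b;
  wle_total : forall a b, wle a b \/ wle b a;
  wlt_wf : well_founded (fun a b => wle a b /\ a <> b)
}.
Arguments wle {_} _ _.
Definition wlt (L : wellorder) (a b : wo L) : Prop := wle a b /\ a <> b.

Definition wo_cat (L : wellorder) : category.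
Proof.
refine (@Category (wo L) (fun a b => wle a b) (@wle_refl L)
          (fun a b c h k => wle_trans k h) _ _ _);
by move=> *; apply: proof_irrelevance.
Defined.

Definition is_least (L : wellorder) (a : wo L) : Prop := forall b, wle a b.

(* b = a + 1 *)
Definition is_succ (L : wellorder) (a b : wo L) : Prop :=
  wlt a b /\ forall c, wlt a c -> wle b c.

Definition is_limit_elt (L : wellorder) (b : wo L) : Prop :=
  ~ is_least b /\ forall a, ~ is_succ a b.

(* L is a limit ordinal, and subsets of cardinality at most kappa of L have a
   supremum in L. *)
Definition is_filtered (kappa : small) (L : wellorder) : Prop :=
  [/\ inhabited (wo L), forall a : wo L, exists b, wlt a b &
      forall f : kappa -> wo L, exists b, forall i, wle (f i) b].

Section CofibrantGeneration.
Variable C : category.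
Implicit Types (M : premodel C) (P : mclass C).

(* X : L -> C preserves colimits, i.e. X_b = colim_(a < b) X_a for b a limit *)
Definition is_sequence (L : wellorder) (X : functor (wo_cat L) C) : Prop :=
  forall b : wo L, is_limit_elt b ->
    forall (y : ob C) (m : forall a : wo L, wlt a b -> hom (X a) y),
      (forall (a a' : wo L) (h : wlt a b) (h' : wlt a' b) (k : wle a a'),
         m a' h' ∘ @fmap (wo_cat L) C X a a' k = m a h) ->
      exists! u : hom (X b) y,
        forall (a : wo L) (h : wlt a b),
          u ∘ @fmap (wo_cat L) C X a b (proj1 h) = m a h.

(* all the maps X_a -> X_(a+1) are in P *)
Definition steps_in (L : wellorder) (X : functor (wo_cat L) C) P : Prop :=
  forall (a b : wo L) (h : is_succ a b),
    P _ _ (@fmap (wo_cat L) C X a b (proj1 (proj1 h))).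

(* C(a, -) commutes with the colimits of all L-sequences in P, for all
   kappa-filtered L: the canonical map colim C(a, X_b) -> C(a, colim X_b) is
   bijective *)
Definition small_relative (a : ob C) P : Prop :=
  exists kappa : small,
  forall (L : wellorder) (X : functor (wo_cat L) C),
    is_filtered kappa L -> is_sequence X -> steps_in X P ->
  forall (x : ob C) (l : forall b, hom (X b) x),
    @is_colimit (wo_cat L) C X x l ->
    (forall f : hom a x, exists (b : wo L) (g : hom a (X b)), l b ∘ g = f) /\
    (forall (b : wo L) (g g' : hom a (X b)), l b ∘ g = l b ∘ g' ->
       exists (c : wo L) (h : wle b c),
         @fmap (wo_cat L) C X b c h ∘ g = @fmap (wo_cat L) C X b c h ∘ g').

(* a set of maps *)
Record map_set := MapSet {
  ms_idx : small;
  ms_dom : ms_idx -> ob C;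
  ms_cod : ms_idx -> ob C;
  ms_map : forall i, hom (ms_dom i) (ms_cod i)
}.

Inductive in_set (I : map_set) : mclass C :=
| InSet (i : ms_idx I) : in_set I (ms_map i).

(* pushouts of maps in I *)
Definition pushout_of (I : map_set) : mclass C :=
  fun x y f => exists (i : ms_idx I) (u : hom (ms_dom i) x)
    (v : hom (ms_cod i) y), is_pushout (ms_map i) u v f.

(* relative I-cell complexes: transfinite compositions of pushouts of maps
   in I *)
Definition cell (I : map_set) : mclass C :=
  fun x y f => exists (L : wellorder) (X : functor (wo_cat L) C)
    (l : forall b, hom (X b) y) (o : wo L) (u : hom x (X o)),
    [/\ is_sequence X, steps_in X (pushout_of I),
        @is_colimit (wo_cat L) C X y l, is_least o & is_iso u /\ f = l o ∘ u].

Definition permits_small_object_argument (I : map_set) : Prop :=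
  forall i : ms_idx I, small_relative (ms_dom i) (cell I) /\
                       small_relative (ms_cod i) (cell I).

Definition cofibrantly_generated M : Prop :=
  exists I J : map_set,
    [/\ permits_small_object_argument I, permits_small_object_argument J,
        (forall x y (f : hom x y), fib M f <-> rlp (in_set J) f) &
        (forall x y (f : hom x y), tfib M f <-> rlp (in_set I) f)].

End CofibrantGeneration.

(** ** Quillen equivalences and homotopy colimits *)

Section Quillen.
Variables (C D : category) (M : premodel C) (N : premodel D).

Definition quillen_adjunction (L : functor C D) : Prop :=
  (forall x y (f : hom x y), cof M f -> cof N (fmap L f)) /\
  (forall x y (f : hom x y), tcof M f -> tcof N (fmap L f)).

Definition quillen_equivalence (L : functor C D) (R : functor D C)
    (a : adjunction L R) : Prop :=
  quillen_adjunction L /\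
  forall x y (f : hom (L x) y), cofibrant M x -> fibrant N y ->
    (is_weq N f <-> is_weq M (adj a f)).

End Quillen.

Section HomotopyColimits.
Variables (C : category) (M : premodel C).

(* the left lifting property against objectwise trivial fibrations *)
Definition proj_cofibrant (J : category) (F : functor J C) : Prop :=
  forall (X Y : functor J C) (p : nat_trans X Y) (v : nat_trans F Y),
    (forall j, tfib M (p j)) ->
    exists h : nat_trans F X, forall j, p j ∘ h j = v j.

(* The homotopy colimit is the left derived functor of colim : C^J -> C for the
   projective model structure. *)
Definition is_hocolim (J : category) (F : functor J C) (x : ob C) : Prop :=
  exists (F' : functor J C) (q : nat_trans F' F) (y : ob C)
    (l : forall j, hom (F' j) y),
    [/\ proj_cofibrant F', forall j, is_weq M (q j), is_colimit l &
        ho_iso (wmap (weq M)) y x].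

Inductive hocolim_generated (K : ob C -> Prop) : ob C -> Prop :=
| HG_base x : K x -> hocolim_generated K x
| HG_hocolim (J : category) (F : functor J C) x :
    is_small J -> (forall j, hocolim_generated K (F j)) -> is_hocolim F x ->
    hocolim_generated K x.

End HomotopyColimits.

(** * Colocalization *)

Section Colocalization.
Variables (C : category) (M : premodel C).

(* A set of isomorphism classes of objects of Ho(C), given as the predicate on
   objects that holds when the class of the object belongs to the set. *)
Definition is_iso_class_set (K : ob C -> Prop) : Prop :=
  exists (T : small) (k : T -> ob C),
    forall x, K x <-> exists t, ho_iso (wmap (weq M)) x (k t).

Variable K : ob C -> Prop.

Definition colocal_equivalence (x y : ob C) (f : hom x y) : Prop :=
  forall k, K k -> sset_weq (map_post (weq M) k f).

Definition colocal (w : ob C) : Prop :=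
  forall x y (f : hom x y), colocal_equivalence f ->
    sset_weq (map_post (weq M) w f).

Definition colocalization (x' x : ob C) (f : hom x' x) : Prop :=
  colocal_equivalence f /\ colocal x'.

Definition good_colocalization : Prop :=
  (exists N : premodel C,
     [/\ forall x y (f : hom x y), fib N f <-> fib M f,
         forall x y (f : hom x y), is_weq N f <-> colocal_equivalence f &
         is_model_category N]) /\
  (forall x, colocal x <-> hocolim_generated M K x).

End Colocalization.

(** * Symmetric monoidal model categories *)

Record sym_monoidal (C : category) := SymMonoidal {
  tens : ob C -> ob C -> ob C;
  tensm : forall x x' y y', hom x x' -> hom y y' -> hom (tens x y) (tens x' y');
  tens1 : forall x y, tensm (idm x) (idm y) = idm (tens x y);
  tensM : forall x x' x'' y y' y'' (f' : hom x' x'') (f : hom x x')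
    (g' : hom y' y'') (g : hom y y'),
    tensm (f' ∘ f) (g' ∘ g) = tensm f' g' ∘ tensm f g;
  munit : ob C;
  assoc : forall x y z, hom (tens (tens x y) z) (tens x (tens y z));
  associ : forall x y z, hom (tens x (tens y z)) (tens (tens x y) z);
  assocK : forall x y z, associ x y z ∘ assoc x y z = idm _;
  associK : forall x y z, assoc x y z ∘ associ x y z = idm _;
  assoc_nat : forall x x' y y' z z' (f : hom x x') (g : hom y y') (h : hom z z'),
    assoc x' y' z' ∘ tensm (tensm f g) h = tensm f (tensm g h) ∘ assoc x y z;
  lunit : forall x, hom (tens munit x) x;
  lunit_iso : forall x, is_iso (lunit x);
  lunit_nat : forall x y (f : hom x y),
    lunit y ∘ tensm (idm munit) f = f ∘ lunit x;
  runit : forall x, hom (tens x munit) x;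
  runit_iso : forall x, is_iso (runit x);
  runit_nat : forall x y (f : hom x y),
    runit y ∘ tensm f (idm munit) = f ∘ runit x;
  braid : forall x y, hom (tens x y) (tens y x);
  braid_nat : forall x x' y y' (f : hom x x') (g : hom y y'),
    braid x' y' ∘ tensm f g = tensm g f ∘ braid x y;
  braidK : forall x y, braid y x ∘ braid x y = idm (tens x y);
  pentagon : forall x y z t,
    tensm (idm x) (assoc y z t) ∘ assoc x (tens y z) t
      ∘ tensm (assoc x y z) (idm t)
    = assoc x y (tens z t) ∘ assoc (tens x y) z t;
  triangle : forall x y,
    tensm (idm x) (lunit y) ∘ assoc x munit y = tensm (runit x) (idm y);
  hexagon : forall x y z,
    assoc y z x ∘ braid x (tens y z) ∘ assoc x y z
    = tensm (idm y) (braid x z) ∘ assoc y x z ∘ tensm (braid x y) (idm z)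
}.
Arguments tens {C} _ _ _.
Arguments tensm {C} _ {x x' y y'} _ _.
Arguments munit {C} _.
Arguments assoc {C} _ _ _ _.
Arguments associ {C} _ _ _ _.
Arguments lunit {C} _ _.
Arguments runit {C} _ _.

(* - ⊗ y has a right adjoint for all y *)
Definition is_closed (C : category) (T : sym_monoidal C) : Prop :=
  forall y z : ob C, exists (h : ob C) (ev : hom (tens T h y) z),
    forall x (f : hom (tens T x y) z),
      exists! g : hom x h, ev ∘ tensm T g (idm y) = f.

Section MonoidalModel.
Variables (C : category) (T : sym_monoidal C) (M : premodel C).

Definition pushout_product_axiom : Prop :=
  forall (a b c d : ob C) (i : hom a b) (j : hom c d),
    cof M i -> cof M j ->
  forall (e : ob C) (p : hom (tens T a d) e) (q : hom (tens T b c) e),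
    is_pushout (tensm T (idm a) j) (tensm T i (idm c)) p q ->
  forall h : hom e (tens T b d),
    h ∘ p = tensm T i (idm d) -> h ∘ q = tensm T (idm b) j ->
    cof M h /\ (is_weq M i \/ is_weq M j -> is_weq M h).

Definition unit_axiom : Prop :=
  forall (o : ob C) (q : hom o (munit T)), cofibrant M o -> tfib M q ->
  forall x, cofibrant M x -> is_weq M (tensm T q (idm x)).

Definition is_sym_monoidal_model : Prop :=
  [/\ is_model_category M, is_closed T, pushout_product_axiom & unit_axiom].

End MonoidalModel.

(** * Monoids and modules *)

Record monoid (C : category) (T : sym_monoidal C) := Monoid {
  mon :> ob C;
  mmul : hom (tens T mon mon) mon;
  mone : hom (munit T) mon;
  mmulA : mmul ∘ tensm T mmul (idm mon)
          = mmul ∘ tensm T (idm mon) mmul ∘ assoc T mon mon mon;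
  mmul1m : mmul ∘ tensm T mone (idm mon) = lunit T mon;
  mmulm1 : mmul ∘ tensm T (idm mon) mone = runit T mon
}.
Arguments mmul {C T} _.
Arguments mone {C T} _.

Record monoid_map (C : category) (T : sym_monoidal C) (A B : monoid T) :=
  MonoidMap {
  monm :> hom A B;
  monmM : monm ∘ mmul A = mmul B ∘ tensm T monm monm;
  monm1 : monm ∘ mone A = mone B
}.

Section Modules.
Variables (C : category) (T : sym_monoidal C).

Record module (A : monoid T) := Module {
  mob :> ob C;
  mact : hom (tens T A mob) mob;
  mactA : mact ∘ tensm T (mmul A) (idm mob)
          = mact ∘ tensm T (idm A) mact ∘ assoc T A A mob;
  mact1 : mact ∘ tensm T (mone A) (idm mob) = lunit T mob
}.

Record module_map (A : monoid T) (X Y : module A) := ModuleMap {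
  modm :> hom X Y;
  modm_act : modm ∘ mact X = mact Y ∘ tensm T (idm A) modm
}.

Lemma module_map_eq (A : monoid T) (X Y : module A) (f g : module_map X Y) :
  modm f = modm g -> f = g.
Proof.
case: f g => f hf [g hg] /= fg; case: g / fg hg => hg.
by congr ModuleMap; apply: proof_irrelevance.
Qed.

Lemma tens_compl x y y' y'' (g : @hom C y' y'') (f : hom y y') :
  tensm T (idm x) (g ∘ f) = tensm T (idm x) g ∘ tensm T (idm x) f.
Proof. by rewrite -tensM comp1m. Qed.

Lemma tens_compr x y y' y'' (g : @hom C y' y'') (f : hom y y') :
  tensm T (g ∘ f) (idm x) = tensm T g (idm x) ∘ tensm T f (idm x).
Proof. by rewrite -tensM comp1m. Qed.

(* Mod(A) *)
Definition Mod (A : monoid T) : category.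
Proof.
unshelve refine (@Category (module A) (@module_map A)
  (fun X => @ModuleMap A X X (idm _) _)
  (fun X Y Z g f => @ModuleMap A X Z (modm g ∘ modm f) _) _ _ _).
- by rewrite tens1 comp1m compm1.
- by rewrite tens_compl -compA modm_act !compA modm_act.
- by move=> *; apply: module_map_eq; rewrite /= comp1m.
- by move=> *; apply: module_map_eq; rewrite /= compm1.
- by move=> *; apply: module_map_eq; rewrite /= compA.
Defined.

(* U : Mod(A) -> C *)
Definition forget (A : monoid T) : functor (Mod A) C.
Proof.
by refine (@Functor (Mod A) C (fun X => mob X) (fun X Y f => modm f) _ _).
Defined.

Lemma restrict_act1 (A' A : monoid T) (phi : monoid_map A' A) (X : module A) :
  mact X ∘ tensm T phi (idm X) ∘ tensm T (mone A') (idm X) = lunit T X.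
Proof. by rewrite -compA -tens_compr monm1 mact1. Qed.

Lemma restrict_actA (A' A : monoid T) (phi : monoid_map A' A) (X : module A) :
  mact X ∘ tensm T phi (idm X) ∘ tensm T (mmul A') (idm X)
  = mact X ∘ tensm T phi (idm X)
      ∘ tensm T (idm A') (mact X ∘ tensm T phi (idm X)) ∘ assoc T A' A' X.
Proof.
rewrite -compA -tens_compr monmM tens_compr compA mactA -[in LHS]compA assoc_nat.
rewrite -[in RHS](compA _ _ (tensm T (idm A') _)) -[in RHS]tensM compm1 comp1m.
rewrite !compA -[in LHS](compA (mact X)) -tensM comp1m.
by [].
Qed.

(* restriction of scalars, phi^* : Mod(A) -> Mod(A') *)
Definition restrict_ob (A' A : monoid T) (phi : monoid_map A' A)
    (X : module A) : module A' :=
  @Module A' X (mact X ∘ tensm T phi (idm X))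
    (restrict_actA phi X) (restrict_act1 phi X).

Definition restrict (A' A : monoid T) (phi : monoid_map A' A) :
  functor (Mod A) (Mod A').
Proof.
unshelve refine (@Functor (Mod A) (Mod A') (restrict_ob phi)
  (fun X Y f => @ModuleMap A' (restrict_ob phi X) (restrict_ob phi Y) (modm f) _)
  _ _).
- by rewrite /= compA modm_act -!compA -!tensM !comp1m !compm1.
- by move=> X; apply: module_map_eq.
- by move=> X Y Z g f; apply: module_map_eq.
Defined.

Lemma epi_iso x y z (e : @hom C x y) (f g : hom y z) :
  is_iso e -> f ∘ e = g ∘ e -> f = g.
Proof.
by case=> e' [_ ee'] /(f_equal (fun u => u ∘ e')); rewrite -!compA ee' !compm1.
Qed.

Lemma assoc_iso x y z : is_iso (assoc T x y z).
Proof. by exists (associ T x y z); rewrite assocK associK. Qed.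

Lemma tens_iso x y z (e : @hom C x y) : is_iso e -> is_iso (tensm T e (idm z)).
Proof.
case=> e' [e1 e2]; exists (tensm T e' (idm z)).
by rewrite -!tens_compr e1 e2 !tens1.
Qed.

Lemma tens_unit_inj x y (f g : @hom C x y) :
  tensm T (idm (munit T)) f = tensm T (idm (munit T)) g -> f = g.
Proof.
by move=> fg; apply: (epi_iso (lunit_iso T x)); rewrite -!lunit_nat fg.
Qed.

Lemma lunit_tens x y :
  lunit T (tens T x y) ∘ assoc T (munit T) x y = tensm T (lunit T x) (idm y).
Proof.
apply: tens_unit_inj; rewrite tens_compl.
apply: (epi_iso (assoc_iso _ _ _)).
apply: (epi_iso (tens_iso y (assoc_iso (munit T) (munit T) x))).
rewrite -!compA !(compA (tensm T (idm (munit T)) (assoc T _ _ _))) pentagon.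
rewrite !compA triangle -(tens1 T x y) -!assoc_nat -!compA -tens_compr triangle.
by rewrite !assoc_nat.
Qed.

Definition free_act (A : monoid T) (x : ob C) :
    hom (tens T A (tens T A x)) (tens T A x) :=
  tensm T (mmul A) (idm x) ∘ associ T A A x.

Lemma free_actA (A : monoid T) x :
  free_act A x ∘ tensm T (mmul A) (idm (tens T A x))
  = free_act A x ∘ tensm T (idm A) (free_act A x) ∘ assoc T A A (tens T A x).
Proof.
apply: (epi_iso (assoc_iso _ _ _)).
rewrite -[RHS]compA -pentagon /free_act tens_compl -(tens1 T A x) -!compA.
rewrite -assoc_nat (compA (associ T _ _ _) (assoc T _ _ _)) assocK comp1m.
rewrite (compA (tensm T (idm A) (associ T _ _ _))) -tens_compl assocK !tens1 comp1m.
rewrite (compA (tensm T (idm A) (tensm T _ _))) -assoc_nat.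
rewrite -(compA (assoc T _ _ _)) (compA (associ T _ _ _)) assocK comp1m.
by rewrite -!tens_compr mmulA compA.
Qed.

Lemma free_act1 (A : monoid T) x :
  free_act A x ∘ tensm T (mone A) (idm (tens T A x)) = lunit T (tens T A x).
Proof.
apply: (epi_iso (assoc_iso _ _ _)).
rewrite lunit_tens /free_act -!compA -(tens1 T A x) -assoc_nat.
by rewrite (compA (associ T _ _ _)) assocK comp1m -tens_compr mmul1m.
Qed.

(* the free module A ⊗ x *)
Definition free_module (A : monoid T) (x : ob C) : module A :=
  @Module A (tens T A x) (free_act A x) (free_actA A x) (free_act1 A x).

(** ** The model structure on modules *)

Variable M : premodel C.

(* The weak equivalences and fibrations of Mod(A) are those of C; this
   determines the cofibrations. *)
Definition Mod_weq (A : monoid T) : wclass (Mod A) :=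
  @WClass (Mod A) (fun X Y f => is_weq M (fmap (forget A) f))
    (fun X => wmap1 (weq M) X).

Definition Mod_fib (A : monoid T) : mclass (Mod A) :=
  fun X Y f => fib M (fmap (forget A) f).

Definition Mod_model (A : monoid T) : premodel (Mod A) :=
  @Premodel (Mod A) (Mod_weq A)
    (llp (fun X Y f => Mod_fib f /\ wmap (Mod_weq A) f)) (@Mod_fib A).

Definition admissible (A : monoid T) : Prop :=
  is_model_category (Mod_model A) /\ cofibrantly_generated (Mod_model A).

(* Since phi_! is determined up to isomorphism by phi^*, the left adjoint in
   the Quillen equivalence is quantified existentially. *)
Definition strongly_admissible (A : monoid T) : Prop :=
  exists (A' : monoid T) (phi : monoid_map A' A),
    [/\ is_weq M phi, admissible A, admissible A',
        exists (L : functor (Mod A') (Mod A)) (a : adjunction L (restrict phi)),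
          quillen_equivalence (Mod_model A') (Mod_model A) a &
        cofibrant M A' \/
        cof M (mone A') /\
        exists M2 : premodel C,
          [/\ is_sym_monoidal_model T M2, cofibrantly_generated M2,
              forall x y (f : hom x y), is_weq M2 f <-> is_weq M f &
              cofibrant M2 (munit T)]].

(* A ⊗^L K: the left derived functor of x |-> A ⊗ x takes the value A ⊗ x' for
   a cofibrant replacement x' of x. *)
Definition derived_free (A : monoid T) (K : ob C -> Prop) (Y : ob (Mod A)) :
    Prop :=
  exists (x x' : ob C) (q : hom x' x),
    [/\ K x, cofibrant M x', is_weq M q &
        ho_iso (wmap (Mod_weq A)) Y (free_module A x')].

Definition underlying_colocal (A : monoid T) (K : ob C -> Prop)
    (L : ob (Mod A) -> Prop) : Prop :=
  forall Y, L Y -> colocal M K (forget A Y).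

End Modules.

(* Main.v *)
(* Zigzags modulo reduction have normal forms, and the homotopy extension property
   of Kan complexes allows an induction on the number of backward arrows.  This
   shows that, for a natural transformation F => G of functors preserving weak
   equivalences, the two maps map(x, y) -> map(F x, G y) agree in Ho(sSets).
   Consequently an adjunction-like pair of functors exhibits maps of mapping
   spaces as retracts of one another, up to weak equivalence.

   Applied to the free module functor this gives
     map(A (x) Qk, f) equivalence => map(k, U f) equivalence,
   which is the statement on colocal equivalences.  For the colocality of U X',
   let H be the right adjoint of U : Mod(A') -> C.  The tensor product with A'
   preserves cofibrations and trivial cofibrations, so H is right Quillen, and
   with the Quillen equivalence phi_! -| phi^* one obtains a functor S' (namely
   phi_! Q H R) with map(Y, S' g) an equivalence iff map(U Y, g) is one.  If g is
   a K-colocal equivalence then map(U Y, g) is an equivalence for Y in A (x)^L K,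
   as U Y is colocal; so S' g is a colocal equivalence of A-modules, and
   map(X', S' g), hence map(U X', g), is an equivalence. *)
From mathcomp Require Import all_boot zify.
From Stdlib Require Import Relations FunctionalExtensionality ProofIrrelevance
  ClassicalEpsilon.
Require Import Defs.

Set Implicit Arguments.
Unset Strict Implicit.
Unset Printing Implicit Defensive.
Set Primitive Projections.

(** * Extension of maps into Kan complexes *)

(** The obstacle is a backward arrow [w]: in hammocks, the inverse of [F w] followed by the natural
    transformation and the natural transformation followed by the inverse of [G w] agree only up to
    homotopy. A homotopy that moves the transformation through a word arrow by arrow has a length
    depending on the word, and both reductions and simplicial operators change that length. Weak
    equivalences are tested by maps into Kan complexes [Z], so it suffices to compare the two maps
    after composition with a map to [Z]. There the homotopy is built by extension: on words with one
    more backward arrow its values are already forced where the word becomes shorter, and the space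
    of new words deforms into that part. Normal forms make the number of backward arrows and the
    first of them well defined on classes of words. Derived adjunctions are then compared through
    retracts, which only use triangle identities that hold up to a weak equivalence; in this way the
    unit of the free module adjunction, which is rarely a weak equivalence, can be used. *)

Notation emi := excluded_middle_informative.
Notation cid := (@constructive_indefinite_description _ _).

Definition sub_sset (X : sset) (A : forall m, X m -> Prop) : Prop :=
  forall m l (t : mono m l) (x : X l), A l x -> A m (sact t x).

(** A map on a subcomplex that is given by a predicate. Closure of [A] under the operators is a
    separate hypothesis, so [pf_act] takes a membership proof for the simplex and one for its
    image. *)
Record pmap (X Z : sset) (A : forall m, X m -> Prop) := PMap {
  pf :> forall m (x : X m), A m x -> Z m;
  pf_act : forall m l (t : mono m l) (x : X l) (h : A l x) (h' : A m (sact t x)),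
    pf h' = sact t (pf h)
}.
Arguments pf_act {X Z A} _ {m l t x} _ _.

Lemma pf_eq X Z A (f : @pmap X Z A) m (x y : X m) (h : A m x) (h' : A m y) :
  x = y -> f m x h = f m y h'.
Proof. by move=> xy; case: y / xy h' => h'; congr (f m x _); apply: proof_irrelevance. Qed.

Definition extends X Z A B (f : @pmap X Z A) (g : @pmap X Z B) :=
  forall m (x : X m) (h : A m x) (h' : B m x), g m x h' = f m x h.

Section Attach.
Variables (X Z : sset) (A : forall m, X m -> Prop).
Hypotheses (HZ : is_kan Z) (HA : sub_sset A).
Variables (n : nat) (k : 'I_n.+2) (x : X n.+1).
Hypothesis (Hx : forall m (t : mono m n.+1), A (sact t x) <-> in_horn k t).
Hypothesis (Hi : forall m (t t' : mono m n.+1),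
  sact t x = sact t' x -> ~ A (sact t x) -> t = t').

Definition attach m (y : X m) : Prop := A y \/ exists t, y = sact t x.

Lemma attachT m (y : X m) : attach y -> ~ A y -> exists t, y = sact t x.
Proof. by case. Qed.

(* If the horn of the simplex x is all of its intersection with A, and x is
   injective elsewhere, then adjoining x to A is a pushout of a horn inclusion. *)
Lemma attach_extend (f : pmap Z A) : exists g : pmap Z attach, extends f g.
Proof.
have [h hE] : exists h : smap (horn k) Z, forall m (t : horn k m),
    h m t = f _ _ (proj2 (Hx (sval t)) (proj2_sig t)).
  unshelve eexists (@SMap (horn k) Z (fun m t => f _ _ (proj2 (Hx (sval t)) (proj2_sig t))) _); last by [].
  move=> m l t s; rewrite /= -(pf_act f _ (HA t (proj2 (Hx (sval s)) (proj2_sig s)))).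
  by apply: pf_eq; rewrite sactM.
have [z hz] := HZ h.
have zE m (t : mono m n.+1) (a : A (sact t x)) : z m t = f _ _ a.
  have := f_equal (fun u : smap (horn k) Z => u m (exist _ t (proj1 (Hx t) a))) hz.
  by rewrite /= hE => ->; apply: pf_eq.
pose v m (y : X m) (hy : attach y) : Z m :=
  match emi (A y) with
  | left a => f _ _ a
  | right na => z m (sval (cid (attachT hy na)))
  end.
have vA m (y : X m) hy (a : A y) : v m y hy = f _ _ a.
  by rewrite /v; case: emi => // a'; apply: pf_eq.
(* The chosen [t] is irrelevant: inside [A] the filler restricts to the given horn, outside [A] the
   simplex determines [t] by [Hi]. *)
have vT m (t : mono m n.+1) hy : v m (sact t x) hy = z m t.
  rewrite /v; case: emi => [a|na]; first by rewrite zE.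
  case: cid => s /= hs; congr (z m _); symmetry; exact: Hi.
have vact m l (t : mono m l) (y : X l) (hy : attach y) (hy' : attach (sact t y)) :
    v _ _ hy' = sact t (v _ _ hy).
  have [a|[s e]] := hy.
    by rewrite (vA _ _ hy a) (vA _ _ hy' (HA t a)) -(pf_act f a (HA t a)).
  subst y.
  rewrite vT -sfun_act; move: hy'; rewrite -sactM => hy'; exact: vT.
by exists (PMap vact) => m y a hy; apply: vA.
Qed.
End Attach.

(** ** Prisms *)

Notation D1 := (simplex 1).
Definition c0 m : mono m 1 := @mono_const m 1 ord0.
Definition c1 m : mono m 1 := @mono_const m 1 ord_max.

Definition surj m n (t : mono m n) : Prop := forall i, exists j, t j = i.

Lemma surj_comp m n l (s : mono n l) (t : mono m n) :
  surj (mono_comp s t) -> surj s.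
Proof. by move=> h i; case: (h i) => j <-; exists (t j). Qed.

Lemma nsurjP m n (t : mono m n) : ~ surj t -> exists i, forall j, t j != i.
Proof.
move=> h; apply: Classical_Prop.NNPP => h'; apply: h => i.
apply: Classical_Prop.NNPP => h; apply: h'; exists i => j.
by apply/eqP => e; apply: h; exists j.
Qed.

Section Prism.
Variables (Z : sset) (HZ : is_kan Z) (n : nat).
Let P := sprod (simplex n) D1.

(** The boundary of the simplex times the interval, together with the bottom of the prism: a simplex
    lies in the boundary exactly when it is not surjective on vertices. *)
Definition in_open_prism m (x : P m) : Prop := ~ surj x.1 \/ x.2 = c0 m.

Lemma open_prism_sub : sub_sset in_open_prism.
Proof.
move=> m l t [y s] [h|/= ->]; [left|right] => /=.
  by move=> h'; apply: h; apply: surj_comp h'.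
exact: mono_eq.
Qed.

(* the simplices of the (n+1)-simplex (0,0) ... (i,0) (i,1) ... (n,1) *)
Definition in_block (i : nat) m (x : P m) : Prop :=
  forall a, if (0 < x.2 a)%N then (i <= x.1 a)%N else (x.1 a <= i)%N.

(** Blocks are adjoined from [n] down to 0: stage [n.+1] is the open prism and stage 0 the whole
    prism. Block [n] comes first since it is the one that has the bottom as a face. *)
Definition prism_stage (i : nat) m (x : P m) : Prop :=
  in_open_prism x \/ exists2 j, (i <= j <= n)%N & in_block j x.

Lemma prism_stage_sub i : sub_sset (@prism_stage i).
Proof.
move=> m l t x [h|[j hj h]]; first by left; apply: open_prism_sub.
by right; exists j => // a; apply: (h (t a)).
Qed.

Lemma block_fst_lt (i : 'I_n.+1) (a : 'I_n.+2) : (unbump i a < n.+1)%N.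
Proof. by rewrite /unbump; have := ltn_ord a; have := ltn_ord i; lia. Qed.

Lemma block_fst_le (i : 'I_n.+1) (a b : 'I_n.+2) :
  (a <= b)%N -> (unbump i a <= unbump i b)%N.
Proof. by rewrite /unbump; lia. Qed.

Definition block_fst (i : 'I_n.+1) : mono n.+1 n :=
  @Mono n.+1 n (fun a => Ordinal (block_fst_lt i a)) (@block_fst_le i).

Lemma block_snd_lt (i : 'I_n.+1) (a : 'I_n.+2) : ((i < a) < 2)%N.
Proof. by case: (i < a)%N. Qed.

Lemma block_snd_le (i : 'I_n.+1) (a b : 'I_n.+2) :
  (a <= b)%N -> ((i < a) <= (i < b))%N.
Proof. by lia. Qed.

Definition block_snd (i : 'I_n.+1) : mono n.+1 1 :=
  @Mono n.+1 1 (fun a => Ordinal (block_snd_lt i a)) (@block_snd_le i).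

Definition block (i : 'I_n.+1) : P n.+1 := (block_fst i, block_snd i).

Lemma in_blockP (i : 'I_n.+1) m (x : P m) :
  in_block i x -> exists t, x = sact t (block i).
Proof.
case: x => [y s] h.
have hlt (a : 'I_m.+1) : ((y a + s a)%N < n.+2)%N.
  by have := ltn_ord (y a); have := ltn_ord (s a); lia.
have hle (a b : 'I_m.+1) : (a <= b)%N -> (y a + s a <= y b + s b)%N.
  by move=> ab; have := mono_le y ab; have := mono_le s ab; lia.
exists (@Mono m n.+1 (fun a => Ordinal (hlt a)) hle).
by congr pair; apply: mono_eq => a; apply: val_inj; move: (h a) (ltn_ord (s a));
  rewrite /= /unbump /=; case: ltnP; lia.
Qed.

Lemma block_inj (i : 'I_n.+1) m (t t' : mono m n.+1) :
  sact t (block i) = sact t' (block i) -> t = t'.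
Proof.
move=> e; apply: mono_eq => a; apply: val_inj.
have := f_equal (fun u : P m => u.1 a : nat) e.
have := f_equal (fun u : P m => u.2 a : nat) e.
by rewrite /= /unbump; lia.
Qed.

(** Vertex [l] of the block is (l,0) for l <= i and (l-1,1) otherwise. The face opposite vertex i+1
    lies in block i+1, or in the bottom if i = n. The faces opposite the vertices other than i and
    i+1 project to the boundary. Only the face opposite vertex i, the one towards block i-1, is
    missing. *)
Lemma block_horn (i : 'I_n.+1) m (t : mono m n.+1) :
  prism_stage i.+1 (sact t (block i)) <-> in_horn (widen_ord (leqnSn _) i) t.
Proof.
split=> [h|[l li hl]].
- apply: Classical_Prop.NNPP => nh.
  have hit (l : 'I_n.+2) : l != widen_ord (leqnSn _) i -> exists a, t a = l.
    move=> li; apply: Classical_Prop.NNPP => hl; apply: nh; exists l => //.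
    by move=> a; apply/eqP => e; apply: hl; exists a.
  (* Vertex i+1 of the block is (i,1): it is not on the bottom, and it is in no block [j] with j >
     i. *)
  have [a ha] : exists a, t a = lift ord0 i.
    by apply: hit; apply/eqP => /(f_equal val); rewrite /= /bump; lia.
  move/(f_equal val): ha; rewrite /= /bump /= add1n => ha.
  case: h => [[h|h]|[j hj h]].
  + apply: h => l.
    have [|b hb] := hit (lift (widen_ord (leqnSn _) i) l); first by rewrite eq_sym neq_lift.
    by exists b; apply: val_inj; rewrite /= hb /= bumpK.
  + have := f_equal (fun u : mono m 1 => u a : nat) h.
    by rewrite /= ha ltnSn.
  + by have := h a; rewrite /= ha /unbump !ltnSn /=; lia.
- have hl' a : (t a : nat) <> l by move=> e; move/eqP: (hl a); apply; apply: val_inj.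
  have {}li : (l : nat) <> i by move=> e; move/eqP: li; apply; apply: val_inj.
  case: (ltngtP l i.+1) => hli.
  + left; left => h; have hn : (l < n.+1)%N by have := ltn_ord i; lia.
    case: (h (Ordinal hn)) => a /(f_equal val); rewrite /= /unbump; have := hl' a; lia.
  + left; left => h; have hn : (l.-1 < n.+1)%N by have := ltn_ord l; lia.
    case: (h (Ordinal hn)) => a /(f_equal val); rewrite /= /unbump; have := hl' a; lia.
  + case: (ltnP i n) => hin.
      right; exists i.+1; first by lia.
      by move=> a; have := hl' a; rewrite /= /unbump; case: (ltnP i (t a)) => /=; lia.
    left; right; apply: mono_eq => a; apply: val_inj => /=.
    by have := hl' a; have := ltn_ord (t a); have := ltn_ord i; lia.
Qed.

Lemma prism_stage_extend (i : nat) (f : pmap Z (@prism_stage i)) :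
  (i <= n.+1)%N -> exists g : pmap Z (@prism_stage 0), extends f g.
Proof.
elim: i f => [|i IH] f hi; first by exists f => m x h h'; apply: pf_eq.
pose i' : 'I_n.+1 := Ordinal hi.
have [g hg] := attach_extend HZ (@prism_stage_sub i.+1) (@block_horn i')
  (fun m t t' e _ => block_inj e) f.
have sub m (x : P m) : prism_stage i x -> attach (@prism_stage i.+1) (block i') x.
  case=> [h|[j hj h]]; first by left; left.
  have [ij|ij] := eqVneq j i; last by left; right; exists j => //; lia.
  by right; apply: in_blockP; rewrite ij in h.
have [g' hg'] := IH (@PMap P Z (@prism_stage i) (fun m x h => g m x (sub m x h))
  (fun m l t x h h' => pf_act g (sub _ _ h) (sub _ _ h'))) (ltnW hi).
exists g' => m x h h'.
have h1 : prism_stage i x.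
  by case: h => [h|[j hj h]]; [left|right; exists j => //; lia].
by rewrite (hg' _ _ h1 h') /= -(hg _ _ h (sub _ _ h1)).
Qed.

Lemma prism_extend (f : pmap Z in_open_prism) :
  exists g : smap P Z, forall m (x : P m) (h : in_open_prism x), g m x = f m x h.
Proof.
have sub m (x : P m) : prism_stage n.+1 x -> in_open_prism x.
  by case=> // -[j hj _]; lia.
have [g hg] := @prism_stage_extend n.+1 (@PMap P Z (@prism_stage n.+1)
  (fun m x h => f m x (sub m x h))
  (fun m l t x h h' => pf_act f (sub _ _ h) (sub _ _ h'))) (leqnn _).
have all m (x : P m) : prism_stage 0 x.
  right; case: (Classical_Prop.classic (exists a, (0 < x.2 a)%N)) => [[a ha]|h].
    (* A block containing [x] is read off from the first position at which the second coordinate is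
       1; if there is none, block [n] contains [x]. *)
    pose b := [arg min_(c < a | (0 < x.2 c)%N) (c : nat)].
    have [hb bmin] : (0 < x.2 b)%N /\ forall c, (0 < x.2 c)%N -> (b <= c)%N.
      by rewrite /b; case: arg_minnP => //.
    exists (x.1 b); first by have := ltn_ord (x.1 b); lia.
    move=> c; case: ltnP => hc; first by apply/mono_le/bmin.
    apply: mono_le; case: (leqP c b) => // /ltnW /(mono_le x.2); lia.
  exists n; first by rewrite leqnn.
  move=> a; case: ltnP => ha; first by case: h; exists a.
  by have := ltn_ord (x.1 a); lia.
exists (@SMap P Z (fun m x => g m x (all m x)) (fun m l t x => pf_act g (all _ x) (all _ _))).
move=> m x h; rewrite /= (hg _ _ (or_introl h)) /=; exact: pf_eq.
Qed.
End Prism.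

(** ** Skeleta and the homotopy extension property *)

Lemma inj_mono_ge n (t : mono n n) : injective t -> forall i : 'I_n.+1, (i <= t i)%N.
Proof.
move=> ti [i hi]; elim: i hi => //= i IH hi.
apply: leq_ltn_trans (IH (ltnW hi)) _; rewrite ltn_neqAle mono_le ?leqnSn // andbT.
by apply/eqP => /val_inj/ti/(f_equal val) /=; lia.
Qed.

(** Prescribing the section at one point lets sections detect the whole surjection, as needed for
    uniqueness in the Eilenberg-Zilber lemma. *)
Lemma surj_section m n (t : mono m n) (a : 'I_m.+1) : surj t ->
  exists2 s : mono n m, mono_comp t s = mono_id n & s (t a) = a.
Proof.
move=> ht; pose s i := if i == t a then a else sval (cid (ht i)).
have ts i : t (s i) = i by rewrite /s; case: eqP => [->//|_]; case: cid.
have sle (i j : 'I_n.+1) : (i <= j)%N -> (s i <= s j)%N.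
  move=> ij; case: (leqP (s i) (s j)) => // lt; have := mono_le t (ltnW lt).
  rewrite !ts => ji; have e : i = j by apply: val_inj => /=; lia.
  by rewrite e ltnn in lt.
by exists (Mono sle); [apply: mono_eq|rewrite /= /s eqxx].
Qed.

Lemma surj_endo n (t : mono n n) : surj t -> t = mono_id n.
Proof.
move=> ht; have [s ts _] := surj_section ord0 ht.
have {}ts i : t (s i) = i by have := f_equal (fun u : mono n n => u i) ts.
have si : injective s by move=> i j /(f_equal t); rewrite !ts.
have ti : injective t.
  have [s' ss' s's] := injF_bij si.
  by move=> i j; rewrite -[i]s's -[j]s's !ts => ->.
apply: mono_eq => i; apply: val_inj; apply/eqP; rewrite eqn_leq inj_mono_ge // andbT.
by rewrite -{2}(ts i) mono_le // inj_mono_ge.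
Qed.

(** The bound is strict, so this is the (n-1)-skeleton and [skel 0] is empty. *)
Definition skel (X : sset) n m (x : X m) : Prop :=
  exists k (y : X k) (s : mono m k), (k < n)%N /\ x = sact s y.

Lemma skel_sub X n : sub_sset (@skel X n).
Proof.
by move=> m l t x [k [y [s [kn ->]]]]; exists k, y, (mono_comp s t); rewrite sactM.
Qed.

Lemma skel_nsurj (X : sset) n m (y : X n) (t : mono m n) :
  ~ surj t -> skel n (sact t y).
Proof.
move=> /nsurjP [i ti]; case: n y t i ti => [|n] y t i ti.
  by move: (ti ord0); rewrite (ord1 (t _)) (ord1 i).
have hs a : {b | t a = lift i b} by have := ti a; rewrite eq_sym => /unlift_some [b]; exists b.
pose d : mono n n.+1 := @Mono n n.+1 (lift i) (fun a b h => etrans (leq_bump2 _ _ _) h).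
have sle (a b : 'I_m.+1) : (a <= b)%N -> (sval (hs a) <= sval (hs b))%N.
  move=> ab; rewrite -(leq_bump2 i) -[bump i _]/(nat_of_ord (lift i _)).
  by rewrite -[X in (_ <= X)%N]/(nat_of_ord (lift i _)) -!(svalP (hs _)) mono_le.
exists n, (sact d y), (Mono sle); split=> //; rewrite -sactM; congr sact.
by apply: mono_eq => a /=; case: (hs a).
Qed.

(** Uniqueness in the Eilenberg-Zilber lemma. Every section of [s] is a section of [s'], since a
    surjective monotone endomap is the identity; a section of [s] through [a] then gives
    [s a = s' a]. *)
Lemma skel_unique (X : sset) n m (y y' : X n) (s s' : mono m n) :
  sact s y = sact s' y' -> ~ skel n (sact s y) -> ~ skel n y -> y = y' /\ s = s'.
Proof.
move=> e h hy; have hs : surj s by apply: Classical_Prop.NNPP => /(@skel_nsurj X _ _ y).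
have yE d : mono_comp s d = mono_id n -> y = y' /\ mono_comp s' d = mono_id n.
  move=> sd; have ey : y = sact (mono_comp s' d) y' by rewrite sactM -e -sactM sd sact1.
  have /surj_endo sd' : surj (mono_comp s' d).
    by apply: Classical_Prop.NNPP => /(@skel_nsurj X _ _ y'); rewrite -ey.
  by rewrite sd' sact1 in ey.
split; first by have [d sd _] := surj_section ord0 hs; case: (yE _ sd).
apply: mono_eq => a; have [d sd da] := surj_section a hs; have [_ sd'] := yE _ sd.
by rewrite -{2}da -[LHS]/(mono_id n (s a)) -sd'.
Qed.

Section HomotopyExtension.
Variables (X Z : sset) (HZ : is_kan Z) (P : forall m, X m -> Prop) (HP : sub_sset P).
Let C := sprod X D1.

Definition hep_dom n m (x : C m) : Prop := (P x.1 \/ skel n x.1) \/ x.2 = c0 m.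

Lemma hep_dom_sub n : sub_sset (@hep_dom n).
Proof.
move=> m l t [x s] [[h|h]|/= ->] /=; [left; left|left; right|right].
- exact: HP.
- exact: skel_sub.
- exact: mono_eq.
Qed.

Lemma hep_dom_new n m (x : C m) : hep_dom n.+1 x -> ~ hep_dom n x ->
  exists ys : X n * mono m n, [/\ x.1 = sact ys.2 ys.1, ~ P ys.1 & ~ skel n ys.1].
Proof.
case=> [[h|[k [y [s [kn e]]]]]|h] nh; try by [case: nh; left; left|case: nh; right].
have [kn'|kn'] := ltnP k n; first by case: nh; left; right; exists k, y, s.
have {kn kn'}kn : k = n by lia.
subst k; exists (y, s); split=> // h; apply: nh; left; rewrite e.
- by left; apply: HP.
- by right; apply: skel_sub.
Qed.

(** All nondegenerate [n]-simplices outside [P] are treated at once: a prism filler is chosen for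
    each independently, and [skel_unique] shows that a new simplex lies over only one of them, in
    one way. *)
Lemma hep_step n (f : pmap Z (@hep_dom n)) :
  exists g : pmap Z (@hep_dom n.+1), extends f g.
Proof.
have openE y m (x : sprod (simplex n) D1 m) :
    in_open_prism x -> @hep_dom n m (sact x.1 y, x.2).
  by case=> h; [left; right; apply: skel_nsurj|right].
pose fy y := @PMap _ Z (@in_open_prism n) (fun m x hx => f m _ (openE y m x hx)).
have fyact y : forall m l (t : mono m l) (x : sprod (simplex n) D1 l)
    (h : in_open_prism x) (h' : in_open_prism (sact t x)),
    f m _ (openE y _ _ h') = sact t (f l _ (openE y _ _ h)).
  move=> m l t x h h'; rewrite -(pf_act f _ (hep_dom_sub t (openE y _ _ h))).
  by apply: pf_eq; rewrite /= sactM.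
pose H y := sval (cid (prism_extend HZ (fy y (fyact y)))).
have HE y m (x : sprod (simplex n) D1 m) (h : in_open_prism x) :
    H y m x = f _ _ (openE y _ _ h) by rewrite /H; case: cid => g /= ->.
pose v m (x : C m) (hx : hep_dom n.+1 x) : Z m :=
  match emi (hep_dom n x) with
  | left a => f _ _ a
  | right na => let ys := sval (cid (hep_dom_new hx na)) in H ys.1 m (ys.2, x.2)
  end.
have vA m (x : C m) hx (a : hep_dom n x) : v m x hx = f _ _ a.
  by rewrite /v; case: emi => // a'; apply: pf_eq.
have vT m y (s : mono m n) t hx : ~ P y -> ~ skel n y ->
    v m (sact s y, t) hx = H y m (s, t).
  move=> nP nsk; rewrite /v; case: emi => [a|na].
    have o : @in_open_prism n m (s, t).
      case: (a) => [h|h]; last by right.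
      left => /(surj_section ord0) [d sd _].
      have ey : y = sact d (sact s y) by rewrite -sactM sd sact1.
      by case: h => h; [apply: nP|apply: nsk]; rewrite ey; [apply: HP|apply: skel_sub].
    by rewrite (HE _ _ _ o); apply: pf_eq.
  case: cid => -[y' s'] /= [e nP' nsk'].
  have nsks : ~ skel n (sact s y) by move=> h; apply: na; left; right.
  by have [-> ->] := skel_unique e nsks nsk.
have vact m l (t : mono m l) (x : C l) (hx : hep_dom n.+1 x)
    (hx' : hep_dom n.+1 (sact t x)) : v _ _ hx' = sact t (v _ _ hx).
  case: (emi (hep_dom n x)) => [a|na].
    by rewrite (vA _ _ hx a) (vA _ _ hx' (hep_dom_sub t a)) -(pf_act f _ (hep_dom_sub t a)).
  have [[y s] [/= e nP nsk]] := hep_dom_new hx na.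
  case: x e hx hx' na => x u /= -> hx hx' na.
  by rewrite vT // -sfun_act; move: hx'; rewrite /= -sactM => hx'; apply: vT.
by exists (PMap vact) => m x a hx; apply: vA.
Qed.

Definition hep_ind m (x : C m) : Prop := P x.1 \/ x.2 = c0 m.

Lemma homotopy_extension (f : pmap Z hep_ind) :
  exists g : smap C Z, forall m (x : C m) (h : hep_ind x), g m x = f m x h.
Proof.
have sub0 m (x : C m) : hep_dom 0 x -> hep_ind x.
  by case=> [[h|[k [y [s []]]]]|h] //; [left|right].
pose f0 := @PMap _ Z (@hep_dom 0) (fun m x h => f m x (sub0 m x h))
  (fun m l t x h h' => pf_act f (sub0 _ _ h) (sub0 _ _ h')).
pose F := fix F n : pmap Z (@hep_dom n) :=
  if n is n'.+1 then sval (cid (hep_step (F n'))) else f0.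
have domS n n' m (x : C m) : (n <= n')%N -> hep_dom n x -> hep_dom n' x.
  move=> nn' [[h|[k [y [s [kn e]]]]]|h]; [by left; left| |by right].
  by left; right; exists k, y, s; split=> //; lia.
have FE n n' m (x : C m) (h : hep_dom n x) (h' : hep_dom n' x) :
    (n <= n')%N -> F n' m x h' = F n m x h.
  elim: n' h' => [|n' IH] h'.
    by rewrite leqn0 => /eqP e; subst n; apply: pf_eq.
  rewrite leq_eqVlt => /orP[/eqP e|hn]; first by subst n; apply: pf_eq.
  rewrite -(IH (domS _ _ _ _ _ h) hn) //=; case: cid => g hg /=; exact: hg.
(* An [m]-simplex is reached at stage [m.+1], so the union of the stages is defined everywhere
   without a limit argument. *)
have all m (x : C m) : hep_dom m.+1 x.
  by left; right; exists m, x.1, (mono_id m); rewrite sact1.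
unshelve eexists (@SMap C Z (fun m x => F m.+1 m x (all m x)) _).
  move=> m l t x; set N := maxn m.+1 l.+1.
  have hx : hep_dom N x by apply: domS (all l x); rewrite leq_maxr.
  rewrite -(FE _ N _ _ (all l x) hx) ?leq_maxr // -(pf_act (F N) _ (hep_dom_sub t hx)).
  by symmetry; apply: FE; rewrite leq_maxl.
move=> m x h /=.
have h0 : hep_dom 0 x by case: h => h; [left; left|right].
by rewrite (FE 0 m.+1 m x h0) // /=; apply: pf_eq.
Qed.
End HomotopyExtension.

(** The composite of [f] with [k] is defined on [A] times the interval and on the bottom. Its
    extension to the cylinder restricts, at the end where [k] is the identity, to a strict extension
    of [f]. The deformation may move [A] within itself. *)
Lemma deformation_extend (B Z : sset) (A : forall m, B m -> Prop)
    (k : smap (sprod B D1) B) (f : pmap Z A) :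
  is_kan Z -> sub_sset A ->
  (forall m (b : B m), k m (b, c1 m) = b) ->
  (forall m (b : B m), A m (k m (b, c0 m))) ->
  (forall m (b : B m) t, A m b -> A m (k m (b, t))) ->
  exists g : smap B Z, forall m (b : B m) (h : A m b), g m b = f m b h.
Proof.
move=> HZ HA k1 k0 kA.
have sub m (x : sprod B D1 m) : hep_ind A x -> A m (k m x).
  by case: x => b t [h|/= ->]; [apply: kA|apply: k0].
have fact m l (t : mono m l) (x : sprod B D1 l) (h : hep_ind A x) (h' : hep_ind A (sact t x)) :
    f _ _ (sub _ _ h') = sact t (f _ _ (sub _ _ h)).
  by rewrite -(pf_act f _ (HA _ _ t _ (sub _ _ h))); apply: pf_eq; rewrite sfun_act.
have [g hg] := homotopy_extension HZ HA (@PMap _ Z (hep_ind A) (fun m x h => f _ _ (sub m x h)) fact).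
unshelve eexists (@SMap B Z (fun m b => g m (b, c1 m)) _).
  by move=> m l t x; rewrite -sfun_act /=; congr (g m (_, _)); apply: mono_eq.
by move=> m b h; rewrite /= (hg m (b, c1 m) (or_introl h)) /=; apply: pf_eq.
Qed.

(** * Weak homotopy equivalences *)

Lemma smap_eq X Y (f g : smap X Y) : (forall n x, f n x = g n x) -> f = g.
Proof.
case: f g => f hf [g hg] /= fg.
have {}fg : f = g.
  apply: functional_extensionality_dep => n.
  by apply: functional_extensionality => x; apply: fg.
by case: g / fg hg => hg; congr SMap; apply: proof_irrelevance.
Qed.

Notation "g \os f" := (smap_comp g f) (at level 40, left associativity).

Definition smap_id X : smap X X := @SMap X X (fun n x => x) (fun _ _ _ _ => erefl).

Lemma smap_compA X Y Z T (h : smap Z T) (g : smap Y Z) (f : smap X Y) :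
  h \os (g \os f) = h \os g \os f.
Proof. exact: smap_eq. Qed.

Lemma smap_comps1 X Y (f : smap X Y) : f \os smap_id X = f.
Proof. exact: smap_eq. Qed.

Lemma homotopic_refl X Y (f : smap X Y) : homotopic f f.
Proof. exact: rst_refl. Qed.

Lemma homotopic_sym X Y (f g : smap X Y) : homotopic f g -> homotopic g f.
Proof. exact: rst_sym. Qed.

Lemma homotopic_trans X Y (g f h : smap X Y) :
  homotopic f g -> homotopic g h -> homotopic f h.
Proof. exact: rst_trans. Qed.

Lemma homotopic_comp X Y Z (g g' : smap Y Z) (f : smap X Y) :
  homotopic g g' -> homotopic (g \os f) (g' \os f).
Proof.
apply: (@clos_map _ _ _ _ (fun g => g \os f)) => {}g {}g' [H hH].
unshelve eexists (@SMap (sprod X D1) Z (fun n x => H n (f n x.1, x.2)) _).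
  by move=> m n t x; rewrite -sfun_act /= sfun_act.
by move=> n x; apply: hH.
Qed.

Lemma elem_homotopic_comp X Y Z (g : smap Y Z) (f f' : smap X Y) :
  elem_homotopic f f' -> elem_homotopic (g \os f) (g \os f').
Proof. by case=> H hH; exists (g \os H) => n x; have [/= -> ->] := hH n x. Qed.

(* equality in the homotopy category of simplicial sets *)
Definition heq X Y (f g : smap X Y) : Prop :=
  forall Z, is_kan Z -> forall k : smap Y Z, homotopic (k \os f) (k \os g).

Lemma elem_heq X Y (f g : smap X Y) : elem_homotopic f g -> heq f g.
Proof. by move=> h Z _ k; apply/rst_step/elem_homotopic_comp. Qed.

Lemma heq_sym X Y (f g : smap X Y) : heq f g -> heq g f.
Proof. by move=> h Z HZ k; apply/homotopic_sym/h. Qed.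

Lemma heq_post X Y Z (g : smap Y Z) (f f' : smap X Y) :
  heq f f' -> heq (g \os f) (g \os f').
Proof. by move=> h T HT k; rewrite !smap_compA; apply: h. Qed.

Lemma weq_heq X Y (f g : smap X Y) : heq f g -> sset_weq f -> sset_weq g.
Proof.
move=> fg wf Z HZ; have [s i] := wf Z HZ; split=> [h|h h' e].
  by have [k hk] := s h; exists k; apply: homotopic_trans hk; apply/homotopic_sym/fg.
by apply: i; apply: homotopic_trans (fg _ _ _) _ => //;
   apply: homotopic_trans e _; apply/homotopic_sym/fg.
Qed.

Lemma weq_comp X Y Z (g : smap Y Z) (f : smap X Y) :
  sset_weq g -> sset_weq f -> sset_weq (g \os f).
Proof.
move=> wg wf T HT; have [sg ig] := wg T HT; have [sf jf] := wf T HT; split=> [h|h h'].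
  have [k hk] := sf h; have [l hl] := sg k; exists l; rewrite smap_compA.
  exact: homotopic_trans (homotopic_comp _ hl) hk.
by rewrite !smap_compA => /jf /ig.
Qed.

Lemma weq_cancel_right X Y Z (g : smap Y Z) (f : smap X Y) :
  sset_weq f -> sset_weq (g \os f) -> sset_weq g.
Proof.
move=> wf wgf T HT; have [sf jf] := wf T HT; have [s i] := wgf T HT; split=> [h|h h' e].
  have [k hk] := s (h \os f); exists k; apply: jf; by rewrite -smap_compA.
by apply: i; rewrite !smap_compA; apply: homotopic_comp.
Qed.

Lemma weq_cancel_left X Y Z (g : smap Y Z) (f : smap X Y) :
  sset_weq g -> sset_weq (g \os f) -> sset_weq f.
Proof.
move=> wg wgf T HT; have [sg ig] := wg T HT; have [s i] := wgf T HT; split=> [h|h h' e].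
  by have [k hk] := s h; exists (k \os g); rewrite -smap_compA.
have [k hk] := sg h; have [k' hk'] := sg h'.
apply: homotopic_trans (homotopic_sym hk) _; apply: (homotopic_trans _ hk').
apply: homotopic_comp; apply: i; rewrite !smap_compA.
apply: homotopic_trans (homotopic_comp _ hk) _; apply: homotopic_trans e _.
exact: homotopic_comp (homotopic_sym hk').
Qed.

Lemma weq_inverse X Y (f : smap X Y) (g : smap Y X) :
  heq (g \os f) (smap_id X) -> heq (f \os g) (smap_id Y) -> sset_weq f.
Proof.
move=> gf fg Z HZ; split=> [h|h h' /(homotopic_comp g) e].
  by exists (h \os g); rewrite -smap_compA -[X in homotopic _ X]smap_comps1; apply: gf.
rewrite -!smap_compA in e; rewrite -[h]smap_comps1 -[h']smap_comps1.
apply: homotopic_trans (homotopic_sym (fg _ HZ h)) _.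
exact: homotopic_trans e (fg _ HZ h').
Qed.

(* Up to the weak equivalences v0 and v1, the map a is a retract of b in the
   homotopy category of maps. *)
Lemma weq_retract A0 A1 B0 B1 E0 E1 (a : smap A0 A1) (b : smap B0 B1)
    (e : smap E0 E1) (t0 : smap A0 B0) (t1 : smap A1 B1) (s0 : smap B0 E0)
    (s1 : smap B1 E1) (v0 : smap A0 E0) (v1 : smap A1 E1) :
  b \os t0 = t1 \os a -> e \os s0 = s1 \os b -> e \os v0 = v1 \os a ->
  heq (s0 \os t0) v0 -> heq (s1 \os t1) v1 -> sset_weq v0 -> sset_weq v1 ->
  sset_weq b -> sset_weq a.
Proof.
move=> bt es ev h0 h1 w0 w1 wb Z HZ.
have [sv0 iv0] := w0 Z HZ; have [sv1 iv1] := w1 Z HZ; have [sb ib] := wb Z HZ.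
split=> [g|h h' ha].
  have [k hk] := sv0 g; have [l hl] := sb (k \os s0).
  exists (l \os t1); rewrite -smap_compA -bt smap_compA.
  apply: homotopic_trans (homotopic_comp _ hl) _; rewrite -smap_compA.
  exact: homotopic_trans (h0 _ HZ k) hk.
have [k hk] := sv1 h; have [k' hk'] := sv1 h'.
have {ha}ha : homotopic (k \os v1 \os a) (k' \os v1 \os a).
  apply: homotopic_trans (homotopic_comp _ hk) _; apply: homotopic_trans ha _.
  exact: homotopic_comp (homotopic_sym hk').
rewrite -!smap_compA -ev !smap_compA in ha.
have {ha}ha : homotopic (k \os s1) (k' \os s1).
  by apply: ib; rewrite -!smap_compA -es !smap_compA; apply/homotopic_comp/iv0.
apply: homotopic_trans (homotopic_sym hk) _; apply: (homotopic_trans _ hk').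
apply: homotopic_trans (homotopic_sym (h1 _ HZ k)) _.
by apply: homotopic_trans (h1 _ HZ k'); rewrite !smap_compA; apply: homotopic_comp.
Qed.

(** * Reduced zigzags *)

Section ZigzagClasses.
Variables (X : category) (V : mclass X).

Definition zzq (x y : ob X) : Type := quot (@zz_step X V (@zz_reduce X V) x y).
Definition qc x y (p : zigzag V x y) : zzq x y :=
  qclass (@zz_step X V (@zz_reduce X V) x y) p.

Lemma qc_surj x y (a : zzq x y) : exists p, a = qc p.
Proof. exact: qclass_surj. Qed.

Definition zrep x y (a : zzq x y) : zigzag V x y := sval (cid (qc_surj a)).

Lemma zrepK x y (a : zzq x y) : qc (zrep a) = a.
Proof. by rewrite /zrep; case: cid. Qed.

Definition zeq x y := clos_refl_sym_trans _ (@zz_step X V (@zz_reduce X V) x y).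

Lemma qc_eqP x y (p q : zigzag V x y) : qc p = qc q -> zeq p q.
Proof.
move=> /(f_equal (fun a => proj1_sig a q)) /= e.
by have : zeq q q by [apply: rst_refl]; rewrite /zeq -e.
Qed.

Lemma zeq_cat x y z (p p' : zigzag V x y) (q q' : zigzag V y z) :
  zeq p p' -> zeq q q' -> zeq (zz_cat p q) (zz_cat p' q').
Proof.
move=> hp hq; apply: (@rst_trans _ _ _ (zz_cat p' q)).
  apply: (@clos_map _ _ _ _ (fun r => zz_cat r q)) hp => s t.
  by apply: zz_step_cat => a b u v c r; apply: zz_reduce_cat.
move: q q' hq; clear; elim: p' => //= [x' y' z' f p IH|x' y' z' w hw p IH] q q' /IH.
  by apply: (@clos_map _ _ _ _ (fun r => zz_fwd f r)) => *; apply: zzs_fwd.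
by apply: (@clos_map _ _ _ _ (fun r => zz_bwd hw r)) => *; apply: zzs_bwd.
Qed.

Definition qcat x y z (a : zzq x y) (b : zzq y z) : zzq x z :=
  qc (zz_cat (zrep a) (zrep b)).

Lemma qcatE x y z (p : zigzag V x y) (q : zigzag V y z) :
  qcat (qc p) (qc q) = qc (zz_cat p q).
Proof. by apply: qclassP; apply: zeq_cat; apply: qc_eqP; rewrite zrepK. Qed.

Definition qid x : zzq x x := qc (zz_nil x).
Definition qf x y (f : hom x y) : zzq x y := qc (zz_fwd f (zz_nil y)).
Definition qb x y (w : hom y x) (hw : V w) : zzq x y := qc (zz_bwd hw (zz_nil y)).

End ZigzagClasses.
Notation "a ;; b" := (qcat a b) (at level 41, right associativity).
Arguments qid {X V} x.
Arguments qf {X} V {x y} f.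

Section ZigzagCategory.
Variables (X : category) (V : mclass X).
Local Notation zzq := (zzq V).

Lemma qcatA x y z t (a : zzq x y) (b : zzq y z) (c : zzq z t) :
  a ;; (b ;; c) = (a ;; b) ;; c.
Proof.
rewrite -(zrepK a) -(zrepK b) -(zrepK c) !qcatE; congr qc.
by elim: (zrep a) (zrep b) => //= [? ? ? ? p IH|? ? ? ? ? p IH] q; rewrite IH.
Qed.

Lemma qcat1 x y (a : zzq x y) : qid x ;; a = a.
Proof. by rewrite -(zrepK a) qcatE. Qed.

Lemma qcat1r x y (a : zzq x y) : a ;; qid y = a.
Proof.
rewrite -(zrepK a) qcatE; congr qc.
by elim: (zrep a) => //= [? ? ? ? p ->|? ? ? ? ? p ->].
Qed.

Lemma qc_fwd x y z (f : hom x y) (p : zigzag V y z) :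
  qc (zz_fwd f p) = qf V f ;; qc p.
Proof. by rewrite qcatE. Qed.

Lemma qc_bwd x y z (w : hom y x) (hw : V w) (p : zigzag V y z) :
  qc (zz_bwd hw p) = qb hw ;; qc p.
Proof. by rewrite qcatE. Qed.

Lemma zzq_ind (x y : ob X) (a : zzq x y) (P : forall x y, zzq x y -> Prop) :
  (forall x, P x x (qid x)) ->
  (forall x y z (f : hom x y) (a : zzq y z), P y z a -> P x z (qf V f ;; a)) ->
  (forall x y z (w : hom y x) (hw : V w) (a : zzq y z), P y z a -> P x z (qb hw ;; a)) ->
  P x y a.
Proof.
move=> h1 hf hb; rewrite -(zrepK a); elim: (zrep a) => [z|x' y' z f p|x' y' z w hw p] //.
  by rewrite qc_fwd; apply: hf.
by rewrite qc_bwd; apply: hb.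
Qed.

Lemma qf1 x : qf V (idm x) = qid x.
Proof. by apply/qclassP/rst_step/zzs_base; constructor. Qed.

Lemma qfM x y z (f : hom x y) (g : hom y z) : qf V f ;; qf V g = qf V (g ∘ f).
Proof. by rewrite qcatE; apply/qclassP/rst_step/zzs_base; constructor. Qed.

Lemma qb1 x (h : V (idm x)) : qb h = qid x.
Proof. by apply/qclassP/rst_step/zzs_base; constructor. Qed.

Lemma qbM x y z (f : hom y x) (g : hom z y) (hf : V f) (hg : V g) (hfg : V (f ∘ g)) :
  qb hf ;; qb hg = qb hfg.
Proof. by rewrite qcatE; apply/qclassP/rst_step/zzs_base; constructor. Qed.

Lemma qb_eq x y (w w' : hom y x) (h : V w) (h' : V w') : w = w' -> qb h = qb h'.
Proof. by move=> e; case: w' / e h' => h'; congr qb; apply: proof_irrelevance. Qed.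

Lemma qfMA x y z t (f : hom x y) (g : hom y z) (a : zzq z t) :
  qf V f ;; qf V g ;; a = qf V (g ∘ f) ;; a.
Proof. by rewrite qcatA qfM. Qed.

End ZigzagCategory.

Section ZigzagMap.
Variables (X Y : category) (F : functor X Y) (V : mclass X) (W : mclass Y).
Hypothesis h : forall x y (f : hom x y), V f -> W (fmap F f).

Definition zmap x y (a : zzq V x y) : zzq W (F x) (F y) :=
  quot_map (@zz_step_map X Y F V W h x y) a.

Lemma zmapE x y (p : zigzag V x y) : zmap (qc p) = qc (zz_map h p).
Proof. exact: quot_mapE. Qed.

Lemma zmap_cat x y z (a : zzq V x y) (b : zzq V y z) :
  zmap (a ;; b) = zmap a ;; zmap b.
Proof. by rewrite -(zrepK a) -(zrepK b) qcatE !zmapE qcatE zz_map_cat. Qed.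

Lemma zmap1 x : zmap (qid x) = qid (F x).
Proof. exact: zmapE. Qed.

Lemma zmap_f x y (f : hom x y) : zmap (qf V f) = qf W (fmap F f).
Proof. exact: zmapE. Qed.

Lemma zmap_b x y (w : hom y x) (hw : V w) : zmap (qb hw) = qb (h hw).
Proof. exact: zmapE. Qed.

End ZigzagMap.

(** ** Normal forms *)

(** Normal forms have to recognize an identity among arrows whose ends are only provably equal,
    whence the transport. *)
Definition is_id (X : category) (x y : ob X) (f : hom x y) : Prop :=
  exists e : x = y, eq_rect x (hom x) (idm x) y e = f.

Lemma is_id1 (X : category) (x : ob X) : is_id (idm x).
Proof. by exists erefl. Qed.

Lemma is_id_ob (X : category) (x y : ob X) (f : hom x y) : is_id f -> y = x.
Proof. by case. Qed.

Section NormalForm.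
Variables (X : category) (V : mclass X).
Hypothesis VM : forall x y z (g : @hom X y z) (f : hom x y), V g -> V f -> V (g ∘ f).
Local Notation zz := (zigzag V).

Definition zcast x y z (e : y = x) (p : zz y z) : zz x z :=
  eq_rect y (fun u => zz u z) p x e.

Lemma zcast1 x z (e : x = x) (p : zz x z) : zcast e p = p.
Proof. by rewrite (proof_irrelevance _ e erefl). Qed.

Definition mk_fwd x y z (f : hom x y) (p : zz y z) : zz x z :=
  match emi (is_id f) with
  | left h => zcast (is_id_ob h) p
  | right _ => zz_fwd f p
  end.

Definition mk_bwd x y z (w : hom y x) (hw : V w) (p : zz y z) : zz x z :=
  match emi (is_id w) with
  | left h => zcast (esym (is_id_ob h)) p
  | right _ => zz_bwd hw p
  end.

Variant mk_fwd_spec x z : forall y, hom x y -> zz y z -> zz x z -> Prop :=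
| MkFwdId p : mk_fwd_spec (idm x) p p
| MkFwd y (f : hom x y) p : ~ is_id f -> mk_fwd_spec f p (zz_fwd f p).

Lemma mk_fwdP x y z (f : hom x y) (p : zz y z) : mk_fwd_spec f p (mk_fwd f p).
Proof.
rewrite /mk_fwd; case: emi => [h|]; last exact: MkFwd.
case: (h) => e ef; subst y; rewrite zcast1 -ef; exact: MkFwdId.
Qed.

Variant mk_bwd_spec x z : forall y (w : hom y x), V w -> zz y z -> zz x z -> Prop :=
| MkBwdId (h : V (idm x)) p : mk_bwd_spec h p p
| MkBwd y (w : hom y x) (hw : V w) p : ~ is_id w -> mk_bwd_spec hw p (zz_bwd hw p).

Lemma mk_bwdP x y z (w : hom y x) (hw : V w) (p : zz y z) :
  mk_bwd_spec hw p (mk_bwd hw p).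
Proof.
rewrite /mk_bwd; case: emi => [h|]; last exact: MkBwd.
case: (h) => e ew; subst y; rewrite zcast1; case: w / ew hw h => hw _.
exact: MkBwdId.
Qed.

(** One merge suffices: if [g ∘ f] is an identity and disappears, the remaining [p'] does not start
    with a forward arrow when the word was reduced. *)
Definition cons_fwd x y z (f : hom x y) (p : zz y z) : zz x z :=
  match p in zigzag _ y z return hom x y -> zz x z with
  | zz_nil y => fun f => mk_fwd f (zz_nil y)
  | zz_fwd _ _ _ g p' => fun f => mk_fwd (g ∘ f) p'
  | zz_bwd _ _ _ w hw p' => fun f => mk_fwd f (zz_bwd hw p')
  end f.

Definition cons_bwd x y z (w : hom y x) (hw : V w) (p : zz y z) : zz x z :=
  match p in zigzag _ y z return forall w : hom y x, V w -> zz x z with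
  | zz_nil y => fun w hw => mk_bwd hw (zz_nil y)
  | zz_fwd _ _ _ g p' => fun w hw => mk_bwd hw (zz_fwd g p')
  | zz_bwd _ _ _ w' hw' p' => fun w hw => mk_bwd (VM hw hw') p'
  end w hw.

Fixpoint nf x y (p : zz x y) : zz x y :=
  match p in zigzag _ x y return zz x y with
  | zz_nil x => zz_nil x
  | zz_fwd _ _ _ f p => cons_fwd f (nf p)
  | zz_bwd _ _ _ w hw p => cons_bwd hw (nf p)
  end.

Definition fwd_head x y (p : zz x y) : bool := if p is zz_fwd _ _ _ _ _ then true else false.
Definition bwd_head x y (p : zz x y) : bool := if p is zz_bwd _ _ _ _ _ _ then true else false.

Fixpoint reduced x y (p : zz x y) : Prop :=
  match p with
  | zz_nil _ => True
  | zz_fwd _ _ _ f p => [/\ ~ is_id f, ~~ fwd_head p & reduced p]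
  | zz_bwd _ _ _ w _ p => [/\ ~ is_id w, ~~ bwd_head p & reduced p]
  end.

Lemma cons_fwd_nf x y z (f : hom x y) (p : zz y z) :
  reduced p -> ~~ fwd_head p -> cons_fwd f p = mk_fwd f p.
Proof. by case: p f. Qed.

Lemma cons_bwd_nb x y z (w : hom y x) (hw : V w) (p : zz y z) :
  reduced p -> ~~ bwd_head p -> cons_bwd hw p = mk_bwd hw p.
Proof. by case: p w hw. Qed.

Lemma mk_fwd_reduced x y z (f : hom x y) (p : zz y z) :
  reduced p -> ~~ fwd_head p -> reduced (mk_fwd f p).
Proof. by case: mk_fwdP. Qed.

Lemma mk_bwd_reduced x y z (w : hom y x) (hw : V w) (p : zz y z) :
  reduced p -> ~~ bwd_head p -> reduced (mk_bwd hw p).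
Proof. by case: mk_bwdP. Qed.

Lemma cons_fwd_reduced x y z (f : hom x y) (p : zz y z) :
  reduced p -> reduced (cons_fwd f p).
Proof.
case: p f => [y' f _|y' t z' g p f /= [_ h hp]|y' t z' w hw p f hp] /=;
  exact: mk_fwd_reduced.
Qed.

Lemma cons_bwd_reduced x y z (w : hom y x) (hw : V w) (p : zz y z) :
  reduced p -> reduced (cons_bwd hw p).
Proof.
case: p w hw => [y' w hw _|y' t z' g p w hw hp|y' t z' w' hw' p w hw /= [_ h hp]] /=;
  exact: mk_bwd_reduced.
Qed.

Lemma nf_reduced x y (p : zz x y) : reduced (nf p).
Proof.
by elim: p => //= *; [apply: cons_fwd_reduced|apply: cons_bwd_reduced].
Qed.

Lemma mk_fwd1 x y (p : zz x y) : mk_fwd (idm x) p = p.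
Proof.
by rewrite /mk_fwd; case: emi => [h|[]]; [rewrite zcast1|apply: is_id1].
Qed.

Lemma mk_bwd1 x y (h : V (idm x)) (p : zz x y) : mk_bwd h p = p.
Proof.
by rewrite /mk_bwd; case: emi => [h'|[]]; [rewrite zcast1|apply: is_id1].
Qed.

Lemma mk_fwdN x y z (f : hom x y) (p : zz y z) : ~ is_id f -> mk_fwd f p = zz_fwd f p.
Proof. by rewrite /mk_fwd; case: emi. Qed.

Lemma mk_bwdN x y z (w : hom y x) (hw : V w) (p : zz y z) :
  ~ is_id w -> mk_bwd hw p = zz_bwd hw p.
Proof. by rewrite /mk_bwd; case: emi. Qed.

Lemma cons_fwd1 x y (p : zz x y) : reduced p -> cons_fwd (idm x) p = p.
Proof.
case: p => [x'|x' t y' g p|x' t y' w hw p] /=; rewrite ?compm1 ?mk_fwd1 // => -[h _ _].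
exact: mk_fwdN.
Qed.

Lemma mk_bwd_eq x y z (w w' : hom y x) (hw : V w) (hw' : V w') (p : zz y z) :
  w = w' -> mk_bwd hw p = mk_bwd hw' p.
Proof. by move=> e; case: w' / e hw' => hw'; congr mk_bwd; apply: proof_irrelevance. Qed.

Lemma cons_bwd1 x y (h : V (idm x)) (p : zz x y) : reduced p -> cons_bwd h p = p.
Proof.
case: p h => [x'|x' t y' g p|x' t y' w hw p] h /=; rewrite ?mk_bwd1 // => -[nw _ _].
by rewrite (mk_bwd_eq (VM h hw) hw) ?comp1m // mk_bwdN.
Qed.

Lemma cons_fwdM x y z t (f : hom x y) (g : hom y z) (p : zz z t) :
  reduced p -> cons_fwd f (cons_fwd g p) = cons_fwd (g ∘ f) p.
Proof.
have mk (z' : ob X) (h : hom y z') (q : zz z' t) : reduced q -> ~~ fwd_head q ->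
    cons_fwd f (mk_fwd h q) = mk_fwd (h ∘ f) q.
  by move=> rq nq; case: mk_fwdP rq nq => [q'|z'' h' q' _] rq nq //; rewrite comp1m cons_fwd_nf.
case: p g mk => [z'|z' u t' h p|z' u t' w hw p] g mk rp /=; try exact: mk.
by case: rp => _ np rp; rewrite mk // compA.
Qed.

Lemma cons_bwdM x y z t (f : hom y x) (g : hom z y) (hf : V f) (hg : V g)
    (hfg : V (f ∘ g)) (p : zz z t) :
  reduced p -> cons_bwd hf (cons_bwd hg p) = cons_bwd hfg p.
Proof.
have mk (z' : ob X) (h : hom z' y) (hh : V h) (hfh : V (f ∘ h)) (q : zz z' t) :
    reduced q -> ~~ bwd_head q -> cons_bwd hf (mk_bwd hh q) = mk_bwd hfh q.
  move=> rq nq; case: mk_bwdP hfh rq nq => [h1 q'|z'' h' hh' q' _] hfh rq nq /=.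
    by rewrite cons_bwd_nb //; apply: mk_bwd_eq; rewrite compm1.
  exact: mk_bwd_eq.
case: p g hg hfg mk => [z'|z' u t' h p|z' u t' w hw p] g hg hfg mk rp /=; try exact: mk.
case: rp => _ np rp; rewrite (mk _ _ _ (VM hf (VM hg hw))) //.
by apply: mk_bwd_eq; rewrite compA.
Qed.

(** [nf] lets the letters act one after the other on reduced words. Contexts are therefore harmless,
    and only the four generating reductions have to be checked on a reduced tail. *)
Lemma nf_zeq x y (p q : zz x y) : zeq p q -> nf p = nf q.
Proof.
elim=> {p q} [p q h|//|p q _ -> //|p q r _ -> _ -> //].
elim: h => {x y p q} [x y p q h|x y z f p q _ /= -> //|x y z w hw p q _ /= -> //].
case: h => {x y p q} [x y p|x y z t f g p|x y h p|x y z t f g hf hg hfg p] /=.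
- by rewrite cons_fwd1 //; apply: nf_reduced.
- by rewrite cons_fwdM //; apply: nf_reduced.
- by rewrite cons_bwd1 //; apply: nf_reduced.
- by rewrite (cons_bwdM _ _ hfg) //; apply: nf_reduced.
Qed.

Lemma qc_mk_fwd x y z (f : hom x y) (p : zz y z) : qc (mk_fwd f p) = qf V f ;; qc p.
Proof. by case: mk_fwdP => [q|? ? ? _]; rewrite ?qf1 ?qcat1 ?qc_fwd. Qed.

Lemma qc_mk_bwd x y z (w : hom y x) (hw : V w) (p : zz y z) :
  qc (mk_bwd hw p) = qb hw ;; qc p.
Proof. by case: mk_bwdP => [h q|? ? ? ? _]; rewrite ?qb1 ?qcat1 ?qc_bwd. Qed.

Lemma qc_cons_fwd x y z (f : hom x y) (p : zz y z) :
  qc (cons_fwd f p) = qf V f ;; qc p.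
Proof.
case: p f => [y' f|y' t z' g p f|y' t z' w hw p f] /=; rewrite qc_mk_fwd //.
by rewrite qc_fwd qfMA.
Qed.

Lemma qc_cons_bwd x y z (w : hom y x) (hw : V w) (p : zz y z) :
  qc (cons_bwd hw p) = qb hw ;; qc p.
Proof.
case: p w hw => [y' w hw|y' t z' g p w hw|y' t z' w' hw' p w hw] /=; rewrite qc_mk_bwd //.
by rewrite qc_bwd qcatA (qbM _ _ (VM hw hw')).
Qed.

Lemma qc_nf x y (p : zz x y) : qc (nf p) = qc p.
Proof.
by elim: p => //= [? ? ? ? ? IH|? ? ? ? ? ? IH];
  rewrite ?qc_cons_fwd ?qc_cons_bwd IH -?qc_fwd -?qc_bwd.
Qed.

Lemma nf_id x y (p : zz x y) : reduced p -> nf p = p.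
Proof.
elim: p => //= [x' y' z f p IH [nf np rp]|x' y' z w hw p IH [nw np rp]].
  by rewrite IH // cons_fwd_nf // mk_fwdN.
by rewrite IH // cons_bwd_nb // mk_bwdN.
Qed.

Fixpoint blen x y (p : zz x y) : nat :=
  match p with
  | zz_nil _ => 0
  | zz_fwd _ _ _ _ p => blen p
  | zz_bwd _ _ _ _ _ p => (blen p).+1
  end.

Definition qlen x y (a : zzq V x y) : nat := blen (nf (zrep a)).

Lemma nf_zrep x y (p : zz x y) : nf (zrep (qc p)) = nf p.
Proof. by apply/nf_zeq/qc_eqP; rewrite zrepK. Qed.

Lemma qlenE x y (p : zz x y) : qlen (qc p) = blen (nf p).
Proof. by rewrite /qlen nf_zrep. Qed.

Lemma blen_mk_fwd x y z (f : hom x y) (p : zz y z) : blen (mk_fwd f p) = blen p.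
Proof. by case: mk_fwdP. Qed.

Lemma blen_mk_bwd x y z (w : hom y x) (hw : V w) (p : zz y z) :
  (blen (mk_bwd hw p) <= (blen p).+1)%N.
Proof. by case: mk_bwdP => *; rewrite //= leqnSn. Qed.

Lemma blen_mk_bwd_id x y z (w : hom y x) (hw : V w) (p : zz y z) :
  is_id w -> blen (mk_bwd hw p) = blen p.
Proof. by rewrite /mk_bwd; case: emi => // h _; have [e _] := h; subst y; rewrite zcast1. Qed.

Lemma blen_cons_fwd x y z (f : hom x y) (p : zz y z) : blen (cons_fwd f p) = blen p.
Proof. by case: p f => *; apply: blen_mk_fwd. Qed.

Lemma blen_cons_bwd x y z (w : hom y x) (hw : V w) (p : zz y z) :
  (blen (cons_bwd hw p) <= (blen p).+1)%N.
Proof.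
case: p w hw => [y' w hw|y' t z' g p w hw|y' t z' w' hw' p w hw] /=; try exact: blen_mk_bwd.
exact: leq_trans (blen_mk_bwd _ _) _.
Qed.

Lemma qlen_f x y z (f : hom x y) (a : zzq V y z) : qlen (qf V f ;; a) = qlen a.
Proof. by rewrite -(zrepK a) -qc_fwd !qlenE /= blen_cons_fwd. Qed.

Lemma qlen_b x y z (w : hom y x) (hw : V w) (a : zzq V y z) :
  (qlen (qb hw ;; a) <= (qlen a).+1)%N.
Proof. by rewrite -(zrepK a) -qc_bwd !qlenE /= blen_cons_bwd. Qed.

(* Whether a backward arrow lengthens a word depends on the arrow only through
   its being an identity. *)
Lemma qlen_b_stable y y' z (w : hom z y) (hw : V w) (v : hom z y') (hv : V v) t
    (a : zzq V z t) :
  (is_id w -> is_id v) ->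
  (qlen (qb hw ;; a) <= qlen a)%N -> (qlen (qb hv ;; a) <= qlen a)%N.
Proof.
move=> wv; rewrite -(zrepK a) -!qc_bwd !qlenE /=; move: (nf _) => p.
case: p w hw v hv wv => [z'|z' u t' g p|z' u t' w' hw' p] w hw v hv wv /=; first 2 last.
  by move=> _; apply: blen_mk_bwd.
- rewrite /mk_bwd; case: emi => // hid; case: emi => [hid'|[]]; last exact: wv.
  by have [e _] := hid'; subst y'; rewrite zcast1.
- rewrite /mk_bwd; case: emi => [hid|]; last by rewrite /= ltnn.
  case: emi => [hid' _|[]]; last exact: wv.
  by have [e _] := hid'; subst y'; rewrite zcast1.
Qed.

(* the word f w^-1 q *)
Record word (x t : ob X) := Word {
  wd1 : ob X;
  wd2 : ob X;
  wdf : hom x wd1;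
  wdw : hom wd2 wd1;
  wdV : V wdw;
  wdq : zzq V wd2 t
}.

Definition decomp_zz (x t : ob X) (p : zz x t) : option (word x t) :=
  match p with
  | zz_bwd x y t w hw q => Some (Word (idm x) hw (qc q))
  | zz_fwd x y t f p =>
      match p in zigzag _ y t return hom x y -> option (word x t) with
      | zz_bwd _ _ _ w hw q => fun f => Some (Word f hw (qc q))
      | _ => fun _ => None
      end f
  | _ => None
  end.

Definition decomp (x t : ob X) (a : zzq V x t) : option (word x t) := decomp_zz (nf (zrep a)).

(** If [w] lengthens [q], then [w] is no identity and does not merge with the head of [q]. So the
    word is already normal, up to dropping an identity [f], and its decomposition is unique. *)
Lemma decomp_word (x t : ob X) (d : word x t) :
  qlen (qb (wdV d) ;; wdq d) = (qlen (wdq d)).+1 ->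
  decomp (qf V (wdf d) ;; qb (wdV d) ;; wdq d) = Some d.
Proof.
case: d => y z f w hw q /=; rewrite -(zrepK q) -(qc_nf (zrep q)).
have := nf_reduced (zrep q); move: (nf _) => p rp.
rewrite -qc_bwd -qc_fwd /decomp !qlenE nf_zrep /= (nf_id rp).
case: p w hw rp => [z'|z' u t' g p|z' u t' w' hw' p] w hw rp /=; first 2 last.
- by move=> e; have := leq_trans (eq_leq (esym e)) (blen_mk_bwd _ _); rewrite ltnn.
- have [i|ni] := emi (is_id w).
    by move/eqP; rewrite blen_mk_bwd_id // eqn_leq ltnn andbF.
  move=> _; rewrite mk_bwdN //=; have [[e ef]|nif] := emi (is_id f); last by rewrite mk_fwdN.
  by subst x; rewrite -ef /= mk_fwd1.
- have [i|ni] := emi (is_id w).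
    by move/eqP; rewrite blen_mk_bwd_id // eqn_leq ltnn andbF.
  move=> _; rewrite mk_bwdN //=; have [[e ef]|nif] := emi (is_id f); last by rewrite mk_fwdN.
  by subst x; rewrite -ef /= mk_fwd1.
Qed.

Lemma decompP (x t : ob X) (a : zzq V x t) n : qlen a = n.+1 ->
  exists d : word x t,
    [/\ decomp a = Some d, a = qf V (wdf d) ;; qb (wdV d) ;; wdq d & qlen (wdq d) = n].
Proof.
rewrite -(zrepK a) -(qc_nf (zrep a)); have := nf_reduced (zrep a); move: (nf _) => p rp.
rewrite /decomp qlenE nf_zrep (nf_id rp).
case: p rp => // [x' y t' f p|x' y t' w hw p] /=.
  case: p f => [y' f|y' z t'' g q f [] //|y' z t'' w hw q f] //= [_ _ [_ _ rq]] [e].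
  by exists (Word f hw (qc q)); rewrite /= -qc_bwd -qc_fwd qlenE nf_id.
case=> _ _ rp [e]; exists (Word (idm x') hw (qc p)).
by rewrite /= qf1 qcat1 -qc_bwd qlenE nf_id.
Qed.

Lemma qlen0 x t (a : zzq V x t) : qlen a = 0 -> exists f : hom x t, a = qf V f.
Proof.
rewrite -(zrepK a) -(qc_nf (zrep a)); have := nf_reduced (zrep a); move: (nf _) => p rp.
rewrite qlenE (nf_id rp).
case: p rp => // [x' _ _|x' y t' f p]; first by exists (idm x'); rewrite qf1.
case: p f => // [y' f _ _|y' z t'' g p f []] //; by exists f.
Qed.

End NormalForm.

Lemma blen_map (X Y : category) (F : functor X Y) (V : mclass X) (W : mclass Y)
    (h : forall x y (f : hom x y), V x y f -> W _ _ (fmap F f)) x y (p : zigzag V x y) :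
  blen (zz_map h p) = blen p.
Proof. by elim: p => //= ? ? ? ? ? p ->. Qed.

Lemma blen_nf (X : category) (V : mclass X)
    (VM : forall x y z (g : @hom X y z) (f : hom x y), V y z g -> V x y f -> V x z (g ∘ f))
    x y (p : zigzag V x y) :
  (blen (nf VM p) <= blen p)%N.
Proof.
elim: p => //= [? ? ? ? p IH|? ? ? ? ? p IH]; first by rewrite blen_cons_fwd.
by apply: leq_trans (blen_cons_bwd _ _ _) _.
Qed.

(** Only an inequality, since a functor can turn an arrow into an identity. For restriction along
    simplicial operators this is what makes the words of bounded length a subcomplex. *)
Lemma qlen_map (X Y : category) (F : functor X Y) (V : mclass X) (W : mclass Y)
    (h : forall x y (f : hom x y), V x y f -> W _ _ (fmap F f))
    (VM : forall x y z (g : @hom X y z) (f : hom x y), V y z g -> V x y f -> V x z (g ∘ f))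
    (WM : forall x y z (g : @hom Y y z) (f : hom x y), W y z g -> W x y f -> W x z (g ∘ f))
    x y (a : zzq V x y) :
  (qlen WM (zmap h a) <= qlen VM a)%N.
Proof.
rewrite -(zrepK a) -(qc_nf VM (zrep a)) zmapE !qlenE (nf_id VM (nf_reduced VM _)).
by apply: leq_trans (blen_nf _ _) _; rewrite blen_map.
Qed.

(** * Natural transformations act on mapping spaces *)

Definition weq_closed (C : category) (W : wclass C) : Prop :=
  forall x y z (g : @hom C y z) (f : hom x y), wmap W g -> wmap W f -> wmap W (g ∘ f).

Lemma chain_closed C (W : wclass C) (k : nat) : weq_closed W ->
  forall x y z (g : @hom (chain_cat W k) y z) (f : hom x y),
    chain_weq g -> chain_weq f -> chain_weq (g ∘ f).
Proof. by move=> WM x y z g f hg hf i; apply: WM. Qed.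

Lemma chain_is_id C (W : wclass C) k (c d : ob (chain_cat W k)) (t : hom c d) :
  (forall i, is_id (cm t i)) <-> is_id t.
Proof.
split=> [h|[e et] i]; last by subst d; rewrite -et; apply: is_id1.
have cd : (ch c : 'I_k.+1 -> ob C) = ch d.
  by apply: functional_extensionality => i; case: (h i).
case: c d t h cd => c cm1 p1 p2 p3 [d dm1 q1 q2 q3] t h /= cd; subst d.
have et i : cm t i = idm (c i).
  by case: (h i) => e; rewrite (proof_irrelevance _ e erefl).
have em : cm1 = dm1.
  apply: functional_extensionality_dep => i; apply: functional_extensionality_dep => j.
  apply: functional_extensionality_dep => ij.
  by have := cm_nat t ij; rewrite /= !et comp1m compm1.
subst dm1.
case: q1 / (proof_irrelevance _ p1 q1) t h et; case: q2 / (proof_irrelevance _ p2 q2).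
case: q3 / (proof_irrelevance _ p3 q3) => t h et.
by exists erefl; apply: chain_map_eq => i; rewrite et.
Qed.

(** ** Functors on chains *)

Definition preserves (C D : category) (WC : wclass C) (WD : wclass D) (F : functor C D) : Prop :=
  forall x y (f : hom x y), wmap WC f -> wmap WD (fmap F f).

Section ChainFunctor.
Variables (C D : category) (WC : wclass C) (WD : wclass D) (F : functor C D).
Hypothesis hF : preserves WC WD F.

(* The proofs are given as terms, so that [chain_fun] commutes with [chain_res]
   up to conversion. *)
Definition chain_fun_ob k (c : chain WC k) : chain WD k :=
  @Chain D WD k (fun i => F (c i)) (fun i j h => fmap F (chm c h))
    (fun i h => etrans (f_equal (fmap F) (chm1 c h)) (fmap1 F _))
    (fun i j l h1 h2 h3 => etrans (f_equal (fmap F) (chmM c h1 h2 h3)) (fmapM F _ _))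
    (fun i j h => hF (chmW c h)).

Definition chain_fun k : functor (chain_cat WC k) (chain_cat WD k).
Proof.
refine (@Functor (chain_cat WC k) (chain_cat WD k) (@chain_fun_ob k)
  (fun c d t => @ChainMap D WD k (chain_fun_ob c) (chain_fun_ob d)
     (fun i => fmap F (cm t i)) (fun i j h =>
       etrans (esym (fmapM F _ _)) (etrans (f_equal (fmap F) (cm_nat t h)) (fmapM F _ _)))) _ _).
- by move=> c; apply: chain_map_eq => i; apply: fmap1.
- by move=> c d e g f; apply: chain_map_eq => i; apply: fmapM.
Defined.

Lemma chain_fun_weq k (c d : ob (chain_cat WC k)) (t : hom c d) :
  chain_weq t -> chain_weq (fmap (chain_fun k) t).
Proof. by move=> h i; apply: hF. Qed.

End ChainFunctor.

(** ** Interpolation between the ends of a weak equivalence of chains *)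

Section RawInterpolation.
Variable C : category.

(** Connecting maps of an interpolated chain: the booleans tell which of the two chains is used at
    either end, and [g] is the diagonal. Passing back from the second chain to the first is excluded
    by [a ==> b]. *)
Definition ipl (x0 x1 y0 y1 : ob C) (f0 : hom x0 y0) (f1 : hom x1 y1) (g : hom x0 y1)
    (a b : bool) : a ==> b -> hom (if a then x1 else x0) (if b then y1 else y0) :=
  match a, b return a ==> b -> hom (if a then x1 else x0) (if b then y1 else y0) with
  | true, true => fun _ => f1
  | false, false => fun _ => f0
  | false, true => fun _ => g
  | true, false => fun h => match Bool.diff_false_true h with end
  end.

Lemma ipl1 (x0 x1 : ob C) (f0 : hom x0 x0) (f1 : hom x1 x1) (g : hom x0 x1) a (h : a ==> a) :
  f0 = idm x0 -> f1 = idm x1 -> ipl f0 f1 g h = idm _.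
Proof. by case: a h. Qed.

Lemma iplM (x0 x1 y0 y1 z0 z1 : ob C) (f0 : hom x0 y0) (f1 : hom x1 y1)
    (g0 : hom y0 z0) (g1 : hom y1 z1) (h0 : hom x0 z0) (h1 : hom x1 z1)
    (v : hom y0 y1) (w : hom z0 z1) a b c (ab : a ==> b) (bc : b ==> c) (ac : a ==> c) :
  h0 = g0 ∘ f0 -> h1 = g1 ∘ f1 -> w ∘ g0 = g1 ∘ v ->
  ipl h0 h1 (w ∘ h0) ac = ipl g0 g1 (w ∘ g0) bc ∘ ipl f0 f1 (v ∘ f0) ab.
Proof.
by move=> -> -> e; case: a b c ab bc ac => [] [] [] //= _ _ _; rewrite compA // e -compA.
Qed.

Lemma iplW (W : wclass C) (x0 x1 y0 y1 : ob C) (f0 : hom x0 y0) (f1 : hom x1 y1)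
    (g : hom x0 y1) a b (h : a ==> b) :
  wmap W f0 -> wmap W f1 -> wmap W g -> wmap W (ipl f0 f1 g h).
Proof. by case: a b h => [] []. Qed.

Definition ipl_in (x0 x1 : ob C) (w : hom x0 x1) (a : bool) : hom x0 (if a then x1 else x0) :=
  match a with true => w | false => idm x0 end.

Definition ipl_out (x0 x1 : ob C) (w : hom x0 x1) (a : bool) : hom (if a then x1 else x0) x1 :=
  match a with true => idm x1 | false => w end.

Lemma ipl_in_nat (x0 x1 y0 y1 : ob C) (f0 : hom x0 y0) (f1 : hom x1 y1) (v : hom x0 x1)
    (w : hom y0 y1) a b (h : a ==> b) :
  w ∘ f0 = f1 ∘ v -> ipl_in w b ∘ f0 = ipl f0 f1 (w ∘ f0) h ∘ ipl_in v a.
Proof. by case: a b h => [] [] //= _ e; rewrite ?comp1m ?compm1. Qed.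

Lemma ipl_out_nat (x0 x1 y0 y1 : ob C) (f0 : hom x0 y0) (f1 : hom x1 y1) (v : hom x0 x1)
    (w : hom y0 y1) a b (h : a ==> b) :
  w ∘ f0 = f1 ∘ v -> ipl_out w b ∘ ipl f0 f1 (w ∘ f0) h = f1 ∘ ipl_out v a.
Proof. by case: a b h => [] [] //= _ e; rewrite ?comp1m ?compm1. Qed.

Lemma ipl_outK (x0 x1 : ob C) (w : hom x0 x1) a : ipl_out w a ∘ ipl_in w a = w.
Proof. by case: a; rewrite /= ?comp1m ?compm1. Qed.
End RawInterpolation.

Lemma ord2_le (a b : 'I_2) : (a <= b)%N -> (0 < a)%N ==> (0 < b)%N.
Proof. by case: a b => [[|a] ?] [[|b] ?]. Qed.

Section Interpolation.
Variables (C : category) (W : wclass C) (WM : weq_closed W) (k : nat).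
Variables (c d : ob (chain_cat W k)) (w : hom c d) (hw : chain_weq w) (s : mono k 1).

(* equal to c where s is 0 and to d where s is 1 *)
Definition mix : ob (chain_cat W k) :=
  @Chain C W k (fun i => if (0 < s i)%N then ch d i else ch c i)
    (fun i j h => ipl (chm c h) (chm d h) (cm w j ∘ chm c h) (ord2_le (mono_le s h)))
    (fun i h => ipl1 _ _ (chm1 c h) (chm1 d h))
    (fun i j l h1 h2 h3 => iplM _ _ _ (chmM c h1 h2 h3) (chmM d h1 h2 h3) (cm_nat w h2))
    (fun i j h => iplW _ (chmW c h) (chmW d h) (WM (hw j) (chmW c h))).

(** As [s] passes from 0 to 1, the factorization of [w] through [mix] passes from [w] after the
    identity to the identity after [w]. *)
Definition mix_in : hom c mix :=
  @ChainMap C W k c mix (fun i => ipl_in (cm w i) (0 < s i)%N)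
    (fun i j h => ipl_in_nat _ (cm_nat w h)).

Definition mix_out : hom mix d :=
  @ChainMap C W k mix d (fun i => ipl_out (cm w i) (0 < s i)%N)
    (fun i j h => ipl_out_nat _ (cm_nat w h)).

Lemma mix_inW : chain_weq mix_in.
Proof. by move=> i /=; rewrite /ipl_in; case: (0 < s i)%N => //; apply: wmap1. Qed.

Lemma mix_outW : chain_weq mix_out.
Proof. by move=> i /=; rewrite /ipl_out; case: (0 < s i)%N => //; apply: wmap1. Qed.

Lemma mix_outK : mix_out ∘ mix_in = w.
Proof. by apply: chain_map_eq => i; apply: ipl_outK. Qed.
End Interpolation.

Definition zres C (W : wclass C) m n (t : mono m n) (c d : ob (chain_cat W n))
    (a : zzq (@chain_weq C W n) c d) :
    zzq (@chain_weq C W m) (chain_res W t c) (chain_res W t d) :=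
  zmap (@chain_res_weq C W m n t) a.

Lemma zres1 C (W : wclass C) n (c d : ob (chain_cat W n)) (a : zzq (@chain_weq C W n) c d) :
  zres (mono_id n) a = a.
Proof. by rewrite -(zrepK a) /zres zmapE; congr qc; apply: zz_map_res1. Qed.

Lemma zresM C (W : wclass C) m n l (g : mono n l) (f : mono m n) (c d : ob (chain_cat W l))
    (a : zzq (@chain_weq C W l) c d) :
  zres (mono_comp g f) a = zres f (zres g a).
Proof. by rewrite -(zrepK a) /zres !zmapE; congr qc; apply: zz_map_resM. Qed.

(** ** Balanced families *)

Section Balanced.
Variables (C D : category) (WC : wclass C) (WD : wclass D) (F : functor C D).
Hypotheses (hF : preserves WC WD F) (WM : weq_closed WC).
Variables (X0 : ob D) (y0 : ob C) (Z : sset).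
Hypothesis HZ : is_kan Z.
Local Notation ch := (chain_cat WC).
Local Notation VC k := (@chain_weq C WC k).
Local Notation VD k := (@chain_weq D WD k).
Local Notation Fc k := (chain_fun hF k).

(** A word under transformation is cut at a chain [c] into a prefix that already lives in [D] and a
    suffix still in [C]; the cut moves to the right as letters are transformed. *)
Definition pre k (c : ob (ch k)) := zzq (VD k) (chain_const WD k X0) (Fc k c).
Definition suf k (c : ob (ch k)) := zzq (VC k) c (chain_const WC k y0).

Definition pres m n (t : mono m n) (c : ob (ch n)) (u : pre c) : pre (chain_res WC t c) :=
  zres t u.
Definition sres m n (t : mono m n) (c : ob (ch n)) (a : suf c) : suf (chain_res WC t c) :=
  zres t a.

Definition pre_f k (c d : ob (ch k)) (u : pre c) (f : hom c d) : pre d :=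
  u ;; qf (VD k) (fmap (Fc k) f).
Definition pre_b k (c d : ob (ch k)) (u : pre c) (w : hom d c) (hw : chain_weq w) : pre d :=
  u ;; qb (chain_fun_weq hF hw).
Definition suf_f k (c d : ob (ch k)) (f : hom c d) (a : suf d) : suf c := qf (VC k) f ;; a.
Definition suf_b k (c d : ob (ch k)) (w : hom d c) (hw : chain_weq w) (a : suf d) : suf c :=
  qb hw ;; a.
Definition slen k (c : ob (ch k)) (a : suf c) : nat := qlen (chain_closed WM) a.

Lemma pres_f m n (t : mono m n) (c d : ob (ch n)) (u : pre c) (f : hom c d) :
  pres t (pre_f u f) = pre_f (pres t u) (fmap (chain_res WC t) f).
Proof.
by rewrite /pres /zres /pre_f zmap_cat zmap_f.
Qed.

Lemma pres_b m n (t : mono m n) (c d : ob (ch n)) (u : pre c) (w : hom d c) (hw : chain_weq w) :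
  pres t (pre_b u hw) = pre_b (pres t u) (chain_res_weq t hw).
Proof.
rewrite /pres /zres /pre_b zmap_cat zmap_b; congr (_ ;; _).
by apply: qb_eq; apply: chain_map_eq.
Qed.

Lemma sres_f m n (t : mono m n) (c d : ob (ch n)) (f : hom c d) (a : suf d) :
  sres t (suf_f f a) = suf_f (fmap (chain_res WC t) f) (sres t a).
Proof. by rewrite /sres /zres /suf_f zmap_cat zmap_f. Qed.

Lemma sres_b m n (t : mono m n) (c d : ob (ch n)) (w : hom d c) (hw : chain_weq w) (a : suf d) :
  sres t (suf_b hw a) = suf_b (chain_res_weq t hw) (sres t a).
Proof. by rewrite /sres /zres /suf_b zmap_cat zmap_b. Qed.

Lemma pre_fM k (c d e : ob (ch k)) (u : pre c) (f : hom c d) (g : hom d e) :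
  pre_f (pre_f u f) g = pre_f u (g ∘ f).
Proof. by rewrite /pre_f -qcatA qfM -fmapM. Qed.

Lemma suf_fM k (c d e : ob (ch k)) (f : hom c d) (g : hom d e) (a : suf e) :
  suf_f f (suf_f g a) = suf_f (g ∘ f) a.
Proof. exact: qfMA. Qed.

Lemma slen_res m n (t : mono m n) (c : ob (ch n)) (a : suf c) : (slen (sres t a) <= slen a)%N.
Proof. exact: qlen_map. Qed.

Definition family := forall k (c : ob (ch k)), pre c -> suf c -> Z k.

(* Forward arrows may slide between the prefix and the suffix, while nothing is
   required of backward arrows. *)
Record balanced (T : family) : Prop := Balanced {
  bal_act : forall m n (t : mono m n) (c : ob (ch n)) (u : pre c) (a : suf c),
    T m _ (pres t u) (sres t a) = sact t (T n c u a);
  bal_f : forall k (c d : ob (ch k)) (f : hom c d) (u : pre c) (a : suf d),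
    T k d (pre_f u f) a = T k c u (suf_f f a)
}.

Variables T0 T1 : family.
Hypotheses (B0 : balanced T0) (B1 : balanced T1).
Hypothesis T01 : forall k (u : pre (chain_const WC k y0)), T0 u (qid _) = T1 u (qid _).

Definition hfamily := forall k (c : ob (ch k)), pre c -> suf c -> mono k 1 -> Z k.

(* a balanced homotopy from T0 to T1 on the words with at most n backward arrows *)
Record good (n : nat) (H : hfamily) : Prop := Good {
  good_act : forall m k (t : mono m k) (c : ob (ch k)) (u : pre c) (a : suf c) s,
    (slen a <= n)%N -> H m _ (pres t u) (sres t a) (mono_comp s t) = sact t (H k c u a s);
  good_f : forall k (c d : ob (ch k)) (f : hom c d) (u : pre c) (a : suf d) s,
    (slen a <= n)%N -> H k d (pre_f u f) a s = H k c u (suf_f f a) s;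
  good0 : forall k (c : ob (ch k)) (u : pre c) (a : suf c),
    (slen a <= n)%N -> H k c u a (c0 k) = T0 u a;
  good1 : forall k (c : ob (ch k)) (u : pre c) (a : suf c),
    (slen a <= n)%N -> H k c u a (c1 k) = T1 u a
}.

(** * Extending a balanced homotopy to words with one more backward arrow *)

Section Step.
Variables (n : nat) (H : hfamily) (HH : good n H).

(* the words u w^-1 q *)
Record belt (k : nat) := Belt {
  b1 : ob (ch k);
  b2 : ob (ch k);
  bw : hom b1 b2;
  bV : chain_weq bw;
  bq : suf b1;
  bu : pre b2;
  bl : (slen bq <= n)%N
}.

Lemma belt_eq k (c d : ob (ch k)) (w w' : hom c d) (hw : chain_weq w) (hw' : chain_weq w')
    (q q' : suf c) (u u' : pre d) (l : (slen q <= n)%N) (l' : (slen q' <= n)%N) :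
  w = w' -> q = q' -> u = u' -> Belt hw u l = Belt hw' u' l'.
Proof.
move=> ew eq eu; subst w' q' u'; rewrite (proof_irrelevance _ hw hw').
by rewrite (proof_irrelevance _ l l').
Qed.

Definition belts : sset.
Proof.
unshelve refine (@SSet belt (fun m k t b => @Belt m (chain_res WC t (b1 b))
  (chain_res WC t (b2 b)) (fmap (chain_res WC t) (bw b)) (chain_res_weq t (bV b))
  (sres t (bq b)) (pres t (bu b)) _) _ _).
- exact: leq_trans (slen_res _ _) (bl b).
- by move=> k b; apply: (@belt_eq k (b1 b) (b2 b)) => //; [exact: (zres1 (bq b))|exact: (zres1 (bu b))].
- move=> m k l g f b.
  apply: (@belt_eq m (chain_res WC (mono_comp g f) (b1 b)) (chain_res WC (mono_comp g f) (b2 b))).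
  + exact: chain_map_eq.
  + exact: (zresM g f (bq b)).
  + exact: (zresM g f (bu b)).
Defined.

Definition btail k (b : belts k) : suf (b2 b) := suf_b (bV b) (bq b).

(** The old belts: the tail has at most [n] backward arrows after reduction, so [H] already
    prescribes the value. *)
Definition bold k (b : belts k) : Prop := (slen (btail b) <= n)%N.

(* Splitting w as mix_out after mix_in and moving mix_out to the prefix deforms
   each belt to one whose backward arrow is an identity, hence to a shorter word. *)
Definition shift : smap (sprod belts D1) belts.
Proof.
unshelve refine (@SMap (sprod belts D1) belts (fun k x =>
  @Belt k (b1 x.1) (mix WM (bV x.1) x.2) (mix_in WM (bV x.1) x.2)
    (mix_inW WM (bV x.1) x.2) (bq x.1)
    (pre_b (bu x.1) (mix_outW WM (bV x.1) x.2)) (bl x.1)) _).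
move=> m k t [b s]; apply: (@belt_eq m (chain_res WC t (b1 b)) (chain_res WC t (mix WM (bV b) s))) => //.
by rewrite pres_b; congr (_ ;; _); apply: qb_eq; apply: chain_map_eq.
Defined.

Lemma belt_shift k (c e d : ob (ch k)) (w : hom c d) (hw : chain_weq w) (v : hom c e)
    (hv : chain_weq v) (v' : hom e d) (hv' : chain_weq v') (q : suf c) (u : pre d)
    (l : (slen q <= n)%N) :
  is_id v' -> v' ∘ v = w -> Belt hv (pre_b u hv') l = Belt hw u l.
Proof.
case=> e0 ev; subst d; subst v' => vw; apply: belt_eq => //; first exact: etrans (esym (comp1m v)) vw.
rewrite /pre_b -[RHS]qcat1r -(@qb1 _ (VD k) (Fc k e) (fun i => wmap1 WD _)); congr (_ ;; _).
by apply: qb_eq; apply: chain_map_eq => i /=; apply: fmap1.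
Qed.

Lemma shift1 k (b : belts k) : shift k (b, c1 k) = b.
Proof. by apply: belt_shift; [apply/chain_is_id => i; apply: is_id1|apply: mix_outK]. Qed.

(** If [bq b] has fewer than [n] backward arrows, any arrow may be prepended. If it has exactly [n],
    being old means that [w] does not lengthen it, and [mix_in] is an identity whenever [w] is. *)
Lemma bold_shift k (b : belts k) s : bold b -> bold (shift k (b, s)).
Proof.
rewrite /bold /btail /suf_b /slen /= => h.
have := bl b; rewrite leq_eqVlt => /orP[/eqP e|lt]; last exact: leq_trans (qlen_b _ _ _) lt.
rewrite -e in h *; apply: qlen_b_stable h => hid; apply/chain_is_id => i /=.
by rewrite /ipl_in; case: (0 < s i)%N; [apply: (proj2 (chain_is_id _) hid)|apply: is_id1].
Qed.

Lemma bold_shift0 k (b : belts k) : bold (shift k (b, c0 k)).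
Proof.
rewrite /bold /btail /suf_b /slen /=; apply: leq_trans (bl b).
have h1 : is_id (idm (b1 b)) by apply: is_id1.
have hid : chain_weq (idm (b1 b)) by move=> i; apply: wmap1.
apply: (qlen_b_stable (hw := hid)).
  by move=> _; apply/chain_is_id => i; apply: is_id1.
by rewrite qb1 qcat1.
Qed.

Lemma bold_sub : sub_sset bold.
Proof.
move=> m k t b h; apply: leq_trans h; rewrite -[X in (X <= _)%N]/(slen (suf_b _ _)).
by rewrite -sres_b slen_res.
Qed.

(** Where the value of the new homotopy is forced: by [H] on old belts, and by [T0] and [T1] at the
    two ends. *)
Definition bpart k (x : sprod belts D1 k) : Prop :=
  bold x.1 \/ (x.2 = c0 k \/ x.2 = c1 k).

Lemma bpart_sub : sub_sset bpart.
Proof.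
move=> m k t [b s] [h|[/= ->|/= ->]]; [left; exact: bold_sub|right; left|right; right];
exact: mono_eq.
Qed.

Lemma c01 k : c0 k <> c1 k.
Proof. by move/(f_equal (fun u : mono k 1 => u ord0 : nat)). Qed.

Definition bval k (x : sprod belts D1 k) : Z k :=
  if emi (bold x.1) then H (bu x.1) (btail x.1) x.2
  else if emi (x.2 = c0 k) then T0 (bu x.1) (btail x.1) else T1 (bu x.1) (btail x.1).

Lemma bval0 k (b : belts k) : bval (b, c0 k) = T0 (bu b) (btail b).
Proof.
rewrite /bval /=; case: (emi (bold b)) => [h|nb] /=; first by rewrite (good0 HH).
by case: (emi (c0 k = c0 k)) => [e|[]].
Qed.

Lemma bval1 k (b : belts k) : bval (b, c1 k) = T1 (bu b) (btail b).
Proof.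
rewrite /bval /=; case: (emi (bold b)) => [h|nb] /=; first by rewrite (good1 HH).
by case: (emi (c1 k = c0 k)) => [e|ne] //; case: (c01 (esym e)).
Qed.

Lemma btail_act m k (t : mono m k) (b : belts k) : btail (sact t b) = sres t (btail b).
Proof. by rewrite /btail sres_b. Qed.

Lemma bval_act m k (t : mono m k) (x : sprod belts D1 k) :
  bpart x -> bval (sact t x) = sact t (bval x).
Proof.
case: x => b s [/= h|[/= ->|/= ->]].
- rewrite /bval /=; case: (emi (bold (sact t b))) => [h'|[]] /=; last exact: bold_sub.
  case: (emi (bold b)) => [h''|[]] //=; rewrite btail_act; exact: (good_act HH).
- have e : mono_comp (c0 k) t = c0 m by apply: mono_eq.
  rewrite -[LHS]/(bval (sact t b, mono_comp (c0 k) t)) e.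
  by rewrite !bval0 btail_act; apply: (bal_act B0).
- have e : mono_comp (c1 k) t = c1 m by apply: mono_eq.
  rewrite -[LHS]/(bval (sact t b, mono_comp (c1 k) t)) e.
  by rewrite !bval1 btail_act; apply: (bal_act B1).
Qed.

Lemma belt_extend :
  exists g : smap (sprod belts D1) Z, forall k (x : sprod belts D1 k), bpart x -> g k x = bval x.
Proof.
pose f := @PMap (sprod belts D1) Z bpart (fun k x _ => bval x)
  (fun m l t x h _ => bval_act t h).
(* Two interval coordinates occur: [x.2] is the time of [shift], while [x.1.2] is the time of the
   homotopy from [T0] to [T1] and stays fixed, so that the two ends are preserved. *)
unshelve epose (K := @SMap (sprod (sprod belts D1) D1) (sprod belts D1)
  (fun k x => (shift k (x.1.1, x.2), x.1.2)) _).
  move=> m k t [[b s] r].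
  exact: (f_equal (fun z : belts m => (z, mono_comp s t)) (sfun_act shift t (b, r))).
have [|||g hg] := @deformation_extend (sprod belts D1) Z bpart K f HZ bpart_sub.
- by move=> k [b s]; rewrite /K /= -[X in (X, _)]/(shift k (b, c1 k)) shift1.
- by move=> k [b s]; left; apply: bold_shift0.
- by move=> k [b s] t [h|h]; [left; apply: bold_shift|right].
by exists g => k x h; rewrite (hg _ _ h).
Qed.

Lemma good_step : exists H' : hfamily, good n.+1 H' /\
  forall k (c : ob (ch k)) (u : pre c) (a : suf c) s, (slen a <= n)%N -> H' k c u a s = H u a s.
Proof.
have [g hg] := belt_extend.
(* Past the first test, the values [H u a s] are defaults. They are met only on words with more than
   [n.+1] backward arrows, of which [good n.+1] says nothing. *)
pose H' : hfamily := fun k c u a s =>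
  match emi (slen a <= n)%N with
  | left _ => H u a s
  | right _ =>
    match decomp (chain_closed WM) a with
    | None => H u a s
    | Some d => match emi (slen (c := wd2 d) (wdq d) <= n)%N with
        | left l => g k (Belt (wdV d) (pre_f u (wdf d)) l, s)
        | right _ => H u a s
        end
    end
  end.
have HO k (c : ob (ch k)) (u : pre c) (a : suf c) s : (slen a <= n)%N -> H' k c u a s = H u a s.
  by rewrite /H'; case: emi.
(* The formula holds for every presentation, reduced or not: if the tail is old, [g] agrees with [H]
   and [good_f] moves [f] across; otherwise the presentation is the one found by [decomp]. *)
have HB k (c d e : ob (ch k)) (f : hom c d) (w : hom e d) (hw : chain_weq w) (q : suf e)
    (l : (slen q <= n)%N) (u : pre c) s :
    H' k c u (suf_f f (suf_b hw q)) s = g k (Belt hw (pre_f u f) l, s).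
  have lenE : slen (suf_f f (suf_b hw q)) = slen (suf_b hw q) by apply: qlen_f.
  case: (leqP (slen (suf_b hw q)) n) => h.
    rewrite HO ?lenE // hg; last by left.
    rewrite /bval /=; case: (emi (bold (Belt hw (pre_f u f) l))) => [h'|[]] //=.
    by rewrite -(good_f HH).
  have len_b : slen (suf_b hw q) = (slen q).+1.
    apply/eqP; rewrite eqn_leq qlen_b; exact: leq_ltn_trans l h.
  rewrite /H'; case: (emi (slen (suf_f f (suf_b hw q)) <= n)%N) => [h'|nh].
    by exfalso; rewrite lenE leqNgt h in h'.
  have := @decomp_word _ _ (chain_closed WM) _ _ (Word f hw q) len_b.
  rewrite -[X in decomp _ X]/(suf_f f (suf_b hw q)) => -> /=.
  case: (emi (slen q <= n)%N) => [l'|[]] //.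
  by rewrite (proof_irrelevance _ l l').
have HP k (c : ob (ch k)) (a : suf c) : (slen a <= n.+1)%N -> (slen a <= n)%N \/
    exists (d e : ob (ch k)) (f : hom c d) (w : hom e d) (hw : chain_weq w) (q : suf e),
      a = suf_f f (suf_b hw q) /\ (slen q <= n)%N.
  rewrite leq_eqVlt => /orP[/eqP h|]; last by left.
  have [d [_ e l]] := decompP h; right.
  by exists (wd1 d), (wd2 d), (wdf d), (wdw d), (wdV d), (wdq d); rewrite /slen l.
exists H'; split; last exact: HO; split.
- move=> m k t c u a s /HP [h|[d [e [f [w [hw [q [-> l]]]]]]]].
    by rewrite !HO ?(good_act HH) //; apply: leq_trans (slen_res _ _) h.
  have l' : (slen (sres t q) <= n)%N by apply: leq_trans (slen_res _ _) l.
  rewrite sres_f sres_b (HB _ _ _ _ _ _ _ _ l') (HB _ _ _ _ _ _ _ _ l) -sfun_act.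
  congr (g m (_, _)); apply: (@belt_eq m (chain_res WC t e) (chain_res WC t d)) => //.
  by rewrite pres_f.
- move=> k c d f u a s /HP [h|[d' [e [f' [w [hw [q [-> l]]]]]]]].
    rewrite !HO //; first exact: (good_f HH).
    by rewrite /slen qlen_f.
  by rewrite suf_fM !(HB _ _ _ _ _ _ _ _ l) pre_fM.
- move=> k c u a /HP [h|[d [e [f [w [hw [q [-> l]]]]]]]]; first by rewrite HO // (good0 HH).
  rewrite (HB _ _ _ _ _ _ _ _ l) hg; last by right; left.
  by rewrite bval0 /btail /= (bal_f B0).
- move=> k c u a /HP [h|[d [e [f [w [hw [q [-> l]]]]]]]]; first by rewrite HO // (good1 HH).
  rewrite (HB _ _ _ _ _ _ _ _ l) hg; last by right; right.
  by rewrite bval1 /btail /= (bal_f B1).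
Qed.
End Step.

Lemma T01_len0 k (c : ob (ch k)) (u : pre c) (a : suf c) : slen a = 0 -> T0 u a = T1 u a.
Proof.
move/qlen0 => [f ->]; rewrite -[qf _ _]qcat1r -[qcat _ _]/(suf_f f (qid _)).
by rewrite -(bal_f B0) -(bal_f B1) T01.
Qed.

Lemma balanced_homotopy : exists H : hfamily, [/\
  forall m k (t : mono m k) (c : ob (ch k)) (u : pre c) (a : suf c) s,
    H m _ (pres t u) (sres t a) (mono_comp s t) = sact t (H k c u a s),
  forall k (c : ob (ch k)) (u : pre c) (a : suf c), H k c u a (c0 k) = T0 u a &
  forall k (c : ob (ch k)) (u : pre c) (a : suf c), H k c u a (c1 k) = T1 u a].
Proof.
have g0 : good 0 (fun k c u a s => T0 u a).
  split=> [m k t c u a s _|k c d f u a s _|//|k c u a]; rewrite ?(bal_act B0) ?(bal_f B0) //.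
  by rewrite leqn0 => /eqP /T01_len0.
pose G := fix G n : {H | good n H} :=
  if n is n'.+1 then
    let: exist H h := G n' in
    let: exist H' h' := cid (good_step h) in exist _ H' (proj1 h')
  else exist _ _ g0.
have FE n n' k (c : ob (ch k)) (u : pre c) (a : suf c) s : (slen a <= n <= n')%N ->
    sval (G n') k c u a s = sval (G n) k c u a s.
  elim: n' => [|n' IH]; first by case: n => //= n; rewrite andbF.
  case/andP => an; rewrite leq_eqVlt => /orP[/eqP -> //|nn'].
  rewrite -IH ?an //=; case: (G n') => H h /=; case: cid => H' [h' e] /=; apply: e.
  exact: leq_trans an nn'.
(* Each word is evaluated at the stage given by its own length. Restriction may lower the length,
   but by [FE] the stages agree there. *)
exists (fun k c u a s => sval (G (slen a)) k c u a s); split=> [m k t c u a s|k c u a|k c u a].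
- rewrite -(good_act (svalP (G (slen a)))) //.
  by symmetry; apply: FE; rewrite leqnn slen_res.
- exact: (good0 (svalP (G (slen a)))).
- exact: (good1 (svalP (G (slen a)))).
Qed.
End Balanced.

(** ** Maps between mapping spaces *)

Lemma is_id_square (X : category) (V : mclass X) (a b a' b' : ob X) (f : hom a a')
    (g : hom b b') (hf : V _ _ f) (hg : V _ _ g) (i : hom a b) (i' : hom a' b') :
  is_id i -> is_id i' -> i' ∘ f = g ∘ i -> qb hf ;; qf V i = qf V i' ;; qb hg.
Proof.
case=> e ei [e' ei']; subst b b'; subst i i' => /=; rewrite comp1m compm1 => fg.
by rewrite !qf1 qcat1 qcat1r; apply: qb_eq.
Qed.

Lemma is_id_loop (X : category) (V : mclass X) (a b : ob X) (f : hom a b) (hf : V _ _ f) :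
  is_id f -> qf V f ;; qb hf = qid a /\ qb hf ;; qf V f = qid b.
Proof. by case=> e ef; subst b; subst f; rewrite qf1 qb1 qcat1. Qed.

(** When the components are identities, naturality passes backward arrows strictly. This compares
    functors on chains that agree on objects and maps without being convertible. *)
Lemma zmap_nat (X Y : category) (F G : functor X Y) (V : mclass X) (W : mclass Y)
    (hF : forall x y (f : hom x y), V x y f -> W _ _ (fmap F f))
    (hG : forall x y (f : hom x y), V x y f -> W _ _ (fmap G f))
    (i : forall x, hom (F x) (G x)) (x y : ob X) (a : zzq V x y) :
  (forall x, is_id (i x)) ->
  (forall x y (f : hom x y), i y ∘ fmap F f = fmap G f ∘ i x) ->
  zmap hF a ;; qf W (i y) = qf W (i x) ;; zmap hG a.
Proof.
move=> ii nat; elim/zzq_ind: a => [z|x' y' z f a IH|x' y' z w hw a IH].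
- by rewrite !zmap1 qcat1 qcat1r.
- by rewrite !zmap_cat !zmap_f -qcatA IH !qcatA !qfM nat.
- rewrite !zmap_cat !zmap_b -qcatA IH !qcatA; congr (_ ;; _).
  exact: is_id_square.
Qed.

Lemma smap_compE X Y Z (g : smap Y Z) (f : smap X Y) n (x : X n) :
  (g \os f) n x = g n (f n x).
Proof. by []. Qed.

Section MapSpaces.
Variables (C : category) (W : wclass C).
Local Notation map := (map_space W).

Lemma map_actE x y m n (t : mono m n) (a : map x y n) : sact t a = zres t a.
Proof.
have [p ->] := qc_surj (a : zzq (@chain_weq C W n) _ _).
rewrite /zres zmapE; exact: quot_mapE.
Qed.

Lemma map_postE x y z (f : hom y z) n (a : map x y n) :
  map_post W x f n a = a ;; qf _ (fmap (chain_const W n) f).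
Proof.
have [p ->] := qc_surj (a : zzq (@chain_weq C W n) _ _).
rewrite qcatE; exact: quot_mapE.
Qed.

Definition map_pre x x' y (f : hom x x') : smap (map x' y) (map x y).
Proof.
refine (@SMap (map x' y) (map x y) (fun n a => qf _ (fmap (chain_const W n) f) ;; a) _).
by move=> m n t a; rewrite !map_actE /zres zmap_cat zmap_f.
Defined.

Lemma map_preE x x' y (f : hom x x') n (a : map x' y n) :
  map_pre y f n a = qf _ (fmap (chain_const W n) f) ;; a.
Proof. by []. Qed.

Lemma map_postM x y z t (g : hom z t) (f : hom y z) :
  map_post W x g \os map_post W x f = map_post W x (g ∘ f).
Proof. by apply: smap_eq => n a; rewrite !smap_compE !map_postE -qcatA qfM -fmapM. Qed.

Lemma map_preM x y z t (g : hom y z) (f : hom x y) :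
  map_pre t f \os map_pre t g = map_pre t (g ∘ f).
Proof. by apply: smap_eq => n a; rewrite !smap_compE !map_preE qfMA -fmapM. Qed.

Lemma map_pre_post x y z t (f : hom x y) (g : hom z t) :
  map_pre t f \os map_post W y g = map_post W x g \os map_pre z f.
Proof. by apply: smap_eq => n a; rewrite !smap_compE !map_postE !map_preE qcatA. Qed.

Hypothesis WM : weq_closed W.

Definition const_weq n x y (w : hom x y) (hw : wmap W w) :
    chain_weq (fmap (chain_const W n) w) :=
  fun i => hw.

Lemma mix_in0 k (c d : ob (chain_cat W k)) (w : hom c d) (hw : chain_weq w) :
  is_id (mix_in WM hw (c0 k)).
Proof. by apply/chain_is_id => i; apply: is_id1. Qed.

Lemma mix_out1 k (c d : ob (chain_cat W k)) (w : hom c d) (hw : chain_weq w) :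
  is_id (mix_out WM hw (c1 k)).
Proof. by apply/chain_is_id => i; apply: is_id1. Qed.

Lemma mix_loop_in1 k (c d : ob (chain_cat W k)) (w : hom c d) (hw : chain_weq w) :
  qf _ (mix_in WM hw (c1 k)) ;; qb (mix_inW WM hw (c1 k)) = qf _ w ;; qb hw.
Proof.
have [e ev] := mix_out1 hw; have := mix_outK WM hw (c1 k); rewrite -ev.
move: (mix_in _ _ _) (mix_inW _ _ _); move: (mix _ _ _) e {ev} => m e; subst d => v h.
rewrite comp1m => ew; subst w; congr (_ ;; _); exact: qb_eq.
Qed.

Lemma mix_loop_out0 k (c d : ob (chain_cat W k)) (w : hom c d) (hw : chain_weq w) :
  qb (mix_outW WM hw (c0 k)) ;; qf _ (mix_out WM hw (c0 k)) = qb hw ;; qf _ w.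
Proof.
have [e ev] := mix_in0 hw; have := mix_outK WM hw (c0 k); rewrite -ev.
move: (mix_out _ _ _) (mix_outW _ _ _); move: (mix _ _ _) e {ev} => m e; subst m => v h.
rewrite compm1 => ew; subst w; congr (_ ;; _); exact: qb_eq.
Qed.

(* the null homotopic loops w w^-1 and w^-1 w *)
Section Loops.
Variables (x : ob C) (l : forall k, mono k 1 ->
  zzq (@chain_weq C W k) (chain_const W k x) (chain_const W k x)).
Hypothesis lact : forall m k (t : mono m k) s, zres t (l s) = l (mono_comp s t).

Lemma loop_post y : exists H : smap (sprod (map y x) D1) (map y x),
  forall k (a : map y x k) s, H k (a, s) = a ;; l s.
Proof.
unshelve eexists (@SMap (sprod (map y x) D1) (map y x) (fun k a => a.1 ;; l a.2) _); last by [].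
move=> m k t [a s]; rewrite [RHS]map_actE /zres zmap_cat -[zmap _ (l s)]/(zres t (l s)) lact.
by congr (_ ;; _); apply: map_actE.
Qed.

Lemma loop_pre y : exists H : smap (sprod (map x y) D1) (map x y),
  forall k (a : map x y k) s, H k (a, s) = l s ;; a.
Proof.
unshelve eexists (@SMap (sprod (map x y) D1) (map x y) (fun k a => l a.2 ;; a.1) _); last by [].
move=> m k t [a s]; rewrite [RHS]map_actE /zres zmap_cat -[zmap _ (l s)]/(zres t (l s)) lact.
by congr (_ ;; _); apply: map_actE.
Qed.
End Loops.

Section Invertible.
Variables (x y : ob C) (w : hom x y) (hw : wmap W w).

Definition cw k : hom (chain_const W k x) (chain_const W k y) := fmap (chain_const W k) w.
Definition cwW k : chain_weq (cw k) := @const_weq k x y w hw.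

(** Trivial at [s] = 0 and equal to [w] followed by its formal inverse at [s] = 1. For [loop_y] the
    ends are exchanged: the trivial word is at 1. These are the two homotopies showing that the
    formal inverse inverts [w] on mapping spaces. *)
Definition loop_x k (s : mono k 1) : zzq (@chain_weq C W k) (chain_const W k x) (chain_const W k x) :=
  qf _ (mix_in WM (@cwW k) s) ;; qb (mix_inW WM (@cwW k) s).
Definition loop_y k (s : mono k 1) : zzq (@chain_weq C W k) (chain_const W k y) (chain_const W k y) :=
  qb (mix_outW WM (@cwW k) s) ;; qf _ (mix_out WM (@cwW k) s).

Lemma loop_x_act m k (t : mono m k) s : zres t (loop_x s) = loop_x (mono_comp s t).
Proof.
rewrite /zres zmap_cat zmap_f zmap_b.
refine (f_equal (qcat (qf _ (mix_in WM (@cwW m) (mono_comp s t)))) _).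
by apply: qb_eq; apply: chain_map_eq.
Qed.

Lemma loop_y_act m k (t : mono m k) s : zres t (loop_y s) = loop_y (mono_comp s t).
Proof.
rewrite /zres zmap_cat zmap_f zmap_b.
refine (f_equal (fun r => qcat r (qf _ (mix_out WM (@cwW m) (mono_comp s t)))) _).
by apply: qb_eq; apply: chain_map_eq.
Qed.

Lemma loop_x0 k : loop_x (c0 k) = qid _.
Proof. by case: (is_id_loop (mix_inW WM (@cwW k) (c0 k)) (mix_in0 (@cwW k))). Qed.

Lemma loop_y1 k : loop_y (c1 k) = qid _.
Proof. by case: (is_id_loop (mix_outW WM (@cwW k) (c1 k)) (mix_out1 (@cwW k))). Qed.

Lemma map_post_weq z : sset_weq (map_post W z w).
Proof.
unshelve epose (g := @SMap (map z y) (map z x) (fun k a => a ;; qb (@cwW k)) _).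
  by move=> m k t a; rewrite !map_actE /zres zmap_cat zmap_b.
have [H HE] := loop_post loop_x_act z; have [K KE] := loop_post loop_y_act z.
apply: (@weq_inverse _ _ _ g).
- apply/heq_sym/elem_heq; exists H => k a; rewrite !HE loop_x0 qcat1r; split=> //.
  by rewrite /loop_x mix_loop_in1 smap_compE map_postE /= -qcatA.
- apply/elem_heq; exists K => k a; rewrite !KE loop_y1 qcat1r; split=> //.
  by rewrite /loop_y mix_loop_out0 smap_compE map_postE /= -qcatA.
Qed.

Lemma map_pre_weq z : sset_weq (map_pre z w).
Proof.
unshelve epose (g := @SMap (map x z) (map y z) (fun k a => qb (@cwW k) ;; a) _).
  by move=> m k t a; rewrite !map_actE /zres zmap_cat zmap_b.
have [H HE] := loop_pre loop_x_act z; have [K KE] := loop_pre loop_y_act z.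
apply: (@weq_inverse _ _ _ g).
- apply/elem_heq; exists K => k a; rewrite !KE loop_y1 qcat1; split=> //.
  by rewrite /loop_y mix_loop_out0 smap_compE map_preE /= -qcatA.
- apply/heq_sym/elem_heq; exists H => k a; rewrite !HE loop_x0 qcat1; split=> //.
  by rewrite /loop_x mix_loop_in1 smap_compE map_preE /= -qcatA.
Qed.
End Invertible.
End MapSpaces.

(** ** Functors on mapping spaces *)

Section FunctorMap.
Variables (C D : category) (WC : wclass C) (WD : wclass D) (F : functor C D).
Hypothesis hF : preserves WC WD F.

(** The image of a constant chain has connecting maps [fmap F (idm x)], equal but not convertible to
    [idm (F x)]; a comparison with identity components replaces a transport. *)
Definition fconst_in k x : hom (chain_const WD k (F x)) (chain_fun hF k (chain_const WC k x)) :=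
  @ChainMap D WD k (chain_const WD k (F x)) (chain_fun hF k (chain_const WC k x))
    (fun=> idm (F x))
    (fun _ _ _ => f_equal (fun f => f ∘ idm (F x)) (esym (fmap1 F x))).

Definition fconst_out k x : hom (chain_fun hF k (chain_const WC k x)) (chain_const WD k (F x)) :=
  @ChainMap D WD k (chain_fun hF k (chain_const WC k x)) (chain_const WD k (F x))
    (fun=> idm (F x))
    (fun _ _ _ => f_equal (fun f => idm (F x) ∘ f) (fmap1 F x)).

Definition zfun k c d (a : zzq (@chain_weq C WC k) c d) :
    zzq (@chain_weq D WD k) (chain_fun hF k c) (chain_fun hF k d) :=
  zmap (fun x y f => @chain_fun_weq _ _ _ _ _ hF k x y f) a.

Lemma zfun_res m n (t : mono m n) (c d : ob (chain_cat WC n)) (a : zzq (@chain_weq C WC n) c d) :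
  zres t (zfun a) = zfun (zres t a).
Proof.
rewrite -(zrepK a) /zfun /zres !zmapE; congr qc.
elim: (zrep a) => //= [x y z f p ->|x y z w hw p ->] //.
by congr zz_bwd; apply: proof_irrelevance.
Qed.

Lemma zfun_cat k c d e (a : zzq (@chain_weq C WC k) c d) (b : zzq (@chain_weq C WC k) d e) :
  zfun (a ;; b) = zfun a ;; zfun b.
Proof. exact: zmap_cat. Qed.

Lemma zfun_f k c d (f : hom c d) :
  zfun (qf (@chain_weq C WC k) f) = qf _ (fmap (chain_fun hF k) f).
Proof. exact: zmap_f. Qed.

Definition map_fun x y : smap (map_space WC x y) (map_space WD (F x) (F y)).
Proof.
refine (@SMap (map_space WC x y) (map_space WD (F x) (F y))
  (fun n a => qf _ (fconst_in n x) ;; zfun a ;; qf _ (fconst_out n y)) _).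
move=> m n t a; rewrite [RHS]map_actE [sact t a]map_actE /zres !zmap_cat !zmap_f.
by rewrite -[zmap _ (zfun a)]/(zres t (zfun a)) zfun_res.
Defined.

Lemma map_funE x y n (a : map_space WC x y n) :
  map_fun x y n a = qf _ (fconst_in n x) ;; zfun a ;; qf _ (fconst_out n y).
Proof. by []. Qed.

Lemma map_fun_post x y z (f : hom y z) :
  map_fun x z \os map_post WC x f = map_post WD (F x) (fmap F f) \os map_fun x y.
Proof.
apply: smap_eq => n a; rewrite !smap_compE !map_postE !map_funE zfun_cat zfun_f.
rewrite -!qcatA !qfM; do 2!congr (_ ;; _); congr qf.
by apply: chain_map_eq => i /=; rewrite comp1m compm1.
Qed.

Lemma map_fun_pre x y z (f : hom x y) :
  map_fun x z \os map_pre WC z f = map_pre WD (F z) (fmap F f) \os map_fun y z.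
Proof.
apply: smap_eq => n a; rewrite !smap_compE !map_preE !map_funE zfun_cat zfun_f.
rewrite -!qcatA !qfMA; congr (_ ;; _); congr qf.
by apply: chain_map_eq => i /=; rewrite comp1m compm1.
Qed.
End FunctorMap.

Section FunctorComp.
Variables (C D E : category) (WC : wclass C) (WD : wclass D) (WE : wclass E).
Variables (G : functor D E) (F : functor C D).
Hypotheses (hG : preserves WD WE G) (hF : preserves WC WD F).

Definition fcomp : functor C E.
Proof.
refine (@Functor C E (fun x => G (F x)) (fun x y f => fmap G (fmap F f)) _ _).
- by move=> x; rewrite !fmap1.
- by move=> x y z g f; rewrite !fmapM.
Defined.

Lemma preserves_comp : preserves WC WE fcomp.
Proof. by move=> x y f /hF /hG. Qed.
End FunctorComp.

Lemma map_fun_comp (C D E : category) (WC : wclass C) (WD : wclass D) (WE : wclass E)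
    (G : functor D E) (F : functor C D) (hG : preserves WD WE G) (hF : preserves WC WD F)
    (h : preserves WC WE (fcomp G F)) x y :
  map_fun h x y = map_fun hG (F x) (F y) \os map_fun hF x y.
Proof.
apply: smap_eq => n a; rewrite smap_compE !map_funE !zfun_cat !zfun_f -!qcatA.
unshelve epose (i := (fun c => @ChainMap E WE n (chain_fun h n c)
    (chain_fun hG n (chain_fun hF n c)) (fun j => idm (G (F (ch c j)))) _)
  : forall c : ob (chain_cat WC n),
      @hom (chain_cat WE n) (chain_fun h n c) (chain_fun hG n (chain_fun hF n c))).
  by move=> j l jl /=; rewrite comp1m compm1.
have nat := @zmap_nat (chain_cat WC n) (chain_cat WE n) (chain_fun h n)
  (fcomp (chain_fun hG n) (chain_fun hF n)) (@chain_weq C WC n) (@chain_weq E WE n)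
  (fun x y f => @chain_fun_weq _ _ _ _ _ h n x y f)
  (fun x y f hf => chain_fun_weq hG (chain_fun_weq hF hf)) i _ _ a.
have {}nat : zfun h a ;; qf _ (i _) = qf _ (i _) ;; zfun hG (zfun hF a).
  rewrite /zfun nat; last 2 first.
  - by move=> c; apply/chain_is_id => j; apply: is_id1.
  - by move=> c d f; apply: chain_map_eq => j /=; rewrite comp1m compm1.
  congr (_ ;; _); rewrite -(zrepK a) !zmapE; congr qc; clear.
  elim: (zrep a) => //= [x' y' z' f p ->|x' y' z' w hw p ->] //.
have -> : fconst_out h n y = fconst_out hG n (F y) ∘ fmap (chain_fun hG n) (fconst_out hF n y) ∘ i _.
  by apply: chain_map_eq => j /=; rewrite fmap1 !comp1m.
rewrite -[in LHS]qfM [zfun h a ;; _]qcatA nat -!qcatA !qfMA qfM.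
congr (_ ;; _); congr qf.
by apply: chain_map_eq => j /=; rewrite fmap1 !comp1m.
Qed.

Definition fid (C : category) : functor C C :=
  @Functor C C (fun x => x) (fun x y f => f) (fun _ => erefl) (fun _ _ _ _ _ => erefl).

Lemma preserves_id (C : category) (W : wclass C) : preserves W W (fid C).
Proof. by []. Qed.

Lemma map_fun_id (C : category) (W : wclass C) (h : preserves W W (fid C)) x y :
  map_fun h x y = smap_id _.
Proof.
apply: smap_eq => n a; rewrite map_funE.
unshelve epose (i := (fun c => @ChainMap C W n (chain_fun h n c) c (fun j => idm (ch c j)) _)
  : forall c : ob (chain_cat W n), @hom (chain_cat W n) (chain_fun h n c) c).
  by move=> j l jl /=; rewrite comp1m compm1.
have nat := @zmap_nat (chain_cat W n) (chain_cat W n) (chain_fun h n)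
  (fid _) (@chain_weq C W n) (@chain_weq C W n)
  (fun x y f => @chain_fun_weq _ _ _ _ _ h n x y f)
  (fun x y f hf => hf) i _ _ a.
have {}nat : zfun h a ;; qf _ (i _) = qf _ (i _) ;; a.
  rewrite /zfun nat; last 2 first.
  - by move=> c; apply/chain_is_id => j; apply: is_id1.
  - by move=> c d f; apply: chain_map_eq => j /=; rewrite comp1m compm1.
  congr (_ ;; _); rewrite -[RHS](zrepK a) -{1}(zrepK a) zmapE; congr qc; clear.
  by elim: (zrep a) => //= [x' y' z' f p ->|x' y' z' w hw p ->].
have -> : fconst_out h n y = i _ by apply: chain_map_eq.
rewrite nat qfMA (_ : _ ∘ _ = idm _) ?qf1 ?qcat1 //.
by apply: chain_map_eq => j /=; rewrite comp1m.
Qed.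

(** ** Homotopy naturality *)

(* A natural transformation commutes strictly with the forward arrows of a
   hammock but only up to homotopy with the backward ones. *)
Theorem map_fun_nat (C D : category) (WC : wclass C) (WD : wclass D) (F G : functor C D)
    (hF : preserves WC WD F) (hG : preserves WC WD G) (al : nat_trans F G) x y :
  weq_closed WC ->
  heq (map_post WD (F x) (al y) \os map_fun hF x y)
      (map_pre WD (G y) (al x) \os map_fun hG x y).
Proof.
move=> WM Z HZ g; apply: rst_step.
unshelve epose (alc := (fun k c =>
    @ChainMap D WD k (chain_fun hF k c) (chain_fun hG k c) (fun j => al (ch c j)) _)
  : forall k (c : ob (chain_cat WC k)),
      @hom (chain_cat WD k) (chain_fun hF k c) (chain_fun hG k c)).
  by move=> i j ij /=; rewrite nt_nat.
have alc_nat k (c d : ob (chain_cat WC k)) (f : hom c d) :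
    alc k d ∘ fmap (chain_fun hF k) f = fmap (chain_fun hG k) f ∘ alc k c.
  by apply: chain_map_eq => i; apply: nt_nat.
pose ca z k := fmap (chain_const WD k) (al z).
(* [T0] transforms the suffix by [F] and applies [al] at the very end, whereas [T1] applies [al] at
   the cut and transforms the suffix by [G]. With the cut at the start these are the two maps to be
   compared. *)
pose T0 : family hF (F x) y Z := fun k c u a =>
  g k ((u ;; zfun hF a ;; qf _ (ca y k ∘ fconst_out hF k y)) :
         map_space WD (F x) (G y) k).
pose T1 : family hF (F x) y Z := fun k c u a =>
  g k ((u ;; qf _ (alc k c) ;; zfun hG a ;; qf _ (fconst_out hG k y)) :
         map_space WD (F x) (G y) k).
have B0 : balanced T0.
  split=> [m n t c u a|k c d f u a]; rewrite /T0.
    rewrite -sfun_act map_actE /zres !zmap_cat zmap_f -[zmap _ (zfun hF a)]/(zres t _) zfun_res.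
    by [].
  by rewrite /pre_f /suf_f zfun_cat zfun_f -!qcatA.
have B1 : balanced T1.
  split=> [m n t c u a|k c d f u a]; rewrite /T1.
    rewrite -sfun_act map_actE /zres !zmap_cat !zmap_f -[zmap _ (zfun hG a)]/(zres t _) zfun_res.
    by [].
  by rewrite /pre_f /suf_f zfun_cat zfun_f -!qcatA !qfMA alc_nat.
(* For an empty suffix the cut is the end of the word. *)
have T01 k (u : pre hF (F x) (chain_const WC k y)) : T0 k _ u (qid _) = T1 k _ u (qid _).
  rewrite /T0 /T1 /zfun !zmap1 !qcat1 qfM; congr (g k (_ ;; qf _ _)).
  by apply: chain_map_eq => i /=; rewrite comp1m compm1.
have [H [Hact H0 H1]] := balanced_homotopy WM HZ B0 B1 T01.
unshelve eexists (@SMap (sprod (map_space WC x y) D1) Z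
  (fun k v => H k (chain_const WC k x) (qf _ (fconst_in hF k x)) v.1 v.2) _).
  move=> m k t [a s]; rewrite -Hact /pres /sres /zres zmap_f.
  by rewrite -[X in H _ _ _ X _ = _]/(sact t a) map_actE.
move=> k a; rewrite !smap_compE map_postE map_preE !map_funE /=; split.
- by rewrite H0 /T0; congr (g k _); rewrite -!qcatA qfM.
- rewrite H1 /T1; congr (g k _); rewrite !qfMA; congr (qf _ _ ;; _).
  by apply: chain_map_eq => i /=; rewrite comp1m compm1.
Qed.

(** * Model categories *)

Lemma is_weq1 (C : category) (W : wclass C) x : wmap W (idm x).
Proof. exact: wmap1. Qed.

Lemma two_of_three_closed (C : category) (W : wclass C) :
  two_of_three (@wmap C W) -> weq_closed W.
Proof. by move=> h x y z g f wg wf; case: (h _ _ _ g f) => /(_ wf wg). Qed.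

Lemma weq_right (C : category) (W : wclass C) x y z (g : hom y z) (f : hom x y) (h : hom x z) :
  two_of_three (@wmap C W) -> g ∘ f = h -> wmap W f -> wmap W h -> wmap W g.
Proof. by move=> W3 <- wf; case: (W3 _ _ _ g f) => _ + _; apply. Qed.

Lemma weq_left (C : category) (W : wclass C) x y z (g : hom y z) (f : hom x y) (h : hom x z) :
  two_of_three (@wmap C W) -> g ∘ f = h -> wmap W g -> wmap W h -> wmap W f.
Proof. by move=> W3 <- wf; case: (W3 _ _ _ g f) => _ _; apply. Qed.

Lemma initial_eq (C : category) (o x : ob C) (f g : hom o x) : is_initial o -> f = g.
Proof. by move=> io; have [h [_ hu]] := io x; rewrite -(hu f) // -(hu g). Qed.

Lemma terminal_eq (C : category) (o x : ob C) (f g : hom x o) : is_terminal o -> f = g.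
Proof. by move=> io; have [h [_ hu]] := io x; rewrite -(hu f) // -(hu g). Qed.

(** ** Small shapes *)

Definition discrete (T : small) : category :=
  @Category T (fun a b => a = b) (fun a => erefl) (fun a b c g f => etrans f g)
    (fun _ _ _ => proof_irrelevance _ _ _) (fun _ _ _ => proof_irrelevance _ _ _)
    (fun _ _ _ _ _ _ _ => proof_irrelevance _ _ _).

Lemma discrete_small T : is_small (discrete T).
Proof. by exists T, id => j; exists j. Qed.

Definition discrete_diagram (C : category) (T : small) (x : T -> ob C) : functor (discrete T) C.
Proof.
refine (@Functor (discrete T) C x
  (fun a b e => eq_rect a (fun c => hom (x a) (x c)) (idm (x a)) b e) _ _) => //.
by move=> a b c g f; destruct g, f; rewrite /= comp1m.
Defined.

Lemma has_initial (C : category) : cocomplete C -> exists o : ob C, is_initial o.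
Proof.
move=> cc; have [o [l [_ lu]]] := cc _ (@discrete_diagram C Empty_set
  (fun e => match e with end)) (discrete_small _).
exists o => x; have [|h [_ hu]] := lu x (fun e => match e with end); first by case.
by exists h; split=> // h' _; apply: hu; case.
Qed.

Lemma has_terminal (C : category) : complete C -> exists o : ob C, is_terminal o.
Proof.
move=> cc; have [o [l [_ lu]]] := cc _ (@discrete_diagram C Empty_set
  (fun e => match e with end)) (discrete_small _).
exists o => x; have [|h [_ hu]] := lu x (fun e => match e with end); first by case.
by exists h; split=> // h' _; apply: hu; case.
Qed.

Definition is_coproduct (C : category) (x y s : ob C) (i : hom x s) (j : hom y s) : Prop :=
  forall z (f : hom x z) (g : hom y z), exists! h : hom s z, h ∘ i = f /\ h ∘ j = g.

Definition is_product (C : category) (x y s : ob C) (i : hom s x) (j : hom s y) : Prop :=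
  forall z (f : hom z x) (g : hom z y), exists! h : hom z s, i ∘ h = f /\ j ∘ h = g.

Lemma has_coproduct (C : category) (x y : ob C) : cocomplete C ->
  exists s (i : hom x s) (j : hom y s), is_coproduct i j.
Proof.
move=> cc; have [s [l [_ lu]]] := cc _ (@discrete_diagram C bool
  (fun b => if b then x else y)) (discrete_small _).
exists s, (l true), (l false) => z f g.
have [|h [hm hu]] := lu z (fun b => match b with true => f | false => g end).
  by move=> a b e; destruct e => /=; rewrite compm1.
exists h; split; first by split; [apply: (hm true)|apply: (hm false)].
by move=> h' [e1 e2]; apply: hu => -[].
Qed.

Lemma has_product (C : category) (x y : ob C) : complete C ->
  exists s (i : hom s x) (j : hom s y), is_product i j.
Proof.
move=> cc; have [s [l [_ lu]]] := cc _ (@discrete_diagram C bool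
  (fun b => if b then x else y)) (discrete_small _).
exists s, (l true), (l false) => z f g.
have [|h [hm hu]] := lu z (fun b => match b with true => f | false => g end).
  by move=> a b e; destruct e => /=; rewrite comp1m.
exists h; split; first by split; [apply: (hm true)|apply: (hm false)].
by move=> h' [e1 e2]; apply: hu => -[].
Qed.

Section Span.
Variables (C : category) (a b c : ob C) (f : hom a b) (g : hom a c).

Definition span_hom (i j : option bool) : small :=
  match i, j with
  | None, _ => unit
  | Some i, Some j => i = j
  | Some _, None => Empty_set
  end.

Lemma span_hom_eq i j (s t : span_hom i j) : s = t.
Proof.
by case: i j s t => [i|] [j|] //= [] //= s; [apply: proof_irrelevance|case: s|case: s].
Qed.

Definition span : category.
Proof.
refine (@Category (option bool) span_hom
  (fun i => match i with None => tt | Some b => erefl end)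
  (fun i j k => match i, j, k with
    | None, _, _ => fun _ _ => tt
    | Some _, Some _, Some _ => fun q p => etrans p q
    | Some _, None, _ => fun _ p => match p with end
    | Some _, Some _, None => fun q _ => match q with end
    end) _ _ _) => *; exact: span_hom_eq.
Defined.

Definition span_ob (i : option bool) : ob C :=
  match i with None => a | Some true => b | Some false => c end.

Definition span_map (i j : option bool) : span_hom i j -> hom (span_ob i) (span_ob j) :=
  match i, j return span_hom i j -> hom (span_ob i) (span_ob j) with
  | None, None => fun _ => idm a
  | None, Some true => fun _ => f
  | None, Some false => fun _ => g
  | Some i, Some j => fun e =>
      eq_rect i (fun k => hom (span_ob (Some i)) (span_ob (Some k))) (idm _) j e
  | Some _, None => fun p => match p with end
  end.

Definition span_diagram : functor span C.
Proof.
refine (@Functor span C span_ob span_map _ _); first by case.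
case=> [[]|] [[]|] [[]|] //= q p; rewrite ?(proof_irrelevance _ p erefl)
  ?(proof_irrelevance _ q erefl) /= ?(proof_irrelevance _ (etrans _ _) erefl) /= ?comp1m ?compm1 //.
Defined.
End Span.

Lemma has_pushout (C : category) (a b c : ob C) (f : hom a b) (g : hom a c) : cocomplete C ->
  exists d (p : hom b d) (q : hom c d), is_pushout f g p q.
Proof.
have sm : is_small span by exists (option bool), id => j; exists j.
move=> cc; have [d [l [lc lu]]] := cc _ (span_diagram f g) sm.
have lf := lc None (Some true) tt; have lg := lc None (Some false) tt.
exists d, (l (Some true)), (l (Some false)); split.
  by move: lf lg => /= -> ->.
move=> y p q e.
have [|h [hm hu]] := lu y (fun i => match i with
    | None => p ∘ f | Some true => p | Some false => q end).
  by case=> [[]|] [[]|] //= u; rewrite ?(proof_irrelevance _ u erefl) /= ?compm1.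
exists h; split; first by split; [apply: (hm (Some true))|apply: (hm (Some false))].
move=> h' [e1 e2]; apply: hu => -[[]|] //.
by rewrite -lf /= compA e1.
Qed.

(** ** Lifting properties *)

Lemma lifts_comp (C : category) (a b c x y : ob C) (i : hom a b) (j : hom b c) (p : hom x y) :
  lifts i p -> lifts j p -> lifts (j ∘ i) p.
Proof.
move=> li lj u v e; have [h [h1 h2]] := li u (v ∘ j) ltac:(by rewrite -compA).
by have [k [k1 k2]] := lj h v h2; exists k; rewrite compA k1.
Qed.

Lemma lifts_pushout (C : category) (a b c d x y : ob C) (f : hom a b) (g : hom a c)
    (p : hom b d) (q : hom c d) (r : hom x y) :
  is_pushout f g p q -> lifts f r -> lifts q r.
Proof.
case=> e po lf u v uv.
have [h [h1 h2]] := lf (u ∘ g) (v ∘ p) ltac:(by rewrite compA uv -!compA e).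
have [k [[k1 k2] ku]] := po _ h u h1; exists k; split=> //.
have [m [_ mu]] := po _ (v ∘ p) (v ∘ q) ltac:(by rewrite -!compA e).
by rewrite -(mu v) // -(mu (r ∘ k)) // -!compA k1 k2.
Qed.

Lemma lifts_adj (C D : category) (L : functor C D) (R : functor D C) (ad : adjunction L R)
    (a b : ob C) (x y : ob D) (i : hom a b) (p : hom x y) :
  lifts (fmap L i) p <-> lifts i (fmap R p).
Proof.
split=> H u v e.
  have [|h [h1 h2]] := H (adj_inv ad u) (adj_inv ad v).
    by rewrite -[LHS](adjK ad) -[RHS](adjK ad) adj_natl adj_natr !adj_invK e.
  by exists (adj ad h); rewrite -adj_natl -adj_natr h1 h2 !adj_invK.
have [|h [h1 h2]] := H (adj ad u) (adj ad v); first by rewrite -adj_natl -adj_natr e.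
exists (adj_inv ad h); split.
  by rewrite -[LHS](adjK ad) adj_natl adj_invK h1 adjK.
by rewrite -[LHS](adjK ad) adj_natr adj_invK h2 adjK.
Qed.

Section ModelCategory.
Variables (C : category) (M : premodel C).
Hypothesis HM : is_model_category M.

Let MS : is_model_structure M. Proof. by case: HM. Qed.
Let W3 : two_of_three (@wmap C (weq M)). Proof. exact: ms_2of3 MS. Qed.

Lemma model_closed : weq_closed (weq M).
Proof. exact: two_of_three_closed. Qed.

Lemma cof_llp (a b : ob C) (i : hom a b) : (cof M i <-> llp (tfib M) i).
Proof.
split=> [ci x y p tp|li]; first exact: (ms_lift_tfib MS ci tp).
have [ff] := ms_fac_tfib MS.
have [h [h1 h2]] := li _ _ _ (ff_rQ ff i) (ff_l ff i) (idm b)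
  ltac:(by rewrite comp1m ff_fac).
apply: (ms_cof_retract MS) (ff_lP ff i).
exists (idm a), (idm a), h, (ff_r ff i).
by rewrite comp1m compm1 h1 h2 compm1 ff_fac.
Qed.

Lemma tcof_llp (a b : ob C) (i : hom a b) : (tcof M i <-> llp (@fib C M) i).
Proof.
split=> [ci x y p tp|li]; first exact: (ms_lift_tcof MS ci tp).
have [ff] := ms_fac_tcof MS.
have [h [h1 h2]] := li _ _ _ (ff_rQ ff i) (ff_l ff i) (idm b)
  ltac:(by rewrite comp1m ff_fac).
have re : is_retract i (ff_l ff i).
  exists (idm a), (idm a), h, (ff_r ff i).
  by rewrite comp1m compm1 h1 h2 compm1 ff_fac.
have [c w] := ff_lP ff i.
by split; [apply: (ms_cof_retract MS) re c|apply: (ms_weq_retract MS) re w].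
Qed.

Lemma fib_rlp (x y : ob C) (p : hom x y) : (fib M p <-> rlp (tcof M) p).
Proof.
split=> [fp a b i ti|lp]; first exact: (ms_lift_tcof MS ti fp).
have [ff] := ms_fac_tcof MS.
have [h [h1 h2]] := lp _ _ _ (ff_lP ff p) (idm x) (ff_r ff p)
  ltac:(by rewrite compm1 ff_fac).
apply: (ms_fib_retract MS) (ff_rQ ff p).
exists (ff_l ff p), h, (idm y), (idm y).
by rewrite !comp1m h1 h2 ff_fac.
Qed.

Lemma tfib_rlp (x y : ob C) (p : hom x y) : (tfib M p <-> rlp (@cof C M) p).
Proof.
split=> [fp a b i ti|lp]; first exact: (ms_lift_tfib MS ti fp).
have [ff] := ms_fac_tfib MS.
have [h [h1 h2]] := lp _ _ _ (ff_lP ff p) (idm x) (ff_r ff p)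
  ltac:(by rewrite compm1 ff_fac).
have re : is_retract p (ff_r ff p).
  exists (ff_l ff p), h, (idm y), (idm y).
  by rewrite !comp1m h1 h2 ff_fac.
have [c w] := ff_rQ ff p.
by split; [apply: (ms_fib_retract MS) re c|apply: (ms_weq_retract MS) re w].
Qed.

Lemma cof_comp (x y z : ob C) (j : hom y z) (i : hom x y) : cof M i -> cof M j -> cof M (j ∘ i).
Proof.
by move=> /cof_llp hi /cof_llp hj; apply/cof_llp => e b p tp; apply: lifts_comp; auto.
Qed.

Lemma fib_comp (x y z : ob C) (q : hom y z) (p : hom x y) : fib M p -> fib M q -> fib M (q ∘ p).
Proof.
move=> /fib_rlp hp /fib_rlp hq; apply/fib_rlp => a b i ti u v e.
have [h [h1 h2]] := hq _ _ _ ti (p ∘ u) v ltac:(by rewrite compA).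
have [k [k1 k2]] := hp _ _ _ ti u h (esym h1).
by exists k; rewrite k1 -compA k2 h2.
Qed.

Lemma cofibrantP (x : ob C) : cofibrant M x <->
  forall e b (p : hom e b) (v : hom x b), tfib M p -> exists h : hom x e, p ∘ h = v.
Proof.
have [_ cc _] := HM; have [o io] := has_initial cc; split=> [cx e b p v tp|H o' f io'].
  have [f _] := io x; have [u _] := io e.
  have /cof_llp cf := cx o f io.
  have [h [_ ph]] := cf _ _ _ tp u v (initial_eq _ _ io).
  by exists h.
apply/cof_llp => e b p tp u v uv; have [h ph] := H _ _ p v tp.
by exists h; split=> //; apply: initial_eq io'.
Qed.

Lemma fibrantP (x : ob C) : fibrant M x <->
  forall a b (i : hom a b) (u : hom a x), tcof M i -> exists h : hom b x, h ∘ i = u.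
Proof.
have [cc _ _] := HM; have [o io] := has_terminal cc; split=> [cx e b p v tp|H o' f io'].
  have [f _] := io x; have [u _] := io b.
  have /fib_rlp cf := cx o f io.
  have [h [ph _]] := cf _ _ _ tp v u (terminal_eq _ _ io).
  by exists h.
apply/fib_rlp => e b p tp u v uv; have [h ph] := H _ _ p u tp.
by exists h; split=> //; apply: terminal_eq io'.
Qed.

(** ** Ken Brown's lemma *)

Section KenBrown.
Variables (D : category) (V : wclass D) (F : functor C D).
Hypothesis V3 : two_of_three (@wmap D V).

Lemma ken_brown : (forall x y (i : hom x y), tcof M i -> wmap V (fmap F i)) ->
  forall x y (f : hom x y), cofibrant M x -> cofibrant M y -> is_weq M f -> wmap V (fmap F f).
Proof.
move=> FT x y f /cofibrantP cx /cofibrantP cy wf.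
have [_ cc _] := HM; have [s [i [j co]]] := has_coproduct x y cc.
have [ff] := ms_fac_tfib MS.
have [h [[hi hj] _]] := co _ f (idm y).
set c := ff_l ff h; set p := ff_r ff h.
have [tp wp] : tfib M p := ff_rQ ff h; have cc' : cof M c := ff_lP ff h.
have pc : p ∘ c = h := ff_fac ff h.
have ci : cof M i.
  apply/cof_llp => e b q tq u v uv; have [k qk] := cy _ _ q (v ∘ j) tq.
  have [m [[mi mj] _]] := co _ u k; exists m; split=> //.
  have [n [_ nu]] := co _ (q ∘ u) (q ∘ k).
  by rewrite -(nu (q ∘ m)) ?(nu v) // -!compA mi mj.
have cj : cof M j.
  apply/cof_llp => e b q tq u v uv; have [k qk] := cx _ _ q (v ∘ i) tq.
  have [m [[mi mj] _]] := co _ k u; exists m; split=> //.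
  have [n [_ nu]] := co _ (q ∘ k) (q ∘ u).
  by rewrite -(nu (q ∘ m)) ?(nu v) // -!compA mi mj.
have wci : is_weq M (c ∘ i).
  by apply: (@weq_left _ _ _ _ _ p _ f W3) => //; rewrite compA pc.
have wcj : is_weq M (c ∘ j).
  apply: (@weq_left _ _ _ _ _ p _ (idm y) W3) => //; last exact: is_weq1.
  by rewrite compA pc.
have Fi : wmap V (fmap F (c ∘ i)) by apply: FT; split=> //; apply: cof_comp.
have Fj : wmap V (fmap F (c ∘ j)) by apply: FT; split=> //; apply: cof_comp.
have Fp : wmap V (fmap F p).
  apply: (@weq_right _ _ _ _ _ _ (fmap F (c ∘ j)) (idm _) V3) => //; last exact: is_weq1.
  by rewrite -fmapM compA pc hj fmap1.
have -> : f = p ∘ (c ∘ i) by rewrite compA pc hi.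
by rewrite fmapM; apply: two_of_three_closed.
Qed.

Lemma ken_brown_dual : (forall x y (i : hom x y), tfib M i -> wmap V (fmap F i)) ->
  forall x y (f : hom x y), fibrant M x -> fibrant M y -> is_weq M f -> wmap V (fmap F f).
Proof.
move=> FT x y f /fibrantP cx /fibrantP cy wf.
have [cc _ _] := HM; have [s [i [j co]]] := has_product x y cc.
have [ff] := ms_fac_tcof MS.
have [h [[hi hj] _]] := co _ (idm x) f.
set c := ff_l ff h; set p := ff_r ff h.
have [cc' wc] : tcof M c := ff_lP ff h; have fp : fib M p := ff_rQ ff h.
have pc : p ∘ c = h := ff_fac ff h.
have ci : fib M i.
  apply/fib_rlp => a b q tq u v uv; have [k qk] := cy _ _ q (j ∘ u) tq.
  have [m [[mi mj] _]] := co _ v k; exists m; split=> //.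
  have [n [_ nu]] := co _ (v ∘ q) (k ∘ q).
  by rewrite -(nu (m ∘ q)) ?(nu u) // !compA mi mj.
have cj : fib M j.
  apply/fib_rlp => a b q tq u v uv; have [k qk] := cx _ _ q (i ∘ u) tq.
  have [m [[mi mj] _]] := co _ k v; exists m; split=> //.
  have [n [_ nu]] := co _ (k ∘ q) (v ∘ q).
  by rewrite -(nu (m ∘ q)) ?(nu u) // !compA mi mj.
have wci : is_weq M (i ∘ p).
  apply: (@weq_right _ _ _ _ _ _ c (idm x) W3) => //; last exact: is_weq1.
  by rewrite -compA pc.
have wcj : is_weq M (j ∘ p).
  by apply: (@weq_right _ _ _ _ _ _ c f W3) => //; rewrite -compA pc.
have Fi : wmap V (fmap F (i ∘ p)) by apply: FT; split=> //; apply: fib_comp.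
have Fj : wmap V (fmap F (j ∘ p)) by apply: FT; split=> //; apply: fib_comp.
have Fp : wmap V (fmap F c).
  apply: (@weq_left _ _ _ _ _ (fmap F (i ∘ p)) _ (idm _) V3) => //; last exact: is_weq1.
  by rewrite -fmapM -compA pc hi fmap1.
have -> : f = (j ∘ p) ∘ c by rewrite -compA pc hj.
by rewrite fmapM; apply: two_of_three_closed.
Qed.
End KenBrown.

(** ** Functorial replacements *)

Lemma cofibrant_replacement : exists (Q : functor C C) (q : nat_trans Q (fid C)),
  [/\ forall x, cofibrant M (Q x), forall x, tfib M (q x) & preserves (weq M) (weq M) Q].
Proof.
have [_ cc _] := HM; have [o io] := has_initial cc; have [ff] := ms_fac_tfib MS.
pose i x : hom o x := sval (cid (io x)).
have e x y (f : hom x y) : i y ∘ idm o = f ∘ i x by apply: initial_eq io.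
unshelve epose (Q := @Functor C C (fun x => ff_ob ff (i x)) (fun x y f => ff_map ff (e x y f)) _ _).
- by move=> x; apply: ff_map1.
(* [ff_map] depends on the proof of its square, and composing squares yields the top edge
   [idm o ∘ idm o]; once this is rewritten to [idm o], proof irrelevance applies. *)
- move=> x y z g f; have h : i z ∘ (idm o ∘ idm o) = (g ∘ f) ∘ i x by apply: initial_eq io.
  rewrite -(ff_mapM ff (e _ _ f) (e _ _ g) h); move: h; rewrite comp1m => h.
  by rewrite (proof_irrelevance _ (e x z (g ∘ f)) h).
unshelve epose (q := @NatTrans C C Q (fid C) (fun x => ff_r ff (i x)) _).
  by move=> x y f; apply: ff_map_r.
have tq x : tfib M (q x) by apply: (ff_rQ ff (i x)).
exists Q, q; split=> // [x|x y f wf].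
- apply/cofibrantP => e' b p v tp.
  have /cof_llp cf : cof M (ff_l ff (i x)) := ff_lP ff (i x).
  have [u _] := io e'.
  by have [h [_ ph]] := cf _ _ _ tp u v (initial_eq _ _ io); exists h.
- have [_ w1] := tq x; have [_ w2] := tq y.
  apply: (@weq_left _ _ _ _ _ (q y) _ (f ∘ q x) W3) => //.
    exact: (nt_nat q f).
  exact: model_closed.
Qed.

Lemma fibrant_replacement : exists (R : functor C C) (r : nat_trans (fid C) R),
  [/\ forall x, fibrant M (R x), forall x, tcof M (r x) & preserves (weq M) (weq M) R].
Proof.
have [cc _ _] := HM; have [o io] := has_terminal cc; have [ff] := ms_fac_tcof MS.
pose i x : hom x o := sval (cid (io x)).
have e x y (f : hom x y) : i y ∘ f = idm o ∘ i x by apply: terminal_eq io.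
unshelve epose (R := @Functor C C (fun x => ff_ob ff (i x)) (fun x y f => ff_map ff (e x y f)) _ _).
- by move=> x; apply: ff_map1.
- move=> x y z g f; have h : i z ∘ (g ∘ f) = (idm o ∘ idm o) ∘ i x by apply: terminal_eq io.
  rewrite -(ff_mapM ff (e _ _ f) (e _ _ g) h); move: h; rewrite comp1m => h.
  by rewrite (proof_irrelevance _ (e x z (g ∘ f)) h).
unshelve epose (r := @NatTrans C C (fid C) R (fun x => ff_l ff (i x)) _).
  by move=> x y f; symmetry; apply: ff_map_l.
have tq x : tcof M (r x) by apply: (ff_lP ff (i x)).
exists R, r; split=> // [x|x y f wf].
- apply/fibrantP => a b j u tj.
  have /fib_rlp cf : fib M (ff_r ff (i x)) := ff_rQ ff (i x).
  have [v _] := io b.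
  by have [h [ph _]] := cf _ _ _ tj u v (terminal_eq _ _ io); exists h.
- have [_ w1] := tq x; have [_ w2] := tq y.
  apply: (@weq_right _ _ _ _ _ _ (r x) (r y ∘ f) W3) => //.
    by rewrite (nt_nat r f).
  exact: model_closed.
Qed.
End ModelCategory.

(** * Modules *)

Lemma right_adjoint (C D : category) (L : functor C D) :
  (forall y : ob D, exists (h : ob C) (e : hom (L h) y),
     forall x (f : hom (L x) y), exists! g : hom x h, e ∘ fmap L g = f) ->
  exists R : functor D C, inhabited (adjunction L R).
Proof.
move=> H.
pose r y := sval (cid (H y)); pose e y : hom (L (r y)) y := sval (cid (svalP (cid (H y)))).
have U y x (f : hom (L x) y) : exists! g : hom x (r y), e y ∘ fmap L g = f.
  exact: (svalP (cid (svalP (cid (H y))))).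
clearbody e; move: r e U => r e U.
have ue y x (g g' : hom x (r y)) : e y ∘ fmap L g = e y ∘ fmap L g' -> g = g'.
  by move=> gg; have [h [_ hu]] := U y x (e y ∘ fmap L g'); rewrite -(hu g) // -(hu g').
pose ad y x (f : hom (L x) y) := sval (cid (U y x f)).
have adE y x (f : hom (L x) y) : e y ∘ fmap L (ad y x f) = f.
  by case: (svalP (cid (U y x f))).
unshelve epose (R := @Functor D C r (fun y z v => ad z (r y) (v ∘ e y)) _ _).
- by move=> y; apply: (ue); rewrite adE comp1m fmap1 compm1.
- by move=> x y z g f; apply: (ue); rewrite fmapM compA !adE -[RHS]compA adE compA.
exists R; constructor.
refine (@Adjunction C D L R (fun x y => ad y x) (fun x y g => e y ∘ fmap L g) _ _ _ _).
- by move=> x y f; apply: adE.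
- by move=> x y f; apply: (ue); rewrite adE.
- by move=> x x' y u f; apply: (ue); rewrite fmapM compA !adE.
- by move=> x y y' v f; apply: (ue); rewrite fmapM compA !adE -[RHS]compA adE.
Qed.

(** * Free and coinduced modules as adjoints of the forgetful functor *)

Section FreeModules.
Variables (C : category) (T : sym_monoidal C) (A : monoid T).
Local Notation "f ⊗ g" := (tensm T f g) (at level 35).

Lemma associ_nat x x' y y' z z' (f : @hom C x x') (g : hom y y') (h : hom z z') :
  associ T x' y' z' ∘ (f ⊗ (g ⊗ h)) = ((f ⊗ g) ⊗ h) ∘ associ T x y z.
Proof.
by apply: (epi_iso (assoc_iso T x y z)); rewrite -!compA assocK compm1 -assoc_nat compA assocK comp1m.
Qed.

Lemma free_act_nat x y (f : @hom C x y) :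
  (idm A ⊗ f) ∘ free_act A x = free_act A y ∘ (idm A ⊗ (idm A ⊗ f)).
Proof. by rewrite /free_act -[RHS]compA associ_nat !compA -!tensM tens1 !comp1m !compm1. Qed.

Lemma free_act_unit x : free_act A x ∘ (idm A ⊗ (mone A ⊗ idm x)) = idm A ⊗ lunit T x.
Proof.
rewrite /free_act -compA associ_nat compA -tensM mmulm1 comp1m -triangle.
by rewrite -compA associK compm1.
Qed.

Lemma mact_free (X : module A) : mact X ∘ free_act A X = mact X ∘ (idm A ⊗ mact X).
Proof. by rewrite /free_act compA mactA -compA associK compm1. Qed.

Lemma free_act_free x :
  free_act A x ∘ free_act A (tens T A x) = free_act A x ∘ (idm A ⊗ free_act A x).
Proof. exact: (mact_free (free_module A x)). Qed.

Lemma free_act_assoc x : free_act A x ∘ assoc T A A x = mmul A ⊗ idm x.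
Proof. by rewrite /free_act -compA assocK compm1. Qed.

Definition lunit_inv x : hom x (tens T (munit T) x) := sval (cid (lunit_iso T x)).

Lemma lunitK x : lunit_inv x ∘ lunit T x = idm _.
Proof. by case: (svalP (cid (lunit_iso T x))). Qed.

Lemma lunit_invK x : lunit T x ∘ lunit_inv x = idm _.
Proof. by case: (svalP (cid (lunit_iso T x))). Qed.

Lemma lunit_inv_nat x y (f : @hom C x y) : lunit_inv y ∘ f = (idm _ ⊗ f) ∘ lunit_inv x.
Proof.
apply: (epi_iso (lunit_iso T x)); rewrite -[RHS]compA lunitK compm1 -compA -lunit_nat compA.
by rewrite lunitK comp1m.
Qed.

Definition free : functor C (Mod A).
Proof.
refine (@Functor C (Mod A) (free_module A)
  (fun x y f => @ModuleMap C T A (free_module A x) (free_module A y) (idm A ⊗ f)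
     (free_act_nat f)) _ _).
- by move=> x; apply: module_map_eq; apply: tens1.
- by move=> x y z g f; apply: module_map_eq; apply: tens_compl.
Defined.

Definition free_unit x : hom x (tens T A x) := (mone A ⊗ idm x) ∘ lunit_inv x.

Definition free_ext x (Y : module A) (f : hom x Y) : @hom (Mod A) (free x) Y.
Proof.
refine (@ModuleMap C T A (free_module A x) Y (mact Y ∘ (idm A ⊗ f)) _).
by rewrite -compA free_act_nat compA mact_free -compA -tens_compl.
Defined.

Lemma mact_unit (Y : module A) : mact Y ∘ free_unit Y = idm (Y : ob C).
Proof. by rewrite /free_unit compA mact1 lunit_invK. Qed.

Lemma free_unit_nat x y (f : @hom C x y) : free_unit y ∘ f = (idm A ⊗ f) ∘ free_unit x.
Proof. by rewrite /free_unit -compA lunit_inv_nat !compA -!tensM !comp1m !compm1. Qed.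

Definition free_adj : adjunction free (forget A).
Proof.
refine (@Adjunction C (Mod A) free (forget A) (fun x Y g => modm g ∘ free_unit x)
  (fun x Y f => free_ext f) _ _ _ _).
- move=> x Y g; apply: module_map_eq => /=.
  rewrite tens_compl compA -(modm_act g) -compA -[RHS]compm1; congr (_ ∘ _).
  by rewrite /= /free_unit tens_compl compA free_act_unit -tens_compl lunit_invK tens1.
- by move=> x Y f /=; rewrite -compA -free_unit_nat compA mact_unit comp1m.
- by move=> x x' Y u f; rewrite /= -[LHS]compA -[RHS]compA free_unit_nat.
- by move=> x Y Y' v f /=; rewrite compA.
Defined.

(** ** Coinduced modules *)

Section Coinduction.
Variables (y h : ob C) (ev : hom (tens T A h) y).
Hypothesis evU : forall x (f : hom (tens T A x) y), exists! g : hom x h, ev ∘ (idm A ⊗ g) = f.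

Lemma coind_eq x (g g' : hom x h) : ev ∘ (idm A ⊗ g) = ev ∘ (idm A ⊗ g') -> g = g'.
Proof.
by move=> e; have [k [_ ku]] := evU (ev ∘ (idm A ⊗ g')); rewrite -(ku g) // -(ku g').
Qed.

(* With h = Hom(A, y), the action is (b, phi) |-> (c |-> phi (c b)). *)
Lemma coind_module : exists act : hom (tens T A h) h,
  [/\ ev ∘ (idm A ⊗ act) = ev ∘ free_act A h,
      act ∘ (mmul A ⊗ idm h) = act ∘ (idm A ⊗ act) ∘ assoc T A A h &
      act ∘ (mone A ⊗ idm h) = lunit T h].
Proof.
have [act [actE _]] := evU (ev ∘ free_act A h); exists act; split=> //.
  apply: coind_eq; rewrite !tens_compl !compA actE -(compA ev _ (idm A ⊗ (idm A ⊗ act))).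
  rewrite -free_act_nat (compA ev (idm A ⊗ act)) actE -(compA ev _ (free_act A _)) free_act_free.
  by rewrite -[LHS]compA -[RHS]compA -(compA (free_act A h)) -tens_compl free_act_assoc.
apply: coind_eq; rewrite tens_compl compA actE -compA free_act_unit.
by [].
Qed.

Variables (act : hom (tens T A h) h).
Hypothesis actE : ev ∘ (idm A ⊗ act) = ev ∘ free_act A h.

(** [ev ∘ free_unit h] is evaluation at the unit of [A], and evaluating the action of b on phi there
    gives phi (1 b) = phi b. *)
Lemma coind_counit : ev ∘ free_unit h ∘ act = ev.
Proof.
rewrite -compA free_unit_nat compA actE -compA.
by rewrite (mact_unit (free_module A h)) compm1.
Qed.

(** The transpose sends x to the function a |-> f (a x). *)
Lemma coind_transpose (X : module A) (f : @hom C X y) : exists g : @hom C X h,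
  g ∘ mact X = act ∘ (idm A ⊗ g) /\ ev ∘ free_unit h ∘ g = f.
Proof.
have [g [gE _]] := evU (f ∘ mact X); exists g; split.
  apply: coind_eq; rewrite !tens_compl !compA gE actE -compA -mact_free compA -gE.
  by rewrite -[LHS]compA -[RHS]compA free_act_nat.
by rewrite -compA free_unit_nat compA gE -compA mact_unit compm1.
Qed.

Lemma coind_transpose_eq (X : module A) (g : @hom C X h) :
  g ∘ mact X = act ∘ (idm A ⊗ g) ->
  ev ∘ (idm A ⊗ g) = ev ∘ free_unit h ∘ g ∘ mact X.
Proof. by move=> gX; rewrite -[RHS]compA gX compA coind_counit. Qed.
End Coinduction.

Hypothesis TC : is_closed T.

Lemma forget_right_adjoint : exists H : functor C (Mod A), inhabited (adjunction (forget A) H).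
Proof.
apply: right_adjoint => y; have [h [ev0 evU0]] := TC A y.
(* Closedness provides an adjoint for tensoring on the right, modules have [A] on the left. *)
pose ev := ev0 ∘ braid T A h.
have evU x (f : hom (tens T A x) y) : exists! g : hom x h, ev ∘ (idm A ⊗ g) = f.
  have [g [gE gu]] := evU0 x (f ∘ braid T x A); exists g; split.
    by rewrite /ev -compA braid_nat compA gE -compA braidK compm1.
  by move=> g' g'E; apply: gu; rewrite -g'E /ev -(compA ev0) braid_nat -!compA braidK compm1.
have [act [actE actA act1]] := coind_module evU.
exists (Module actA act1), (ev ∘ free_unit h) => X f /=.
have [g [gX gE]] := coind_transpose evU actE f.
exists (@ModuleMap C T A X (Module actA act1) g gX); split=> // k kE.
apply: module_map_eq; apply: (coind_eq evU) => /=.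
by rewrite (coind_transpose_eq actE gX) (coind_transpose_eq actE (modm_act k)) gE kE.
Qed.
End FreeModules.

(** * Tensor products that preserve cofibrations and trivial cofibrations *)

Section TensorQuillen.
Variables (C : category) (T : sym_monoidal C) (M : premodel C).
Hypothesis HM : is_sym_monoidal_model T M.
Local Notation "f ⊗ g" := (tensm T f g) (at level 35).

Let MC : is_model_category M. Proof. by case: HM. Qed.
Let TC : is_closed T. Proof. by case: HM. Qed.
Let PP : pushout_product_axiom T M. Proof. by case: HM. Qed.

Lemma initial_tens (o y : ob C) : is_initial o -> is_initial (tens T o y).
Proof.
move=> io z; have [h [ev evU]] := TC y z; have [g _] := io h.
exists (ev ∘ (g ⊗ idm y)); split=> // f _; have [k [<- _]] := evU _ f.
by rewrite (initial_eq g k io).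
Qed.

Lemma lifts_munit (c d x y : ob C) (j : hom c d) (r : hom x y) :
  lifts j r -> lifts (idm (munit T) ⊗ j) r.
Proof.
move=> lj u v uv; have [h [h1 h2]] := lj (u ∘ lunit_inv T c) (v ∘ lunit_inv T d)
  ltac:(by rewrite compA uv -!compA lunit_inv_nat).
exists (h ∘ lunit T d).
by rewrite -compA lunit_nat compA h1 -compA lunitK compm1 compA h2 -compA lunitK compm1.
Qed.

(* the pushout-product of j with the map from the initial object to b *)
Lemma tens_cofibrant (b c d : ob C) (j : hom c d) : cofibrant M b -> cof M j ->
  cof M (idm b ⊗ j) /\ (is_weq M j -> is_weq M (idm b ⊗ j)).
Proof.
move=> cb cj; have [_ cc _] := MC; have [o io] := has_initial cc; have [i _] := io b.
have iod := initial_tens d io; have [p _] := iod (tens T b c).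
have po : is_pushout (idm o ⊗ j) (i ⊗ idm c) p (idm (tens T b c)).
  split; first exact: (initial_eq _ _ (initial_tens c io)).
  move=> y p' q' _; exists q'; split; last by move=> h [_ <-]; rewrite compm1.
  by rewrite compm1; split=> //; apply: initial_eq iod.
have [|ch wh] := PP (cb o i io) cj po (h := idm b ⊗ j) _ (compm1 _).
  exact: initial_eq iod.
by split=> // wj; apply: wh; right.
Qed.

(* the pushout-product of j with the unit, precomposed with a pushout of j *)
Lemma tens_cof_unit (b c d : ob C) (i : hom (munit T) b) (j : hom c d) : cof M i -> cof M j ->
  cof M (idm b ⊗ j) /\ (is_weq M j -> is_weq M (idm b ⊗ j)).
Proof.
move=> ci cj; have [_ cc MS] := MC.
have [e [p [q po]]] := has_pushout (idm (munit T) ⊗ j) (i ⊗ idm c) cc.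
have [_ pU] := po.
have [|h [[hp hq] _]] := pU _ (i ⊗ idm d) (idm b ⊗ j); first by rewrite -!tensM !comp1m !compm1.
have [ch wh] := PP ci cj po hp hq.
have cq : cof M q.
  apply/(cof_llp MC) => x y r tr; apply: (lifts_pushout po); apply: lifts_munit.
  by move/(cof_llp MC): cj => /(_ _ _ r tr).
rewrite -hq; split=> [|wj]; first exact: cof_comp.
have [_ wq] : tcof M q.
  apply/(tcof_llp MC) => x y r tr; apply: (lifts_pushout po); apply: lifts_munit.
  by have /(tcof_llp MC) : tcof M j by []; apply.
by apply: (model_closed MC) => //; apply: wh; right.
Qed.
End TensorQuillen.

Section ModModel.
Variables (C : category) (T : sym_monoidal C) (M : premodel C) (A : monoid T).
Hypothesis MC : is_model_category M.
Hypothesis HA : is_model_category (Mod_model M A).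

Lemma free_tcof (x y : ob C) (j : hom x y) : tcof M j -> tcof (Mod_model M A) (fmap (free A) j).
Proof.
move=> tj; apply/(tcof_llp HA) => X Y p fp; apply/(lifts_adj (free_adj A)).
by move/(tcof_llp MC): tj; apply.
Qed.

Variables (H : functor C (Mod A)) (ad : adjunction (forget A) H).
Hypothesis tens_cof : forall (c d : ob C) (j : hom c d), cof M j ->
  cof M (tensm T (idm A) j) /\ (is_weq M j -> is_weq M (tensm T (idm A) j)).

(** Fibrations of modules are detected in [C], so [j] has to lift against the underlying map of
    [fmap H p]. By the two adjunctions this means that the tensor product of [A] with [j] lifts
    against [p]; cofibrations of modules never have to be identified. *)
Lemma coinduced_tfib (x y : ob C) (p : hom x y) : tfib M p -> tfib (Mod_model M A) (fmap H p).
Proof.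
move=> tp; apply/(tfib_rlp MC) => a b j cj.
apply/(lifts_adj (free_adj A)); apply/(lifts_adj ad).
by have [ct _] := tens_cof cj; apply: (ms_lift_tfib _ ct tp); case: MC.
Qed.
End ModModel.

(** ** Reflecting equivalences of mapping spaces *)

Section MapFunWeq.
Variables (C : category) (W : wclass C) (WM : weq_closed W) (Q : functor C C).
Hypothesis hQ : preserves W W Q.

(** By naturality up to homotopy, the functor followed by composition with [q y] is precomposition
    with [q x], and both of these compositions are equivalences. *)
Lemma map_fun_weq_over (q : nat_trans Q (fid C)) x y :
  (forall z, wmap W (q z)) -> sset_weq (map_fun hQ x y).
Proof.
move=> wq; apply: (weq_cancel_left (map_post_weq WM (wq y) (Q x))).
have /heq_sym e := @map_fun_nat _ _ _ _ _ _ hQ (@preserves_id C W) q x y WM.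
rewrite map_fun_id smap_comps1 in e.
exact: (weq_heq e (map_pre_weq WM (wq x) y)).
Qed.

Lemma map_fun_weq_under (r : nat_trans (fid C) Q) x y :
  (forall z, wmap W (r z)) -> sset_weq (map_fun hQ x y).
Proof.
move=> wr; apply: (weq_cancel_left (map_pre_weq WM (wr x) (Q y))).
have e := @map_fun_nat _ _ _ _ _ _ (@preserves_id C W) hQ r x y WM.
rewrite map_fun_id smap_comps1 in e.
exact: (weq_heq e (map_post_weq WM (wr y) x)).
Qed.

Lemma map_post_square x y0 y1 z0 z1 (f : hom y0 y1) (g : hom z0 z1) (u : hom y0 z0) (v : hom y1 z1) :
  v ∘ f = g ∘ u -> wmap W u -> wmap W v ->
  sset_weq (map_post W x f) <-> sset_weq (map_post W x g).
Proof.
move=> e /(map_post_weq WM) wu /(map_post_weq WM) wv.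
have {}e : map_post W x v \os map_post W x f = map_post W x g \os map_post W x u.
  by rewrite !map_postM e.
split=> h; first by apply: (weq_cancel_right (wu x)); rewrite -e; apply: weq_comp.
by apply: (weq_cancel_left (wv x)); rewrite e; apply: weq_comp.
Qed.
End MapFunWeq.

Section Reflect.
Variables (C D : category) (WC : wclass C) (WD : wclass D).
Hypothesis WCM : weq_closed WC.
Variables (G : functor C D) (G' : functor D C) (Q : functor C C).
Hypotheses (hG : preserves WC WD G) (hG' : preserves WD WC G') (hQ : preserves WC WC Q).

(* Applying G and then G' exhibits map(x, f) as a retract of map(G x, g), up to
   homotopy and weak equivalences; [map_fun_nat] identifies the composite. *)
Lemma map_post_reflect (s : nat_trans Q (fcomp G' G)) (x y0 y1 : ob C) (f : hom y0 y1)
    (z0 z1 : ob D) (g : hom z0 z1) (t0 : hom (G y0) z0) (t1 : hom (G y1) z1) :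
  sset_weq (map_fun hQ x y0) -> sset_weq (map_fun hQ x y1) ->
  g ∘ t0 = t1 ∘ fmap G f ->
  wmap WC (fmap G' t0 ∘ s y0) -> wmap WC (fmap G' t1 ∘ s y1) ->
  sset_weq (map_post WD (G x) g) -> sset_weq (map_post WC x f).
Proof.
move=> wQ0 wQ1 gt ws0 ws1.
pose S z := map_pre WC (G' z) (s x) \os map_fun hG' (G x) z.
have ST y z (t : hom (G y) z) :
    heq (S z \os (map_post WD (G x) t \os map_fun hG x y))
        (map_post WC (Q x) (fmap G' t ∘ s y) \os map_fun hQ x y).
  have hG'G : preserves WC WC (fcomp G' G) by apply: (preserves_comp hG' hG).
  have e : S z \os (map_post WD (G x) t \os map_fun hG x y) =
      map_post WC (Q x) (fmap G' t) \os (map_pre WC (G' (G y)) (s x) \os map_fun hG'G x y).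
    rewrite (map_fun_comp hG' hG) /S smap_compA -(smap_compA (map_pre _ _ _)) map_fun_post.
    by rewrite (smap_compA (map_pre _ _ _)) map_pre_post -!smap_compA.
  rewrite e -map_postM -smap_compA; apply: heq_post.
  by apply: heq_sym; apply: (@map_fun_nat _ _ _ _ _ _ hQ hG'G s x y WCM).
have wv y z (t : hom (G y) z) : sset_weq (map_fun hQ x y) -> wmap WC (fmap G' t ∘ s y) ->
    sset_weq (map_post WC (Q x) (fmap G' t ∘ s y) \os map_fun hQ x y).
  by move=> wQ ws; apply: weq_comp wQ; apply: map_post_weq.
apply: (weq_retract (e := map_post WC (Q x) (fmap G' g)) _ _ _ (ST y0 z0 t0) (ST y1 z1 t1)).
- by rewrite smap_compA map_postM gt -map_postM -!smap_compA map_fun_post.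
- by rewrite /S !smap_compA -map_pre_post -!smap_compA map_fun_post.
- rewrite smap_compA map_postM -smap_compA map_fun_post smap_compA map_postM.
  by congr (map_post _ _ _ \os _); rewrite compA -fmapM gt fmapM -!compA (nt_nat s).
- exact: wv.
- exact: wv.
Qed.

(** The dual retract: here the counit [ev] is natural and the unit [s] is needed only at [w], so the
    triangle identity is the one at the source of the mapping spaces. *)
Lemma map_post_reflect_pre (R : functor C C) (hR : preserves WC WC R)
    (ev : nat_trans (fcomp G' G) R) (w : ob D) (s : hom w (G (G' w))) (y0 y1 : ob C) (f : hom y0 y1) :
  sset_weq (map_fun hR (G' w) y0) -> sset_weq (map_fun hR (G' w) y1) ->
  wmap WC (ev (G' w) ∘ fmap G' s) ->
  sset_weq (map_post WD w (fmap G f)) -> sset_weq (map_post WC (G' w) f).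
Proof.
move=> wR0 wR1 ws.
have hG'G : preserves WC WC (fcomp G' G) by apply: (preserves_comp hG' hG).
pose S y := map_post WC (G' w) (ev y) \os map_fun hG' w (G y).
have ST y :
    heq (S y \os (map_pre WD (G y) s \os map_fun hG (G' w) y))
        (map_pre WC (R y) (ev (G' w) ∘ fmap G' s) \os map_fun hR (G' w) y).
  have e : S y \os (map_pre WD (G y) s \os map_fun hG (G' w) y) =
      map_pre WC (R y) (fmap G' s) \os
        (map_post WC (G' (G (G' w))) (ev y) \os map_fun hG'G (G' w) y).
    rewrite (map_fun_comp hG' hG) /S smap_compA -(smap_compA (map_post _ _ _)) map_fun_pre.
    by rewrite (smap_compA (map_post _ _ _)) -map_pre_post -!smap_compA.
  rewrite e -map_preM -smap_compA; apply: heq_post.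
  exact: (@map_fun_nat _ _ _ _ _ _ hG'G hR ev (G' w) y WCM).
have wv y : sset_weq (map_fun hR (G' w) y) ->
    sset_weq (map_pre WC (R y) (ev (G' w) ∘ fmap G' s) \os map_fun hR (G' w) y).
  by move=> wR; apply: weq_comp wR; apply: map_pre_weq.
apply: (weq_retract (e := map_post WC (G' w) (fmap R f)) _ _ _ (ST y0) (ST y1)).
- by rewrite smap_compA -map_pre_post -!smap_compA map_fun_post.
- rewrite /S smap_compA map_postM -(nt_nat ev) -map_postM -!smap_compA.
  by rewrite (map_fun_post hG').
- by rewrite smap_compA -map_pre_post -!smap_compA map_fun_post.
- exact: wv.
- exact: wv.
Qed.
End Reflect.

(** * Colocalization of modules *)

Section Adjunction.
Variables (C D : category) (L : functor C D) (R : functor D C) (ad : adjunction L R).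

Definition unit x : hom x (R (L x)) := adj ad (idm (L x)).
Definition counit y : hom (L (R y)) y := adj_inv ad (idm (R y)).

Lemma adj_unit x y (f : hom (L x) y) : adj ad f = fmap R f ∘ unit x.
Proof. by rewrite /unit -adj_natr compm1. Qed.

Lemma unit_nat x y (f : hom x y) : unit y ∘ f = fmap R (fmap L f) ∘ unit x.
Proof. by rewrite -adj_unit -adj_natl comp1m. Qed.

Lemma counit_unit y : fmap R (counit y) ∘ unit (R y) = idm (R y).
Proof. by rewrite -adj_unit adj_invK. Qed.

Lemma adj_inj x y (f g : hom (L x) y) : adj ad f = adj ad g -> f = g.
Proof. by move=> e; rewrite -(adjK ad f) e adjK. Qed.

Lemma counit_nat y z (f : hom y z) : counit z ∘ fmap L (fmap R f) = f ∘ counit y.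
Proof. by apply: adj_inj; rewrite adj_natl adj_natr !adj_invK comp1m compm1. Qed.

Lemma unit_counit x : counit (L x) ∘ fmap L (unit x) = idm (L x).
Proof. by apply: adj_inj; rewrite adj_natl adj_invK comp1m. Qed.
End Adjunction.

Lemma ho_iso_refl (C : category) (W : mclass C) x : ho_iso W x x.
Proof. by exists (zz_nil x), (zz_nil x); split; apply: rst_refl. Qed.

(** * From colocal equivalences of modules to underlying colocal equivalences *)

Section ForgetReflects.
Variables (C : category) (T : sym_monoidal C) (M : premodel C) (A : monoid T).
Hypotheses (MC : is_model_category M) (MA : is_model_category (Mod_model M A)).
Local Notation W := (weq M).
Local Notation WA := (Mod_weq M A).

(** The retract comes from a triangle identity: the unit at [Q (U Z)] followed by [U] of the derived
    counit [t Z] is the replacement map [q], a weak equivalence. *)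
Lemma free_colocal_equivalence (K : ob C -> Prop) (X Y : ob (Mod A)) (f : hom X Y) :
  colocal_equivalence (Mod_model M A) (derived_free M (A := A) K) f ->
  colocal_equivalence M K (fmap (forget A) f).
Proof.
move=> fK k Kk; have [Q [q [cQ tq hQ]]] := cofibrant_replacement MC.
have wq x : is_weq M (q x) by case: (tq x).
have [_ _ MAS] := MA; have WM := model_closed MC.
have hFQ : preserves W WA (fcomp (free A) Q).
  move=> x y g wg; apply: (@ken_brown _ _ MC _ WA (free A) (ms_2of3 MAS)); last exact: (hQ _ _ _ wg).
  - by move=> u v i ti; case: (free_tcof MC MA ti).
  - exact: cQ.
  - exact: cQ.
unshelve epose (s := @NatTrans C C Q (fcomp (forget A) (fcomp (free A) Q))
  (fun x => unit (free_adj A) (Q x)) _).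
  by move=> x y g; apply: (unit_nat (free_adj A) (fmap Q g)).
pose t (Z : ob (Mod A)) := adj_inv (free_adj A) (q (forget A Z)).
have st Z : fmap (forget A) (t Z) ∘ s (forget A Z) = q (forget A Z).
  by rewrite -[LHS](adj_unit (free_adj A)) adj_invK.
have hU : preserves WA W (forget A) by [].
apply: (@map_post_reflect _ _ W WA WM (fcomp (free A) Q) (forget A) Q hFQ hU hQ s
  k _ _ _ X Y f (t X) (t Y)).
- exact: (@map_fun_weq_over _ W WM Q hQ q _ _ wq).
- exact: (@map_fun_weq_over _ W WM Q hQ q _ _ wq).
- apply: (adj_inj (ad := free_adj A)); rewrite adj_natr adj_natl !adj_invK.
  by symmetry; apply: (nt_nat q).
- by rewrite st.
- by rewrite st.
- apply: fK; exists k, (Q k), (q k); split=> //.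
  exact: (@ho_iso_refl (Mod A) (wmap WA) (free_module A (Q k))).
Qed.
End ForgetReflects.

(** * Derived adjoints and mapping spaces *)

Lemma map_pre_post_weq (C : category) (W : wclass C) (WM : weq_closed W) (x x' y0 y1 : ob C)
    (w : hom x' x) (f : hom y0 y1) :
  wmap W w -> sset_weq (map_post W x f) -> sset_weq (map_post W x' f).
Proof.
move=> ww wf; apply: (weq_cancel_right (map_pre_weq WM ww y0)).
by rewrite -map_pre_post; apply: weq_comp => //; apply: map_pre_weq.
Qed.

(** [R] preserves all weak equivalences, hence needs no fibrant replacement, and [S] is the left
    derived functor of [L]. In a Quillen equivalence this is also a right adjoint of [R] on homotopy
    categories, which is the side used here. *)
Lemma quillen_equivalence_map (C D : category) (M : premodel C) (N : premodel D)
    (L : functor C D) (R : functor D C) (ad : adjunction L R) :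
  is_model_category M -> is_model_category N -> quillen_equivalence M N ad ->
  preserves (weq N) (weq M) R ->
  exists S : functor C D, forall X (y0 y1 : ob C) (g : hom y0 y1),
    sset_weq (map_post (weq N) X (fmap S g)) <-> sset_weq (map_post (weq M) (R X) g).
Proof.
move=> MC NC [[_ Ltcof] Lequiv] hR.
have [_ _ MS] := MC; have [_ _ NS] := NC.
have WM := model_closed MC; have WN := model_closed NC.
have [Q [q [cQ tq hQ]]] := cofibrant_replacement MC.
have wq x : is_weq M (q x) by case: (tq x).
have [B [r [fB tr _]]] := fibrant_replacement NC.
have wr x : is_weq N (r x) by case: (tr x).
pose S := fcomp L Q.
have hS : preserves (weq M) (weq N) S.
  move=> x y g wg; apply: (@ken_brown _ _ MC _ (weq N) L (ms_2of3 NS)); last exact: (hQ _ _ _ wg).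
  - by move=> u v i ti; case: (Ltcof _ _ _ ti).
  - exact: cQ.
  - exact: cQ.
unshelve epose (u := @NatTrans C C Q (fcomp R S) (fun x => unit ad (Q x)) _).
  by move=> x y g; apply: (unit_nat ad (fmap Q g)).
have wu x : is_weq M (u x).
  apply: (@weq_left _ _ _ _ _ (fmap R (r (S x))) _ (adj ad (r (S x))) (ms_2of3 MS)).
  - by rewrite [RHS]adj_unit.
  - exact: hR.
  - exact: (proj1 (Lequiv _ _ (r (S x)) (cQ x) (fB (S x))) (wr _)).
pose b X : hom (S (R X)) X := adj_inv ad (q (R X)).
have b_nat X Y (f : hom X Y) : b Y ∘ fmap S (fmap R f) = f ∘ b X.
  apply: (adj_inj (ad := ad)); rewrite [RHS]adj_natr /b adj_invK.
  refine (etrans (adj_natl ad (fmap Q (fmap R f)) (b Y)) _).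
  by rewrite /b adj_invK; apply: (nt_nat q).
(* The Quillen equivalence speaks only of fibrant targets, so the claim is proved at [B X] and
   carried back along [r X] by naturality of [b]. *)
have wb X : is_weq N (b X).
  apply: (@weq_left _ _ _ _ _ (r X) _ (b (B X) ∘ fmap S (fmap R (r X))) (ms_2of3 NS)) => //.
  apply: WN; last exact/hS/hR.
  by apply: (proj2 (Lequiv _ _ (b (B X)) (cQ _) (fB X))); rewrite /b adj_invK; apply: wq.
pose bn := @NatTrans D D (fcomp S R) (fid D) b b_nat.
have hSR : preserves (weq N) (weq N) (fcomp S R) by apply: (preserves_comp hS hR).
exists S => X y0 y1 g; split=> wg.
- apply: (@map_post_reflect _ _ (weq M) (weq N) WM S R Q hS hR hQ u (R X) _ _ g _ _
    (fmap S g) (idm _) (idm _)).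
  + exact: (@map_fun_weq_over _ _ WM Q hQ q).
  + exact: (@map_fun_weq_over _ _ WM Q hQ q).
  + by rewrite comp1m compm1.
  + by rewrite fmap1 comp1m.
  + by rewrite fmap1 comp1m.
  + exact: (map_pre_post_weq WN (wb X) wg).
(* [g] and [fmap R (fmap S g)] are joined by the natural weak equivalences [q] and [u] out of
   [fmap Q g]. *)
- have w2 : sset_weq (map_post (weq M) (R X) (fmap R (fmap S g))).
    apply: (proj1 (map_post_square WM (R X) (nt_nat u g) (wu y0) (wu y1))).
    exact: (proj2 (map_post_square WM (R X) (nt_nat q g) (wq y0) (wq y1)) wg).
  unshelve epose (s := @NatTrans D D (fcomp S R) (fcomp S R) (fun x => idm _) _).
    by move=> x y f /=; rewrite comp1m compm1.
  apply: (@map_post_reflect _ _ (weq N) (weq M) WN R S (fcomp S R) hR hS hSR s X _ _ (fmap S g) _ _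
    (fmap R (fmap S g)) (idm _) (idm _)).
  + exact: (@map_fun_weq_over _ _ WN _ hSR bn).
  + exact: (@map_fun_weq_over _ _ WN _ hSR bn).
  + by rewrite comp1m compm1.
  + by rewrite /= !fmap1 comp1m; apply: is_weq1.
  + by rewrite /= !fmap1 comp1m; apply: is_weq1.
  + exact: w2.
Qed.

Lemma weq_id X : sset_weq (smap_id X).
Proof. by apply: (@weq_inverse _ _ _ (smap_id X)) => Z _ k; apply: homotopic_refl. Qed.

(* P is the right derived functor of the right adjoint of U. *)
Lemma right_derived_map (C D : category) (M : premodel C) (W : wclass D)
    (U : functor D C) (H : functor C D) (ad : adjunction U H) :
  is_model_category M -> two_of_three (wmap W) -> preserves W (weq M) U ->
  (forall x y (p : hom x y), tfib M p -> wmap W (fmap H p)) ->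
  exists P : functor C D, forall X (y0 y1 : ob C) (g : hom y0 y1),
    sset_weq (map_post W X (fmap P g)) <-> sset_weq (map_post (weq M) (U X) g).
Proof.
move=> MC W3 hU Htfib.
have [_ _ MS] := MC; have WM := model_closed MC; have WW := two_of_three_closed W3.
have [R [r [fR tr hR]]] := fibrant_replacement MC.
have wr x : is_weq M (r x) by case: (tr x).
have hH x y (f : hom x y) : fibrant M x -> fibrant M y -> is_weq M f -> wmap W (fmap H f).
  exact: (@ken_brown_dual _ _ MC _ W H W3).
pose P := fcomp H R.
have hP : preserves (weq M) W P.
  by move=> x y g wg; apply: hH; [exact: fR|exact: fR|exact: (hR _ _ _ wg)].
unshelve epose (ev := @NatTrans C C (fcomp U P) R (fun x => counit ad (R x)) _).
  by move=> x y g; apply: (counit_nat ad (fmap R g)).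
pose s X : hom X (P (U X)) := fmap H (r (U X)) ∘ unit ad X.
have s_nat X Y (f : hom X Y) : s Y ∘ f = fmap P (fmap U f) ∘ s X.
  rewrite /s -compA unit_nat !compA; congr (_ ∘ _).
  by rewrite -[fmap P _]/(fmap H (fmap R (fmap U f))) -!fmapM (nt_nat r (fmap U f)).
pose sn := @NatTrans D D (fid D) (fcomp P U) s s_nat.
exists P => X y0 y1 g; split=> wg.
- apply: (@map_post_reflect_pre _ _ (weq M) W WM P U hP hU R hR ev X (s X) _ _ g).
  + exact: (@map_fun_weq_under _ _ WM R hR r).
  + exact: (@map_fun_weq_under _ _ WM R hR r).
  (* The triangle identity at [U X], up to the fibrant replacement [r (U X)]. *)
  + have -> : ev (U X) ∘ fmap U (s X) = r (U X); last exact: wr.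
    rewrite -[LHS]/(counit ad (R (U X)) ∘ fmap U (fmap H (r (U X)) ∘ unit ad X)).
    by rewrite fmapM compA counit_nat -compA unit_counit compm1.
  + exact: wg.
(* The other triangle identity leaves [fmap H (r (R y))]. This is a weak equivalence because
   [r (R y)] is a map between fibrant objects. *)
- have st y : fmap P (counit ad (R y)) ∘ sn (P y) = fmap H (r (R y)).
    rewrite -[LHS]/(fmap H (fmap R (counit ad (R y))) ∘ (fmap H (r _) ∘ unit ad (P y))).
    rewrite compA -fmapM -(nt_nat r (counit ad (R y))) fmapM -compA.
    by rewrite (counit_unit ad (R y)) compm1.
  apply: (@map_post_reflect _ _ W (weq M) WW U P (fid D) hU hP (@preserves_id D W) sn X _ _
    (fmap P g) _ _ (fmap R g) (counit ad (R y0)) (counit ad (R y1))).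
  + by rewrite map_fun_id; apply: weq_id.
  + by rewrite map_fun_id; apply: weq_id.
  + by rewrite (counit_nat ad (fmap R g)).
  + by rewrite st; apply: hH (wr _); apply: fR.
  + by rewrite st; apply: hH (wr _); apply: fR.
  + exact: (proj1 (map_post_square WM (U X) (nt_nat r g) (wr y0) (wr y1)) wg).
Qed.

Theorem theorem4p4 (C : category) (T : sym_monoidal C) (M : premodel C)
    (HM : is_sym_monoidal_model T M) (HMgen : cofibrantly_generated M)
    (A : monoid T) (HA : strongly_admissible M A)
    (K : ob C -> Prop) (HK : is_iso_class_set M K)
    (Hund : underlying_colocal M K (derived_free M (A := A) K))
    (Hgood : good_colocalization (Mod_model M A) (derived_free M (A := A) K))
    (X' X : ob (Mod A)) (f : hom X' X) :
  colocalization (Mod_model M A) (derived_free M (A := A) K) f ->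
  colocalization M K (fmap (forget A) f).
Proof.
case=> fK X'K; have [MC TC _ _] := HM.
have [A' [phi [_ [MA _] [MA' _] [L [ad Lequiv]] cofA']]] := HA.
split; first exact: free_colocal_equivalence.
have [S SE] := quillen_equivalence_map MA' MA Lequiv
  (fun (x y : ob (Mod A)) (f : hom x y) (h : wmap (Mod_weq M A) f) => h).
have [H [adH]] := forget_right_adjoint A' TC.
have tens_cof (c d : ob C) (j : hom c d) : cof M j ->
    cof M (tensm T (idm A') j) /\ (is_weq M j -> is_weq M (tensm T (idm A') j)).
  (* The two kinds of strong admissibility: [A'] is cofibrant, or the unit of [A'] is a
     cofibration. *)
  by move=> cj; case: cofA' => [cA|[cA _]]; [apply: tens_cofibrant|apply: tens_cof_unit cA cj].
have [_ _ MAS'] := MA'.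
have [P PE] := right_derived_map (W := Mod_weq M A') adH MC (ms_2of3 MAS')
  (fun x y f (h : wmap (Mod_weq M A') f) => h)
  (fun x y p tp => proj2 (coinduced_tfib MC adH tens_cof tp)).
(* The two equivalences combine because restricting [Y] along [phi] keeps its underlying object, up
   to conversion. *)
have UE (Y : ob (Mod A)) y0 y1 (g : @hom C y0 y1) :
    sset_weq (map_post (weq (Mod_model M A)) Y (fmap S (fmap P g))) <->
    sset_weq (map_post (weq M) (forget A Y) g).
  by rewrite SE; apply: (PE (restrict phi Y)).
(* Colocality of [X'] is applied to the module map [fmap S (fmap P g)]; testing that map on [l]
   amounts to testing [g] on the underlying object of [l], which is colocal. *)
move=> y0 y1 g gK; apply/UE; apply: X'K => l lK; apply/UE.
exact: (Hund l lK _ _ g gK).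
Qed.
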